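(* Let $\vartheta>0$ and $H\in(1/2,1)$. The least squares estimator $$\bar\vartheta_T=-\frac{X_T^2}{2\int_0^T X_t^2dt}+\frac{\alpha_H\int_0^T\int_0^t e^{-\vartheta(t-s)}\big((t-s)^{2H-2}+(t+s)^{2H-2}\big)\,ds\,dt}{\int_0^T X_t^2dt}+\frac{T}{2\int_0^T X_t^2dt}$$ converges to $\vartheta$ in probability as $T\to\infty$: for every $\varepsilon>0$, $\lim_{T\to\infty}\mathbf P(|\bar\vartheta_T-\vartheta|>\varepsilon)=0$.
   Context: $\alpha_H=H(2H-1)$. A sub-fractional Brownian motion $S^H$ is a centered Gaussian process with $S^H_0=0$ and covariance $\mathbf E(S^H_tS^H_s)=t^{2H}+s^{2H}-\frac12(|t-s|^{2H}+(t+s)^{2H})$; the mixed sub-fractional Brownian motion is $\xi_t=W_t+S^H_t$ with $W$ a standard Brownian motion independent of $S^H$. The mixed sub-fractional Ornstein–Uhlenbeck process is $X_t=\int_0^t e^{-\vartheta(t-s)}d\xi_s$, i.e. the solution of $dX_t=-\vartheta X_tdt+d\xi_t$, $X_0=0$. *)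

(* Defs.v *)
From HB Require Import structures.
From mathcomp Require Import all_boot all_order all_algebra.
From mathcomp Require Import all_classical all_reals all_analysis.
Set Implicit Arguments. Unset Strict Implicit. Unset Printing Implicit Defensive.
Import Order.TTheory GRing.Theory Num.Theory.
Import numFieldNormedType.Exports.
Local Open Scope classical_set_scope.
Local Open Scope ring_scope.

(* A stochastic process on the time set [0, +oo) is modelled as
   Z : Omega -> R -> R, (omega, t) |-> Z_t(omega); values at t < 0 are irrelevant. *)

Definition is_normal_rv {R : realType} {d : measure_display} {Omega : measurableType d}
  (P : probability Omega R) (Y : Omega -> R) (m v : R) : Prop :=
  measurable_fun setT Y /\
  (if v == 0 then P [set w | Y w != m] = 0%E
   else forall A : set R, measurable A ->
          P (Y @^-1` A) = normal_prob m (Num.sqrt v) A).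

Definition centered_gaussian_process {R : realType} {d : measure_display}
  {Omega : measurableType d} (P : probability Omega R)
  (Z : Omega -> R -> R) (K : R -> R -> R) : Prop :=
  forall (n : nat) (t : 'I_n -> R) (c : 'I_n -> R),
    (forall i, 0 <= t i) ->
    is_normal_rv P (fun w => \sum_(i < n) c i * Z w (t i)) 0
      (\sum_(i < n) \sum_(j < n) c i * c j * K (t i) (t j)).

Definition indep_processes {R : realType} {d : measure_display}
  {Omega : measurableType d} (P : probability Omega R)
  (W S : Omega -> R -> R) : Prop :=
  forall (n m : nat) (t : 'I_n -> R) (s : 'I_m -> R)
         (A : 'I_n -> set R) (B : 'I_m -> set R),
    (forall i, 0 <= t i) -> (forall j, 0 <= s j) ->
    (forall i, measurable (A i)) -> (forall j, measurable (B j)) ->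
    let E1 := \bigcap_(i in [set: 'I_n]) ((fun w => W w (t i)) @^-1` A i) in
    let E2 := \bigcap_(j in [set: 'I_m]) ((fun w => S w (s j)) @^-1` B j) in
    P (E1 `&` E2) = (P E1 * P E2)%E.

Definition bm_cov {R : realType} (t s : R) : R := Num.min t s.

Definition subfbm_cov {R : realType} (H : R) (t s : R) : R :=
  t `^ (2 * H) + s `^ (2 * H)
  - 2^-1 * (`|t - s| `^ (2 * H) + (t + s) `^ (2 * H)).

Definition brownian_motion {R : realType} {d : measure_display}
  {Omega : measurableType d} (P : probability Omega R) (W : Omega -> R -> R) : Prop :=
  centered_gaussian_process P W bm_cov /\
  (forall w, W w 0 = 0) /\
  (forall w, {within [set t | 0 <= t], continuous (W w)}).

Definition subfbm {R : realType} {d : measure_display}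
  {Omega : measurableType d} (P : probability Omega R) (H : R)
  (S : Omega -> R -> R) : Prop :=
  centered_gaussian_process P S (subfbm_cov H) /\
  (forall w, S w 0 = 0) /\
  (forall w, {within [set t | 0 <= t], continuous (S w)}).

Definition alpha_H {R : realType} (H : R) : R := H * (2 * H - 1).

Definition double_kernel_integral {R : realType} (theta H T : R) : R :=
  Rintegral lebesgue_measure `[0, T]
    (fun t => Rintegral lebesgue_measure `[0, t]
       (fun s => expR (- theta * (t - s)) *
                 ((t - s) `^ (2 * H - 2) + (t + s) `^ (2 * H - 2)))).

Definition lse {R : realType} {d : measure_display} {Omega : measurableType d}
  (theta H : R) (X : Omega -> R -> R) (T : R) (w : Omega) : R :=
  let I := Rintegral lebesgue_measure `[0, T] (fun t => X w t ^+ 2) in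
  - (X w T ^+ 2 / (2 * I))
  + alpha_H H * double_kernel_integral theta H T / I
  + T / (2 * I).

(* Main.v *)
(* Write z for the mixed process [W + S], extended by [z t = 0] for [t <= 0],
   and let [mu] be the exponential law of rate [theta]. The solution of the
   Langevin equation is the moving average
   [X t = int (z t - z (t - r)) dmu(r)], so that
   [E (X t)^2] is at most [Gamma = int (r + r^(2H)) dmu(r)] for all [t].
   Replacing [r] by a step function of [r] turns [X] into a finite linear
   combination [Y] of increments of [z], uniformly close to [X] in mean square.
   Since [W] and [S] are Gaussian and independent, the covariance of
   [(Y t)^2] and [(Y s)^2] is [2 E(Y t Y s)^2], and this vanishes away from the
   diagonal because second differences of [x^(2H)] tend to [0]. Hence the time
   averages of [Y^2], and then those of [X^2], converge in mean to [Gamma / 2].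
   The deterministic numerator is computed with the recursion
   [p E r^(p-1) = theta E r^p] for the moments of [mu]: its time average tends to
   [theta Gamma / 2]. The estimator is the quotient, up to [X_T^2 / T], which
   is negligible, and Markov's inequality concludes. *)
Require Import Defs.
From HB Require Import structures.
From mathcomp Require Import all_boot all_order all_algebra.
From mathcomp Require Import finmap.
From mathcomp Require Import all_classical all_reals all_analysis.
From mathcomp Require Import measurable_realfun ring lra.
Set Implicit Arguments. Unset Strict Implicit. Unset Printing Implicit Defensive.
Import Order.TTheory GRing.Theory Num.Theory.
Import numFieldNormedType.Exports.
Import HBNNSimple.
Local Open Scope classical_set_scope.
Local Open Scope ring_scope.

(** Of the Gaussian noise only second and fourth moments are used. The Langevin equation is solved
    path by path, by differentiating [exp(theta s)] times the primitive of [X], so no stochastic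
    integral occurs. Since [z] vanishes at negative times, one law [mu] serves for every [t], and
    the mean-square errors are uniform in [t].

    The obstacle is that fourth moments come from finite combinations of the process, whereas [X] is
    an integral. They are therefore used for [Y] alone; [X^2] is compared with [Y^2] in mean, for
    which closeness in mean square suffices.

    The factor in [Gamma / 2] arises as follows. Put [f r = r + r^(2H)]. Far from time 0, increments
    with lags [r] and [q] at a common time have covariance close to [(f r + f q - f |r - q|) / 2],
    and for independent exponential [r] and [q] the distance [|r - q|] is again exponential of the
    same rate, so each of the three terms averages to [Gamma]. Brownian motion is the case [2H = 1]
    of the same covariance. The limit of the numerator is [theta Gamma / 2 = 1/2 + theta E r^(2H) /
    2], where the term [T / 2] gives the first summand and the kernel integral the second. *)

Local Notation leb := lebesgue_measure.

(** * Integration *)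

(** For an indicator this is the definition of the density; monotone convergence along simple
    functions extends it to nonnegative [f]. It turns integrals against the normal and exponential
    laws into Lebesgue integrals. *)
Lemma integral_density d (T : measurableType d) (R : realType)
    (m nu : {measure set T -> \bar R}) (g : T -> R) (f : T -> \bar R) :
  measurable_fun [set: T] g -> (forall x, 0 <= g x) ->
  (forall A, measurable A -> nu A = \int[m]_(x in A) (g x)%:E)%E ->
  measurable_fun [set: T] f -> (forall x, 0 <= f x)%E ->
  (\int[nu]_x f x = \int[m]_x (f x * (g x)%:E))%E.
Proof.
move=> mg g0 nuE mf f0.
pose f_ := nnsfun_approx measurableT mf.
have fE x : EFin \o f_ ^~ x @ \oo --> f x by apply: cvg_nnsfun_approx.
have fgE x : (EFin \o (fun n => f_ n x * g x)) @ \oo --> (f x * (g x)%:E)%E.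
  rewrite (_ : _ \o _ = fun n => ((EFin \o f_ ^~ x) n * (g x)%:E)%E); last first.
    by apply/funext => n /=; rewrite EFinM.
  exact: cvgeZr.
transitivity (limn (fun n => \int[nu]_x (f_ n x)%:E))%E.
  rewrite -monotone_convergence//.
  - by apply: eq_integral => x _; apply/esym/cvg_lim => //; exact: fE.
  - by move=> n; exact/measurable_EFinP/measurable_funP.
  - by move=> n y _; rewrite lee_fin.
  - by move=> y _ a b ab; rewrite lee_fin; exact/lefP/nd_nnsfun_approx.
transitivity (limn (fun n => \int[m]_x (f_ n x * g x)%:E))%E; last first.
  rewrite -monotone_convergence//.
  - by apply: eq_integral => x _; apply/cvg_lim => //; exact: fgE.
  - by move=> n; apply/measurable_EFinP; apply: measurable_funM.
  - by move=> n y _; rewrite lee_fin mulr_ge0.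
  - move=> y _ a b ab; rewrite lee_fin ler_wpM2r//.
    exact/lefP/nd_nnsfun_approx.
congr (limn _); apply/funext => n.
transitivity (\sum_(k \in range (f_ n))
    \int[nu]_x (k * \1_(f_ n @^-1` [set k]) x)%:E)%E.
  under eq_integral do rewrite fimfunE -fsumEFin//.
  rewrite ge0_integral_fsum//.
  - by move=> y; exact/measurable_EFinP/measurable_funM.
  - by move=> y x _; rewrite nnfun_muleindic_ge0.
transitivity (\int[m]_x (\sum_(k \in range (f_ n))
    (k * \1_(f_ n @^-1` [set k]) x)%:E * (g x)%:E))%E; last first.
  apply: eq_integral => x _; rewrite [in RHS]fimfunE EFinM -fsumEFin//.
  by rewrite ge0_mule_fsuml// => k; rewrite nnfun_muleindic_ge0.
rewrite ge0_integral_fsum//; last 2 first.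
- move=> k; apply: emeasurable_funM; last exact/measurable_EFinP.
  exact/measurable_EFinP/measurable_funM.
- by move=> y x _; rewrite mule_ge0 ?lee_fin// -lee_fin EFinM nnfun_muleindic_ge0.
apply: eq_fsbigr => r /[!inE] -[x _ <-].
have mA : measurable (f_ n @^-1` [set f_ n x]) by [].
under eq_integral do rewrite EFinM.
rewrite ge0_integralZl//; last 2 first.
- exact/measurable_EFinP.
- by rewrite lee_fin.
rewrite integral_indic// setIT nuE// integral_mkcond -ge0_integralZl//; last 3 first.
- exact/(measurable_restrictT _ _).1/measurable_EFinP/measurable_funTS.
- by move=> y _; apply: erestrict_ge0 => ? _; rewrite lee_fin.
- by rewrite lee_fin.
apply: eq_integral => y _; rewrite EFinM -muleA; congr (_ * _)%E.
by rewrite patchE indicE; case: ifPn => _ /=; rewrite ?mul1e ?mul0e.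
Qed.

(** The reflection preserves Lebesgue measure, as is checked on half-open intervals. It turns
    convolutions on [[0, t]] into integrals in the lag [t - s]. *)
Lemma ge0_integral_comp_subr (R : realType) (t : R) (f : R -> \bar R) :
  measurable_fun [set: R] f -> (forall x, 0 <= f x)%E ->
  (\int[leb]_x f (t - x)%R = \int[leb]_x f x)%E.
Proof.
move=> mf f0; pose phi := (fun x => t - x) : measurableTypeR R -> measurableTypeR R.
have mphi : measurable_fun setT phi by exact: measurable_funB.
transitivity (\int[pushforward leb phi]_x f x)%E.
  by rewrite ge0_integral_pushforward.
apply: eq_measure_integral => A mA _; apply/esym/lebesgue_measure_unique => // _ [[a b]] _ <-.
rewrite -[RHS]/(leb (phi @^-1` `]a, b]%classic)).
rewrite (_ : phi @^-1` _ = `[(t - b), (t - a)[%classic); last first.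
  by apply/seteqP; split => x /=; rewrite /phi !in_itv/= => /andP[? ?]; apply/andP; split; lra.
rewrite !lebesgue_measure_itv/= !lte_fin -!EFinD.
by rewrite ltrD2l ltrN2 (_ : t - a - (t - b) = b - a)//; ring.
Qed.

(** * Simple functions and joint measurability of processes *)

Lemma max0_measurable (R : realType) :
  measurable_fun [set: R] (fun t : R => (Num.max t 0)%:E).
Proof. by apply/measurable_EFinP; exact: measurable_maxr. Qed.

(** Simple functions increasing to [max t 0]. Evaluated at the time they prove joint measurability;
    evaluated at the lag they discretize the moving average. The maximum makes the approximated
    function nonnegative. *)
Definition step_approx (R : realType) : {nnsfun measurableTypeR R >-> R}^nat :=
  @nnsfun_approx _ (measurableTypeR R) _ setT measurableT _ (@max0_measurable R).

Lemma step_approx_cvg (R : realType) (t : R) :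
  (fun n => step_approx R n t) @ \oo --> Num.max t 0.
Proof.
have : EFin \o (fun n => step_approx R n t) @ \oo --> (Num.max t 0)%:E.
  by apply: (@cvg_nnsfun_approx _ (measurableTypeR R)) => // x _; rewrite lee_fin le_max lexx orbT.
by move/fine_cvgP => [].
Qed.

Lemma step_approx_le (R : realType) n (t : R) : step_approx R n t <= Num.max t 0.
Proof.
have := @step_approx_cvg R t; move/cvg_lim => <- //.
apply: (@nondecreasing_cvgn_le _ (fun n => step_approx R n t)).
  move=> m k mk; have := @nd_nnsfun_approx _ (measurableTypeR R) _ setT measurableT _ (@max0_measurable R).
  by move=> /(_ m k mk)/lefP.
by apply/cvg_ex; exists (Num.max t 0); exact: step_approx_cvg.
Qed.

Definition sfun_values d (T : measurableType d) (R : realType)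
    (f : {nnsfun T >-> R}) : seq R := finmap.enum_fset (fset_set (range f)).

Lemma sfun_valuesP d (T : measurableType d) (R : realType) (f : {nnsfun T >-> R})
  (t : T) : f t \in sfun_values f.
Proof. by rewrite -[_ \in _]/(_ \in fset_set _) in_fset_set// inE; exists t. Qed.

Lemma sfun_values_ge0 d (T : measurableType d) (R : realType) (f : {nnsfun T >-> R}) x :
  x \in sfun_values f -> 0 <= x.
Proof.
rewrite -[_ \in _]/(_ \in fset_set _) in_fset_set// inE => -[t _ <-].
exact: fun_ge0.
Qed.

(** With [g] a path of the process, this writes its value at the time [f t] as a finite combination
    of its values at fixed times. *)
Lemma sfun_comp_sum d (T : measurableType d) (R : realType) (V : pzRingType)
    (f : {nnsfun T >-> R}) (g : R -> V) (t : T) :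
  g (f t) = \sum_(x <- sfun_values f) (f t == x)%:R * g x.
Proof.
rewrite (bigD1_seq (f t))/= ?sfun_valuesP ?finmap.fset_uniq//.
rewrite eqxx mul1r big1 ?addr0// => x.
by rewrite eq_sym => /negbTE ->; rewrite mul0r.
Qed.

Lemma sfun_eq_measurable d (T : measurableType d) (R : realType)
    (f : {nnsfun T >-> R}) (x : R) : measurable_fun [set: T] (fun t => (f t == x)%:R : R).
Proof.
rewrite (_ : (fun _ => _) = \1_(f @^-1` [set x])) //.
apply/funext => t; rewrite indicE; congr (_%:R); congr nat_of_bool.
by apply/eqP/idP => [e|]; [rewrite inE | rewrite inE].
Qed.

(** At step-valued times the process is a finite sum of products of measurable functions; continuity
    of the paths passes to the limit. *)
Lemma measurable_continuous_process d (T : measurableType d) (R : realType)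
    (Z : T -> R -> R) :
  (forall t, measurable_fun [set: T] (Z ^~ t)) ->
  (forall w, continuous (Z w)) ->
  measurable_fun [set: T * R] (fun p => Z p.1 (Num.max p.2 0)).
Proof.
move=> mZ cZ.
apply: (measurable_fun_cvg (h := fun n p => Z p.1 (step_approx R n p.2))).
  move=> n; rewrite (_ : (fun _ => _) = fun p : T * R =>
    \sum_(x <- sfun_values (step_approx R n)) (step_approx R n p.2 == x)%:R * Z p.1 x).
    apply: measurable_sum => x; apply: measurable_funM.
      exact: (measurableT_comp (sfun_eq_measurable (step_approx R n) x) measurable_snd).
    exact: (measurableT_comp (mZ x) measurable_fst).
  by apply/funext => p; rewrite [LHS](sfun_comp_sum (step_approx R n) (Z p.1)).
move=> p _.
exact: (cvg_comp _ _ (@step_approx_cvg R p.2) (cZ p.1 _)).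
Qed.

Lemma bounded_integrable d (T : measurableType d) (R : realType)
    (mu : {measure set T -> \bar R}) (D : set T) (f : T -> R) (B : R) :
  measurable D -> (mu D < +oo)%E -> measurable_fun D f ->
  (forall x, D x -> `|f x| <= B) -> mu.-integrable D (EFin \o f).
Proof.
move=> mD muD mf fB; apply: measurable_bounded_integrable => //.
exists B; split; first exact: num_real.
by move=> M BM x Dx; apply: (le_trans (fB _ Dx)); exact: ltW.
Qed.

Section integrable_EFin.
Context d (T : measurableType d) (R : realType) (mu : {measure set T -> \bar R}).
Variables (D : set T) (mD : measurable D).
Implicit Types f g : T -> R.

Lemma integrable_addr f g : mu.-integrable D (EFin \o f) ->
  mu.-integrable D (EFin \o g) -> mu.-integrable D (EFin \o (fun x => f x + g x)).
Proof. by move=> fi gi; exact: (integrableD mD fi gi). Qed.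

Lemma integrable_subr f g : mu.-integrable D (EFin \o f) ->
  mu.-integrable D (EFin \o g) -> mu.-integrable D (EFin \o (fun x => f x - g x)).
Proof. by move=> fi gi; exact: (integrableB mD fi gi). Qed.

Lemma integrable_mulr c f : mu.-integrable D (EFin \o f) ->
  mu.-integrable D (EFin \o (fun x => c * f x)).
Proof. by move=> fi; exact: (integrableZl mD c fi). Qed.

End integrable_EFin.

(** Jensen's inequality for the square: with [c] the mean of [h], integrate [2 c h - c^2 <= h^2]. *)
Lemma sqr_Rintegral_le d (T : measurableType d) (R : realType)
    (mu : probability T R) (h : T -> R) (B : R) :
  measurable_fun [set: T] h -> (forall x, `|h x| <= B) ->
  (((\int[mu]_x h x) ^+ 2)%:E <= \int[mu]_x ((h x) ^+ 2)%:E)%E.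
Proof.
move=> mh hB.
have muT : (mu [set: T] < +oo)%E by rewrite probability_setT ltry.
have B0 : 0 <= B by exact: le_trans (hB point).
have ih : mu.-integrable setT (EFin \o h) by apply: bounded_integrable => //.
have ih2 : mu.-integrable setT (EFin \o (fun x => h x ^+ 2)).
  apply: (bounded_integrable (B := B ^+ 2)) => //; first exact: measurable_funX.
  by move=> x _; rewrite normrX lerXn2r// nnegrE.
set c := \int[mu]_x h x.
have ic : mu.-integrable setT (EFin \o (fun x => c * h x)).
  exact: integrable_mulr.
have ic2 : mu.-integrable setT (EFin \o (cst (c ^+ 2))).
  exact: finite_measure_integrable_cst.
have -> : (\int[mu]_x ((h x) ^+ 2)%:E)%E = (\int[mu]_x ((h x) ^+ 2))%:E.
  by rewrite /Rintegral fineK//; apply: integrable_fin_num.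
rewrite lee_fin.
have : \int[mu]_x (c * h x + c * h x - cst (c ^+ 2) x) <= \int[mu]_x ((h x) ^+ 2).
  apply: le_Rintegral => //.
    by apply: integrable_subr => //; apply: integrable_addr.
  by move=> x _; have := sqr_ge0 (h x - c); rewrite /cst/=; nra.
rewrite RintegralB//; last by apply: integrable_addr.
rewrite RintegralD// RintegralZl// -/c Rintegral_cst//.
rewrite [X in fine X](_ : _ = 1%E) ?mulr1; last exact: probability_setT.
apply: le_trans; lra.
Qed.

(** The fundamental theorem of calculus on compact intervals exhausting [D], with vanishing boundary
    terms. Nonnegativity makes both integrals monotone limits, so the equality holds among extended
    reals and carries finiteness from one side to the other. The moment recursions of the normal and
    of the exponential law are its two instances. *)
Lemma improper_by_parts (R : realType) (u v : R^nat) (F f g : R -> R) (D : set R) :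
  D = \bigcup_n `[u n, v n]%classic ->
  nondecreasing_seq (fun n => `[u n, v n]%classic : set R) ->
  (forall n, u n < v n) ->
  (forall x, D x -> 0 <= f x) -> (forall x, D x -> 0 <= g x) ->
  (forall x, D x -> {for x, continuous f}) ->
  (forall x, D x -> {for x, continuous g}) ->
  (forall x, D x -> is_derive x 1 F (f x - g x)) ->
  (fun n => F (v n) - F (u n)) @ \oo --> 0 ->
  (\int[leb]_(x in D) (f x)%:E = \int[leb]_(x in D) (g x)%:E)%E.
Proof.
move=> DE nd uv f0 g0 cf cg dF F0.
have sD n x : `[u n, v n]%classic x -> D x by move=> h; rewrite DE; exists n.
have cw (h : R -> R) n : (forall x, D x -> {for x, continuous h}) -> {within `[u n, v n], continuous h}.
  move=> ch; apply: continuous_in_subspaceT => x; rewrite inE => xn.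
  exact/ch/sD/xn.
have ii (h : R -> R) n : (forall x, D x -> {for x, continuous h}) ->
    leb.-integrable `[u n, v n] (EFin \o h).
  move=> ch; apply: continuous_compact_integrable; first exact: segment_compact.
  exact: cw.
have key n : (\int[leb]_(x in `[u n, v n]) (f x)%:E =
    \int[leb]_(x in `[u n, v n]) (g x)%:E + (F (v n) - F (u n))%:E)%E.
  have : (\int[leb]_(x in `[u n, v n]) (f x - g x)%:E = (F (v n))%:E - (F (u n))%:E)%E.
    have cF x : `[u n, v n]%classic x -> {for x, continuous F}.
      move=> /sD /dF [? _].
      exact/differentiable_continuous/derivable1_diffP.
    apply: continuous_FTC2 => //.
    - apply: cw => x Dx; apply: cvgB; [exact: cf|exact: cg].
    - split.
      + by move=> x xn; have [] := dF x (sD n x (subset_itv_oo_cc xn)).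
      + apply: cvg_at_right_filter; apply: cF => /=.
        by rewrite in_itv/= lexx ltW.
      + apply: cvg_at_left_filter; apply: cF => /=.
        by rewrite in_itv/= lexx ltW.
    - move=> x xn; rewrite derive1E; have [_] := dF x (sD n x (subset_itv_oo_cc xn)).
      by [].
  have fi := ii f n cf; have gi := ii g n cg.
  under eq_integral do rewrite EFinB.
  rewrite integralB_EFin// EFinB => <-.
  by rewrite addeC subeK//; exact: integrable_fin_num.
have mF n : measurable `[u n, v n]%classic by [].
have lim (h : R -> R) : (forall x, D x -> 0 <= h x) -> (forall x, D x -> {for x, continuous h}) ->
    (\int[leb]_(x in `[u n, v n]) (h x)%:E @[n --> \oo] --> \int[leb]_(x in D) (h x)%:E)%E.
  move=> h0 ch; rewrite DE; apply: ge0_nondecreasing_set_cvg_integral => //.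
  - by move=> n; have /integrableP[] := ii h n ch.
  - by move=> n x xn; rewrite lee_fin; exact/h0/sD/xn.
have lf := lim f f0 cf; have lg := lim g g0 cg.
have lgF : ((\int[leb]_(x in `[u n, v n]) (g x)%:E + (F (v n) - F (u n))%:E)%E @[n --> \oo]
    --> \int[leb]_(x in D) (g x)%:E + 0)%E.
  apply: cvgeD => //; first exact: fin_num_adde_defl.
  by apply/cvg_EFin => //; apply: nearW.
rewrite adde0 in lgF; rewrite -(funext key) in lgF.
exact: (cvg_unique _ lf lgF).
Qed.

(** Cesaro averaging: [|g - l|] is at most [e / 2] beyond some [M], and the initial segment
    contributes at most [C M / T]. *)
Lemma Rintegral_average_cvg (R : realType) (g : R -> R) (B l : R) :
  measurable_fun [set: R] g -> (forall t : R, 0 <= t -> `|g t| <= B) ->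
  g t @[t --> +oo] --> l ->
  T^-1 * \int[leb]_(t in `[0, T]) g t @[T --> +oo] --> l.
Proof.
move=> mg gB gl; apply/cvgrPdist_le => /= e e0.
have B0 : 0 <= B by apply: le_trans (gB 0 (lexx _)).
have e2 : 0 < e / 2 by rewrite divr_gt0.
have [L [_ Lg]] : \forall t \near +oo, `|l - g t| <= e / 2.
  by move/cvgrPdist_le : gl; apply.
pose M := Num.max L 0 + 1.
have M0 : 0 < M by rewrite ltr_wpDl// le_max lexx orbT.
have Mg (t : R) : M <= t -> `|l - g t| <= e / 2.
  move=> Mt; apply: Lg; apply: lt_le_trans Mt.
  by rewrite /M ltr_pwDr// le_max lexx.
pose C := B + `|l|.
have C0 : 0 <= C by rewrite addr_ge0.
near=> T'; pose T : R := T'.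
have T0 : 0 < T by rewrite /T; near: T'; exact: nbhs_pinfty_gt.
have leT : leb `[0, T]%classic = T%:E by rewrite lebesgue_measure_itv/= lte_fin T0 oppr0 adde0.
have bi (h : R -> R) (B' : R) : measurable_fun [set: R] h -> (forall t : R, 0 <= t -> `|h t| <= B') ->
    leb.-integrable `[0, T] (EFin \o h).
  move=> mh hB; apply: (bounded_integrable (B := B')) => //.
  - by rewrite [X in (X < _)%E]leT ltry.
  - exact: measurable_funTS.
  - by move=> x /=; rewrite in_itv/= => /andP[x0 _]; exact: hB.
have gi := bi g B mg gB.
have ci c : leb.-integrable `[0, T] (EFin \o cst c).
  by apply: (bi (cst c) `|c|).
have mI : measurable `[0, T]%classic by [].
have dB (t : R) : 0 <= t -> `|l - g t| <= C.
  by move=> t0; rewrite (le_trans (ler_normB _ _))// addrC lerD2r gB.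
pose h (t : R) : R := e / 2 + C * \1_(`[0, M]%classic) t.
have ind0 (t : R) : 0 <= (\1_(`[0, M]%classic) t : R) by rewrite indicE.
have ind1 (t : R) : (\1_(`[0, M]%classic) t : R) <= 1 by rewrite indicE; case: (_ \in _).
have mdif : measurable_fun [set: R] (fun t => l - g t) by exact: measurable_funB.
have i1i : leb.-integrable `[0, T] (EFin \o (\1_(`[0, M]%classic) : R -> R)).
  by apply: (bi _ 1) => // t _; rewrite ger0_norm.
have hi : leb.-integrable `[0, T] (EFin \o h).
  by apply: integrable_addr => //; [exact: ci|exact: integrable_mulr].
have step : `|\int[leb]_(t in `[0, T]) (l - g t)| <= \int[leb]_(t in `[0, T]) h t.
  apply: le_trans (le_normr_Rintegral _ _) _ => //.
    exact: (bi _ C).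
  apply: le_Rintegral => //.
    by apply: (bi _ C) => [|t t0]; [exact: measurableT_comp|rewrite normr_id dB].
  move=> t /=; rewrite in_itv/= => /andP[t0 tT]; rewrite /h.
  have [Mt|tM] := lerP M t.
    by apply: le_trans (Mg t Mt) _; rewrite lerDl mulr_ge0.
  rewrite indicE mem_set ?mulr1; last by rewrite /= in_itv/= t0 ltW.
  by apply: le_trans (dB t t0) _; rewrite lerDr ltW.
have I1 : \int[leb]_(t in `[0, T]) (\1_(`[0, M]%classic) t) <= M.
  rewrite /Rintegral integral_indic//= -lee_fin.
  have le1 : (leb (`[0%R, M] `&` `[0%R, T]) <= M%:E)%E.
    rewrite (_ : M%:E = leb `[0%R, M]%classic); last first.
      by rewrite lebesgue_measure_itv/= lte_fin M0 oppr0 adde0.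
    by apply: le_measure; rewrite ?inE//; exact: measurableI.
  by rewrite fineK// ge0_fin_numE// (le_lt_trans le1)// ltry.
have cT c : \int[leb]_(t in `[0, T]) c = c * T.
  by rewrite Rintegral_cst// [X in fine X]leT.
have Eh : \int[leb]_(t in `[0, T]) h t <= e / 2 * T + C * M.
  rewrite /h RintegralD//; [|exact: ci|exact: integrable_mulr].
  rewrite cT (_ : Rintegral _ _ (fun t => C * _) =
    C * \int[leb]_(t in `[0, T]) (\1_(`[0, M]%classic) t)); last exact: RintegralZl.
  by rewrite lerD2l ler_wpM2l.
have El : \int[leb]_(t in `[0, T]) (l - g t) = l * T - \int[leb]_(t in `[0, T]) g t.
  by rewrite RintegralB ?cT//; exact: ci.
rewrite (_ : l - _ = T^-1 * \int[leb]_(t in `[0, T]) (l - g t)); last first.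
  by rewrite El mulrBr [l * T]mulrC mulKf// gt_eqF.
rewrite normrM gtr0_norm ?invr_gt0// mulrC ler_pdivrMr//.
apply: (le_trans step); apply: (le_trans Eh).
have : C * M <= e / 2 * T.
  rewrite mulrC -[leRHS]mulrC -ler_pdivrMr//.
  by rewrite /T; near: T'; apply: nbhs_pinfty_ge; exact: num_real.
lra.
Unshelve. all: by end_near. Qed.

(** * Independence and Gaussian moments *)

Section independence.
Context d (T : measurableType d) (R : realType) (P : probability T R).

(** Dynkin's argument: the probability of the intersection with [F] and the multiple of [P] by [P F]
    are finite measures that agree on the pi-system [G], hence on the sigma-algebra that it
    generates. *)
Lemma indep_sigma_algebra (G : set (set T)) (F : set T) :
  G `<=` measurable -> setI_closed G -> G setT -> measurable F ->
  (forall E, G E -> P (E `&` F) = P E * P F)%E ->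
  forall E, <<s G >> E -> P (E `&` F) = (P E * P F)%E.
Proof.
move=> Gm GI GT mF GF E sE.
have PF0 : 0 <= fine (P F) by rewrite fine_ge0.
pose m2 : {measure set T -> \bar R} := mscale (NngNum PF0) P.
have m2E A : m2 A = (P A * P F)%E.
  by rewrite /m2/= /mscale/= muleC fineK//; exact: fin_num_measure.
rewrite -m2E -[LHS]/(mrestr P mF E).
apply: (g_sigma_algebra_measure_unique G Gm (fun=> setT)) => //.
- by apply/seteqP; split => // x _; exists 0%N.
- by move=> A GA; rewrite [RHS]m2E -[LHS]/(P (A `&` F)) GF.
- move=> k; rewrite -[X in (X < _)%E]/(P (setT `&` F)).
  by rewrite setTI ltey_eq fin_num_measure.
Qed.

Definition cylinders n (Y : 'I_n -> T -> R) : set (set T) :=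
  [set E | exists A : 'I_n -> set R, (forall i, measurable (A i)) /\
    E = \bigcap_(i in [set: 'I_n]) (Y i @^-1` A i)].

Lemma cylinders_measurable n (Y : 'I_n -> T -> R) :
  (forall i, measurable_fun setT (Y i)) -> cylinders Y `<=` measurable.
Proof.
move=> mY _ [A [mA ->]]; apply: fin_bigcap_measurable => // i _.
by rewrite -[X in measurable X]setTI; exact: mY.
Qed.

Lemma cylinders_setI n (Y : 'I_n -> T -> R) : setI_closed (cylinders Y).
Proof.
move=> _ _ [A [mA ->]] [B [mB ->]]; exists (fun i => A i `&` B i); split.
  by move=> i; exact: measurableI.
by rewrite -bigcapI.
Qed.

Lemma cylinders_setT n (Y : 'I_n -> T -> R) : cylinders Y setT.
Proof. by exists (fun=> setT); split => //; rewrite bigcapT. Qed.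

Lemma measurable_sum_cylinders n (Y : 'I_n -> T -> R) (c : 'I_n -> R) (B : set R) :
  measurable B -> <<s cylinders Y >> ((fun w => \sum_(i < n) c i * Y i w) @^-1` B).
Proof.
move=> mB; pose T' := g_sigma_algebraType (cylinders Y).
have mY i : measurable_fun [set: T'] (Y i : T' -> R).
  move=> _ A mA; rewrite setTI; apply: sub_sigma_algebra.
  exists (fun j => if j == i then A else setT); split.
    by move=> j; case: ifP.
  apply/seteqP; split => w /=; last by move/(_ i Logic.I); rewrite eqxx.
  by move=> Aw j _; case: ifP => [/eqP ->|].
have : measurable_fun [set: T'] (fun w : T' => \sum_(i < n) c i * Y i w).
  by apply: measurable_sum => i; apply: measurable_funM.
by move=> /(_ measurableT _ mB); rewrite setTI.
Qed.

(** Independence is given on cylinder events only. A linear combination is measurable for the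
    sigma-algebra of the cylinders, so [indep_sigma_algebra] is applied to each of the two families
    in turn. *)
Lemma indep_linear n m (Y : 'I_n -> T -> R) (Z : 'I_m -> T -> R) :
  (forall i, measurable_fun setT (Y i)) -> (forall i, measurable_fun setT (Z i)) ->
  (forall (A : 'I_n -> set R) (B : 'I_m -> set R),
    (forall i, measurable (A i)) -> (forall j, measurable (B j)) ->
    let E1 := \bigcap_(i in [set: 'I_n]) (Y i @^-1` A i) in
    let E2 := \bigcap_(j in [set: 'I_m]) (Z j @^-1` B j) in
    P (E1 `&` E2) = P E1 * P E2)%E ->
  forall (c : 'I_n -> R) (e : 'I_m -> R) (A B : set R), measurable A -> measurable B ->
  (P ((fun w => \sum_i c i * Y i w)%R @^-1` A `&` (fun w => \sum_j e j * Z j w)%R @^-1` B)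
   = P ((fun w => \sum_i c i * Y i w)%R @^-1` A) *
     P ((fun w => \sum_j e j * Z j w)%R @^-1` B))%E.
Proof.
move=> mY mZ ind c e A B mA mB.
set E := _ @^-1` A; set F := _ @^-1` B.
have sE : <<s cylinders Y >> E by exact: measurable_sum_cylinders.
have sF : <<s cylinders Z >> F by exact: measurable_sum_cylinders.
have mE : measurable E.
  move: sE; apply: smallest_sub; first exact: sigma_algebra_measurable.
  exact: cylinders_measurable.
have half F' : cylinders Z F' -> (P (E `&` F') = P E * P F')%E.
  move=> ZF'; apply: (indep_sigma_algebra (cylinders_measurable mY)
    (@cylinders_setI _ Y) (cylinders_setT Y)) => //.
    exact: (cylinders_measurable mZ).
  by move=> _ [A' [mA' ->]]; move: ZF' => [B' [mB' ->]]; exact: ind.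
rewrite setIC muleC; apply: (indep_sigma_algebra (cylinders_measurable mZ)
  (@cylinders_setI _ Z) (cylinders_setT Z)) => // F' ZF'.
by rewrite setIC muleC; exact: half.
Qed.

(** By uniqueness of the product measure, the joint law of an independent pair is the product of its
    marginals; Tonelli's theorem then splits the integral. *)
Lemma indep_integral (Y Z : {RV P >-> measurableTypeR R}) (h : R * R -> \bar R) :
  measurable_fun setT h -> (forall p, 0 <= h p)%E ->
  (forall A B, measurable A -> measurable B ->
    P (Y @^-1` A `&` Z @^-1` B) = P (Y @^-1` A) * P (Z @^-1` B))%E ->
  (\int[P]_w h (Y w, Z w) =
   \int[distribution P Z]_z \int[distribution P Y]_y h (y, z))%E.
Proof.
move=> mh h0 ind; pose YZ := fun w => (Y w, Z w).
have mYZ : measurable_fun setT YZ by exact: measurable_fun_pair.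
transitivity (\int[pushforward P YZ]_p h p)%E.
  by rewrite ge0_integral_pushforward.
transitivity (\int[distribution P Y \x distribution P Z]_p h p)%E.
  apply: eq_measure_integral => A mA _; apply/esym.
  by apply: product_measure_unique => // B C mB mC; rewrite -ind.
by rewrite fubini_tonelli2.
Qed.

End independence.

Lemma integral_mass1 d (T : measurableType d) (R : realType)
    (m : {measure set T -> \bar R}) (c : \bar R) : m [set: T] = 1%E -> (\int[m]_x c = c)%E.
Proof. by move=> m1; rewrite -[LHS]/(\int[m]_x cst c x)%E integral_cst// m1 mule1. Qed.

(** * Moments of normal laws and of their independent sums *)

Section normal_moments.
Variables (R : realType) (s : R).
Hypothesis s0 : s != 0.
Local Notation pdf := (normal_pdf 0 s).

Let a := (s ^+ 2 *+ 2)^-1.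

Let a0 : 0 < a.
Proof. by rewrite invr_gt0 pmulrn_lgt0// exprn_even_gt0. Qed.

Let pdfE x : pdf x = normal_peak s * expR (- (a * x ^+ 2)).
Proof. by rewrite normal_pdfE// /normal_fun subr0 mulNr [x ^+ 2 / _]mulrC. Qed.

(** From [exp y >= (y / 2)^2] at [y = a x^2]. A fourth power suffices, since the boundary terms of
    the recursion carry at most [|x|^3]. *)
Let pdf_tail x : 1 <= `|x| -> pdf x <= normal_peak s * (4 / a ^+ 2) / `|x| ^+ 4.
Proof.
move=> x1; rewrite pdfE -mulrA ler_wpM2l ?normal_peak_ge0//.
have x0 : 0 < `|x| by apply: lt_le_trans x1.
have x2 : x ^+ 2 = `|x| ^+ 2 by rewrite real_normK ?num_real.
set y := a * x ^+ 2.
have y0 : 0 < y by rewrite mulr_gt0// x2 exprn_gt0.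
rewrite (_ : 4 / a ^+ 2 / `|x| ^+ 4 = ((y / 2) ^+ 2)^-1); last first.
  rewrite /y x2; field.
  by rewrite !gt_eqF.
rewrite expRN lef_pV2 ?posrE ?expR_gt0 ?exprn_gt0 ?divr_gt0//.
rewrite -[y in leRHS](@divfK _ 2)// expRM_natr.
have y2 : 0 <= y / 2 by rewrite divr_ge0// ltW.
rewrite lerXn2r ?nnegrE ?expR_ge0//.
by apply: le_trans (expR_ge1Dx _); rewrite lerDr.
Qed.

Let pdf_derive (x : R) : is_derive x 1 pdf (- (x / s ^+ 2) * pdf x).
Proof.
rewrite (_ : pdf = fun x => normal_peak s * expR (- (a * x ^+ 2))); last exact/funext/pdfE.
apply: is_derive_eq.
rewrite /GRing.scale/= /a; field.
by [].
Qed.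

Let pdf0 x : 0 <= pdf x. Proof. exact: normal_pdf_ge0. Qed.

(** Integration by parts with primitive [s^2 x^(2j+1)] times the density. The cases [j = 0] and
    [j = 1] give the second and the fourth moment. *)
Lemma normal_moment_rec j : (j <= 1)%N ->
  (\int[leb]_x (s ^+ 2 * j.*2.+1%:R * x ^+ j.*2 * pdf x)%:E =
   \int[leb]_x (x ^+ j.+1.*2 * pdf x)%:E)%E.
Proof.
move=> j1.
have pow0 (x : R) k : 0 <= x ^+ k.*2 by rewrite -muln2 mulnC exprM exprn_ge0 ?sqr_ge0.
pose F x := s ^+ 2 * x ^+ j.*2.+1 * pdf x.
have cpdf : continuous pdf by exact: continuous_normal_pdf.
have cX k : continuous (fun x : R => x ^+ k) by exact: exprn_continuous.
apply: (@improper_by_parts _ (fun n => - n.+1%:R) (fun n => n.+1%:R) F).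
- apply/seteqP; split => // x _ /=.
  have [n xn] : exists n : nat, `|x| <= n.+1%:R.
    by exists (Num.truncn `|x|); rewrite ltW// truncnS_gt.
  by exists n => //=; rewrite in_itv/= -ler_norml.
- move=> m n mn; rewrite subsetEset => x /=; rewrite !in_itv/= -!ler_norml => /le_trans; apply.
  by rewrite ler_nat ltnS.
- by move=> n; apply: (@lt_trans _ _ 0); rewrite ?oppr_lt0 ltr0n.
- move=> x _; do 3 (apply: mulr_ge0 => //); exact: sqr_ge0.
- by move=> x _; rewrite mulr_ge0.
- by move=> x _; apply: cvgM; [apply: cvgM; [exact: cvg_cst|exact: cX]|exact: cpdf].
- by move=> x _; apply: cvgM; [exact: cX|exact: cpdf].
- move=> x _; have dpdf := pdf_derive x.
  rewrite (_ : F = cst (s ^+ 2) * (@id R ^+ j.*2.+1) * pdf); last first.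
    by apply/funext => y; rewrite /F !fctE.
  apply: is_derive_eq; rewrite !fctE.
  rewrite /GRing.scale/= doubleS !exprS; field.
  by [].
- apply/cvgrPdist_le => /= e e0.
  pose C := 2 * (s ^+ 2 * (normal_peak s * (4 / a ^+ 2))).
  have C0 : 0 <= C.
    apply: mulr_ge0 => //; apply: mulr_ge0; first exact: sqr_ge0.
    apply: mulr_ge0; first exact: normal_peak_ge0.
    by apply: divr_ge0 => //; exact: sqr_ge0.
  near=> n; rewrite sub0r normrN.
  have n1 : 1 <= n.+1%:R :> R by rewrite ler1n.
  have FB (x : R) : `|x| = n.+1%:R -> `|F x| <= C / 2 / n.+1%:R.
    move=> xn; rewrite /F normrM (ger0_norm (pdf0 x)) normrM [X in _ * X * _]normrX xn.
    have x1 : 1 <= `|x| by rewrite xn.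
    have := pdf_tail x1; rewrite xn => h.
    rewrite (ger0_norm (sqr_ge0 _)).
    apply: le_trans (ler_wpM2l _ h) _; first by rewrite mulr_ge0 ?sqr_ge0.
    rewrite [leLHS](_ : _ = C / 2 * (n.+1%:R ^+ j.*2.+1 / n.+1%:R ^+ 4)); last first.
      by rewrite /C [2 * _]mulrC mulfK//; ring.
    apply: ler_wpM2l; first by rewrite divr_ge0.
    rewrite ler_pdivrMr ?exprn_gt0// mulrC -[4%N]/(3 + 1)%N exprD expr1 mulfK//.
    by apply: ler_weXn2l => //; rewrite ltnS -[2%N]/(1.*2)%N leq_double.
  apply: le_trans (ler_normB _ _) _.
  apply: le_trans (lerD (FB _ _) (FB _ _)) _; rewrite ?normrN ?ger0_norm//.
  rewrite -mulrDl -splitr ler_pdivrMr// mulrC -ler_pdivrMr//.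
  near: n; exists (Num.truncn (C / e)) => // n /= Cn.
  by apply/ltW; apply: lt_le_trans (truncnS_gt _) _; rewrite ler_nat ltnS.
Unshelve. all: by end_near. Qed.

Let mpdf : measurable_fun setT pdf. Proof. exact: measurable_normal_pdf. Qed.

Lemma normal_integralE (f : R -> R) : measurable_fun setT f -> (forall x, 0 <= f x) ->
  (\int[normal_prob 0 s]_x (f x)%:E = \int[leb]_x (f x * pdf x)%:E)%E.
Proof.
move=> mf f0; rewrite (@integral_density _ _ _ leb (normal_prob 0 s) pdf)//.
exact/measurable_EFinP.
Qed.

Lemma normal_moment2 : (\int[normal_prob 0 s]_x ((x : R) ^+ 2)%:E = (s ^+ 2)%:E)%E.
Proof.
rewrite normal_integralE//; last by move=> x; exact: sqr_ge0.
rewrite -(@normal_moment_rec 0)//.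
under eq_integral do rewrite expr0 !mulr1 EFinM.
rewrite ge0_integralZl//.
- by rewrite integral_normal_pdf mule1.
- exact/measurable_EFinP.
- by move=> x _; rewrite lee_fin.
- by rewrite lee_fin sqr_ge0.
Qed.

Lemma normal_moment4 : (\int[normal_prob 0 s]_x ((x : R) ^+ 4)%:E = (3 * s ^+ 2 ^+ 2)%:E)%E.
Proof.
rewrite normal_integralE//; last by move=> x; rewrite (exprM _ 2 2) sqr_ge0.
rewrite -(@normal_moment_rec 1)//.
under eq_integral do rewrite -mulrA EFinM.
rewrite ge0_integralZl//.
- rewrite -normal_integralE//; last by move=> x; exact: sqr_ge0.
  by rewrite normal_moment2 -EFinM -[1.*2.+1]/3%N; congr (_%:E); ring.
- by apply/measurable_EFinP; apply: measurable_funM.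
- by move=> x _; rewrite lee_fin mulr_ge0 ?sqr_ge0.
- by rewrite lee_fin mulr_ge0 ?sqr_ge0.
Qed.

End normal_moments.

Section gaussian_law.
Context d (T : measurableType d) (R : realType) (P : probability T R).

(** What is kept of normality: the two moments, and the symmetry, which removes odd powers from the
    moments of a sum. This description includes the degenerate case [v = 0]. *)
Definition gaussian_law (m : {measure set (measurableTypeR R) -> \bar R}) (v : R) :=
  [/\ (\int[m]_x ((x : R) ^+ 2)%:E = v%:E)%E, (\int[m]_x ((x : R) ^+ 4)%:E = (3 * v ^+ 2)%:E)%E &
   forall A : set R, measurable A -> m [set x | A (- x)] = m A].

(** Normality of [- Y] with the same parameter supplies the symmetry, and also excludes negative
    values of [v], which the definition of [is_normal_rv] does not forbid. *)
Lemma is_normal_rv_law (Y : {RV P >-> measurableTypeR R}) (v : R) :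
  is_normal_rv P Y 0 v -> is_normal_rv P (fun w => - Y w) 0 v ->
  gaussian_law (distribution P Y) v.
Proof.
move=> [mY nY] [mNY nNY].
have m2 : measurable_fun setT (fun x : R => (x ^+ 2)%:E).
  by apply/measurable_EFinP; exact: measurable_funX.
have m4 : measurable_fun setT (fun x : R => (x ^+ 4)%:E).
  by apply/measurable_EFinP; exact: measurable_funX.
have p4 (x : R) : 0 <= x ^+ 4 by rewrite (exprM _ 2 2) sqr_ge0.
have [v0|vn0] := eqVneq v 0.
  move: nY nNY; rewrite v0 eqxx => nY _.
  have mN : measurable [set w | Y w != 0].
    rewrite (_ : [set _ | _] = Y @^-1` (~` [set 0])); last first.
      by apply/seteqP; split => w /= /eqP.
    by rewrite -[X in measurable X]setTI; apply: mY => //; exact: measurableC.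
  have ae0 k : (\int[P]_w (Y w ^+ k.+1)%:E = 0)%E.
    rewrite -(integral0 P setT); apply: ae_eq_integral => //.
    - by apply/measurable_EFinP; exact: measurable_funX.
    - exists [set w | Y w != 0]; split => // w /= Yw; apply/eqP => Yw0; apply: Yw => _.
      by rewrite Yw0 expr0n.
  split.
  - rewrite ge0_integral_distribution//; first exact: (ae0 1%N).
    by move=> x; rewrite lee_fin sqr_ge0.
  - rewrite ge0_integral_distribution//; first by rewrite expr0n mulr0; exact: (ae0 3%N).
  - move=> A mA; rewrite /distribution /pushforward.
    have mYA B : measurable B -> measurable (Y @^-1` B).
      by move=> mB; rewrite -[X in measurable X]setTI; exact: mY.
    (* Since [Y = 0] almost surely, every event may be intersected with [Y = 0], where [Y] and [- Y]
       coincide. *)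
    have split0 B : measurable B -> P (Y @^-1` B) = P (Y @^-1` B `&` [set w | Y w == 0]).
      move=> mB; have mE : measurable [set w | Y w == 0].
        rewrite (_ : [set _ | _] = ~` [set w | Y w != 0]); first exact: measurableC.
        by apply/seteqP; split => w /=; [move=> ->|move/negP; rewrite negbK].
      rewrite [LHS](measureDI P (mYA _ mB) mE) setDE [X in (X + _)%E](_ : _ = 0%E) ?add0e//.
      apply/eqP; rewrite eq_le measure_ge0 andbT -nY; apply: le_measure; rewrite ?inE//.
        by apply: measurableI; [exact: mYA|exact: measurableC].
      by move=> w [_ /= /negP].
    have mNA : measurable ([set x | A (- x)]).
      have mo : measurable_fun [set: R] (fun x : R => - x) by exact: measurableT_comp.
      by rewrite -[X in measurable X]setTI; exact: mo.
    apply: (etrans (split0 _ mNA)); apply/esym/(etrans (split0 _ mA)); congr (P _).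
    by apply/seteqP; split => w [/= + /eqP Yw0]; rewrite Yw0 ?oppr0 eqxx.
have law (A : set R) : measurable A -> distribution P Y A = normal_prob 0 (Num.sqrt v) A.
  by move=> mA; move: nY; rewrite (negbTE vn0); exact.
have sym (A : set R) : measurable A -> distribution P Y [set x | A (- x)] = distribution P Y A.
  by move=> mA; rewrite (law _ mA); move: nNY; rewrite (negbTE vn0) => <-.
have v0 : 0 < v.
  (* If [v < 0], then [Num.sqrt v = 0], and [normal_prob 0 0] is by convention the uniform law on
     [[0, 1]]. All its mass lies on the positive half-line, and by symmetry all of it on the
     negative one as well, so the total would be 2. *)
  rewrite lt0r vn0/= leNgt; apply/negP => vneg.
  have sv : Num.sqrt v = 0 by rewrite ltr0_sqrtr.
  have one : distribution P Y `]0%R, +oo[%classic = 1%E.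
    rewrite law// sv /normal_prob /normal_pdf eqxx integral_indic//.
    transitivity (leb `]0 : R, 1]%classic); last first.
      by rewrite lebesgue_measure_itv/= lte_fin ltr01 oppr0 adde0.
    congr (leb _); apply/seteqP; split => x /=; rewrite !in_itv/= andbT.
      by move=> [/andP[_ ->] ->].
    by move=> /andP[x0 ->]; rewrite (ltW x0) x0.
  have one' : distribution P Y `]-oo, 0%R[%classic = 1%E.
    rewrite -one -(sym `]0, +oo[%classic)//; congr (distribution P Y _).
    by apply/seteqP; split => x /=; rewrite !in_itv/= ?andbT oppr_gt0.
  have : (distribution P Y (`]-oo, 0%R[ `|` `]0%R, +oo[) <= 1)%E.
    by rewrite probability_le1//; exact: measurableU.
  rewrite measureU//; last first.
    apply/seteqP; split => x //=; rewrite !in_itv/= andbT => -[x0 x1].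
    by have := lt_trans x0 x1; rewrite ltxx.
  by rewrite [X in (X + _ <= _)%E]one' [X in (_ + X <= _)%E]one -EFinD lee_fin; lra.
have sv0 : Num.sqrt v != 0 by rewrite sqrtr_eq0 -ltNge.
split => //.
- transitivity (\int[normal_prob 0 (Num.sqrt v)]_x ((x : R) ^+ 2)%:E)%E.
    by apply: eq_measure_integral => A mA _; exact: law.
  by rewrite normal_moment2// sqr_sqrtr// ltW.
- transitivity (\int[normal_prob 0 (Num.sqrt v)]_x ((x : R) ^+ 4)%:E)%E.
    by apply: eq_measure_integral => A mA _; exact: law.
  by rewrite normal_moment4// sqr_sqrtr// ltW.
Qed.

End gaussian_law.

Section sum_indep_gaussian.
Context (R : realType) (mY mZ : probability (measurableTypeR R) R) (a b : R).
Hypotheses (gY : gaussian_law mY a) (gZ : gaussian_law mZ b).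

Let sym_integral (f : R -> \bar R) : measurable_fun setT f -> (forall x, 0 <= f x)%E ->
  (\int[mY]_x f (- (x : R))%R = \int[mY]_x f x)%E.
Proof.
move=> mf f0; have mo : measurable_fun [set: R] (fun x : R => - x) by exact: measurableT_comp.
pose opp := (fun x : R => - x) : measurableTypeR R -> measurableTypeR R.
have mopp : measurable_fun setT opp by exact: mo.
transitivity (\int[pushforward mY opp]_x f x)%E.
  by rewrite (ge0_integral_pushforward mopp).
by apply: eq_measure_integral => A mA _; case: gY => _ _; exact.
Qed.

Let mulsq (c x : R) : 0 <= c -> 0 <= c * x ^+ 2.
Proof. by move=> c0; rewrite mulr_ge0// sqr_ge0. Qed.

(** Under a symmetric law [f] may be replaced by its even part [g]. Both are nonnegative, so odd
    powers disappear without ever being integrated. *)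
Let even_integral (f g : R -> R) :
  measurable_fun setT f -> (forall x, 0 <= f x) ->
  measurable_fun setT g -> (forall x, 0 <= g x) ->
  (forall x, f x + f (- x) = g x *+ 2) ->
  (\int[mY]_x (f x)%:E = \int[mY]_x (g x)%:E)%E.
Proof.
move=> mf f0 mg g0 fg.
have mo : measurable_fun [set: R] (fun x : R => - x) by exact: measurableT_comp.
have mfN : measurable_fun [set: R] (fun x : R => f (- x)) by exact: measurableT_comp.
have h : (2%:E * \int[mY]_x (f x)%:E = 2%:E * \int[mY]_x (g x)%:E)%E.
  transitivity (\int[mY]_x (f x)%:E + \int[mY]_x (f (- (x : R))%R)%:E)%E.
    rewrite (sym_integral (f := fun x => (f x)%:E))//; last exact/measurable_EFinP.
    by rewrite mule_natl mule2n.
  rewrite -ge0_integralD//; last 4 first.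
  - by move=> x _; rewrite lee_fin.
  - exact/measurable_EFinP.
  - by move=> x _; rewrite lee_fin.
  - exact/measurable_EFinP.
  rewrite -ge0_integralZl//; last 2 first.
  - exact/measurable_EFinP.
  - by move=> x _; rewrite lee_fin.
  by apply: eq_integral => x _; rewrite -EFinD -EFinM fg mulr_natl.
have := congr1 (fun z => ((2^-1)%:E * z)%E) h.
by rewrite !muleA -!EFinM mulVf// !mul1e.
Qed.

Lemma convolution_moment2 : (\int[mZ]_z \int[mY]_y (((y : R) + (z : R)) ^+ 2)%:E = (a + b)%:E)%E.
Proof.
have [Y2 Y4 _] := gY; have [Z2 Z4 _] := gZ.
transitivity (\int[mZ]_z (a%:E + (z ^+ 2)%:E))%E.
  apply: eq_integral => z _ /=.
  rewrite (even_integral (g := fun x => x ^+ 2 + z ^+ 2)).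
  - under eq_integral do rewrite EFinD.
    rewrite ge0_integralD//.
    + by rewrite (integral_mass1 _ (probability_setT mY)) Y2.
    + by move=> x _; rewrite lee_fin sqr_ge0.
    + by apply/measurable_EFinP; exact: measurable_funX.
    + by move=> x _; rewrite lee_fin sqr_ge0.
  - by apply: measurable_funX; exact: measurable_funD.
  - by move=> x; rewrite sqr_ge0.
  - by apply: measurable_funD => //; exact: measurable_funX.
  - by move=> x; rewrite addr_ge0 ?sqr_ge0.
  - by move=> x; ring.
have a0 : 0 <= a by rewrite -lee_fin -Y2; apply: integral_ge0 => x _; rewrite lee_fin sqr_ge0.
rewrite ge0_integralD//.
- by rewrite (integral_mass1 _ (probability_setT mZ)) Z2.
- by move=> x _; rewrite lee_fin sqr_ge0.
- by apply/measurable_EFinP; exact: measurable_funX.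
Qed.

(** In [y], the even part of [(y + z)^4] is [y^4 + 6 z^2 y^2 + z^4]; integrating gives
    [3 a^2 + 6 a b + 3 b^2], so the Gaussian relation between fourth and second moments is preserved
    by independent sums. *)
Lemma convolution_moment4 : (\int[mZ]_z \int[mY]_y (((y : R) + (z : R)) ^+ 4)%:E = (3 * (a + b) ^+ 2)%:E)%E.
Proof.
have p4 (x : R) : 0 <= x ^+ 4 by rewrite (exprM _ 2 2) sqr_ge0.
have [Y2 Y4 _] := gY; have [Z2 Z4 _] := gZ.
have a0 : 0 <= a by rewrite -lee_fin -Y2; apply: integral_ge0 => x _; rewrite lee_fin sqr_ge0.
transitivity (\int[mZ]_z ((3 * a ^+ 2)%:E + ((6 * a) * z ^+ 2 + z ^+ 4)%:E))%E.
  apply: eq_integral => z _ /=.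
  rewrite (even_integral (g := fun x => x ^+ 4 + (6 * z ^+ 2 * x ^+ 2 + z ^+ 4))).
  - under eq_integral do rewrite EFinD EFinD (EFinM (6 * z ^+ 2)).
    rewrite ge0_integralD//.
    + rewrite Y4 ge0_integralD//.
      * rewrite (integral_mass1 _ (probability_setT mY)) ge0_integralZl//.
        - by rewrite Y2 -EFinM -!EFinD; congr (_%:E); ring.
        - by apply/measurable_EFinP; exact: measurable_funX.
        - by move=> x _; rewrite lee_fin sqr_ge0.
        - by rewrite lee_fin mulsq.
      * by move=> x _; rewrite -EFinM lee_fin !mulsq// mulr_ge0.
      * by apply/measurable_EFinP; apply: measurable_funM => //; exact: measurable_funX.
      * by move=> x _; rewrite lee_fin.
    + by move=> x _; rewrite lee_fin.
    + by apply/measurable_EFinP; exact: measurable_funX.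
    + by move=> x _; rewrite -EFinM -EFinD lee_fin addr_ge0// !mulsq.
    + apply/measurable_EFinP; apply: measurable_funD => //.
      by apply: measurable_funM => //; exact: measurable_funX.
  - by apply: measurable_funX; exact: measurable_funD.
  - by [].
  - apply: measurable_funD; first exact: measurable_funX.
    by apply: measurable_funD => //; apply: measurable_funM => //; exact: measurable_funX.
  - by move=> x; rewrite addr_ge0// addr_ge0// !mulsq.
  - by move=> x; ring.
rewrite ge0_integralD//.
- rewrite (integral_mass1 _ (probability_setT mZ)).
  under eq_integral do rewrite EFinD (EFinM (6 * a)).
  rewrite ge0_integralD//.
  + rewrite Z4 ge0_integralZl//.
    * by rewrite Z2 -EFinM -!EFinD; congr (_%:E); ring.
    * by apply/measurable_EFinP; exact: measurable_funX.
    * by move=> x _; rewrite lee_fin sqr_ge0.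
    * by rewrite lee_fin mulr_ge0.
  + by move=> x _; rewrite -EFinM lee_fin !mulsq// mulr_ge0.
  + by apply/measurable_EFinP; apply: measurable_funM => //; exact: measurable_funX.
  + by move=> x _; rewrite lee_fin.
  + by apply/measurable_EFinP; exact: measurable_funX.
- by move=> x _; rewrite lee_fin mulr_ge0// sqr_ge0.
- by move=> x _; rewrite lee_fin addr_ge0// mulsq// mulr_ge0.
- apply/measurable_EFinP; apply: measurable_funD; last exact: measurable_funX.
  by apply: measurable_funM => //; exact: measurable_funX.
Qed.

End sum_indep_gaussian.

Section sum_indep.
Context d (T : measurableType d) (R : realType) (P : probability T R).
Variables (Y Z : {RV P >-> measurableTypeR R}) (a b : R).
Hypotheses (gY : gaussian_law (distribution P Y) a) (gZ : gaussian_law (distribution P Z) b).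
Hypothesis ind : forall A B, measurable A -> measurable B ->
    (P (Y @^-1` A `&` Z @^-1` B) = P (Y @^-1` A) * P (Z @^-1` B))%E.

Lemma sum_indep_moment2 : (\int[P]_w (((Y w : R) + Z w) ^+ 2)%:E = (a + b)%:E)%E.
Proof.
rewrite -(convolution_moment2 gY gZ).
apply: (indep_integral (h := fun p => (((p.1 : R) + (p.2 : R)) ^+ 2)%:E)) => //.
- by apply/measurable_EFinP; apply: measurable_funX; exact: measurable_funD.
- by move=> p; rewrite lee_fin sqr_ge0.
Qed.

Lemma sum_indep_moment4 : (\int[P]_w (((Y w : R) + Z w) ^+ 4)%:E = (3 * (a + b) ^+ 2)%:E)%E.
Proof.
rewrite -(convolution_moment4 gY gZ).
apply: (indep_integral (h := fun p => (((p.1 : R) + (p.2 : R)) ^+ 4)%:E)) => //.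
- by apply/measurable_EFinP; apply: measurable_funX; exact: measurable_funD.
- by move=> p; rewrite lee_fin (exprM _ 2 2) sqr_ge0.
Qed.

End sum_indep.

(** * Finite linear combinations of a process and their moments *)

Section linear_combinations.
Context {T : Type} {R : realType}.
Implicit Types (Z : T -> R -> R) (K : R -> R -> R) (l m : seq (R * R)).

(** A list of pairs (coefficient, time) encodes a finite combination of values of the process.
    Concatenation and [scale] encode sum and multiple, so bilinearity of the covariance becomes a
    statement about lists. *)
Definition lin Z l (w : T) : R := \sum_(p <- l) p.1 * Z w p.2.

Definition cov K l m : R := \sum_(p <- l) \sum_(q <- m) p.1 * q.1 * K p.2 q.2.

Definition scale (c : R) l := [seq (c * p.1, p.2) | p <- l].

Lemma lin_cat Z l m w : lin Z (l ++ m) w = lin Z l w + lin Z m w.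
Proof. exact: big_cat. Qed.

Lemma lin_scale Z c l w : lin Z (scale c l) w = c * lin Z l w.
Proof. by rewrite /lin big_map mulr_sumr; apply: eq_bigr => p _; rewrite mulrA. Qed.

Lemma cov_catl K l l' m : cov K (l ++ l') m = cov K l m + cov K l' m.
Proof. exact: big_cat. Qed.

Lemma cov_catr K l m m' : cov K l (m ++ m') = cov K l m + cov K l m'.
Proof. by rewrite /cov -big_split; apply: eq_bigr => p _; exact: big_cat. Qed.

Lemma cov_scalel K c l m : cov K (scale c l) m = c * cov K l m.
Proof.
rewrite /cov big_map mulr_sumr; apply: eq_bigr => p _.
by rewrite mulr_sumr; apply: eq_bigr => q _; rewrite /= !mulrA.
Qed.

Lemma cov_scaler K c l m : cov K l (scale c m) = c * cov K l m.
Proof.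
rewrite /cov mulr_sumr; apply: eq_bigr => p _.
rewrite big_map mulr_sumr; apply: eq_bigr => q _ /=; ring.
Qed.

Lemma cov_sym K l m : (forall t s, K t s = K s t) -> cov K l m = cov K m l.
Proof.
move=> Ks; rewrite /cov exchange_big; apply: eq_bigr => p _; apply: eq_bigr => q _.
by rewrite Ks [q.1 * _]mulrC.
Qed.

Lemma cov_add K K' l m : cov (fun t s => K t s + K' t s) l m = cov K l m + cov K' l m.
Proof.
rewrite /cov -big_split; apply: eq_bigr => p _ /=.
by rewrite -big_split; apply: eq_bigr => q _ /=; rewrite mulrDr.
Qed.

End linear_combinations.

Section gaussian_moments.
Context d (T : measurableType d) (R : realType) (P : probability T R).
Implicit Types (Z : T -> R -> R) (K : R -> R -> R) (l m : seq (R * R)).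

(** What is retained of the Gaussian hypotheses from here on: for every finite combination, the
    variance, and a fourth moment equal to three times its square. *)
Definition has_gaussian_moments Z K := forall l, [/\ measurable_fun [set: T] (lin Z l),
  (\int[P]_w (lin Z l w ^+ 2)%:E = (cov K l l)%:E)%E &
  (\int[P]_w (lin Z l w ^+ 4)%:E = (3 * cov K l l ^+ 2)%:E)%E].

(** A combination of values of [W + S] splits into one of [W] and one of [S], normal and
    independent, and the convolution formulas apply. Negating the coefficients leaves the variance
    unchanged, which yields the symmetry. The maximum extends the process to negative times. *)
Lemma mixed_gaussian_moments (W S : T -> R -> R) (KW KS : R -> R -> R) :
  centered_gaussian_process P W KW -> centered_gaussian_process P S KS ->
  indep_processes P W S ->
  has_gaussian_moments (fun w t => W w (Num.max t 0) + S w (Num.max t 0))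
    (fun t s => KW (Num.max t 0) (Num.max s 0) + KS (Num.max t 0) (Num.max s 0)).
Proof.
move=> gW gS ind l; pose n := size l.
pose c (i : 'I_n) := (tnth (in_tuple l) i).1.
pose t (i : 'I_n) := Num.max (tnth (in_tuple l) i).2 0.
have t0 i : 0 <= t i by rewrite le_max lexx orbT.
have mW i : measurable_fun setT (W ^~ (t i)).
  have [+ _] := gW 1%N (fun=> t i) (fun=> 1) (fun=> t0 i).
  by under eq_fun do rewrite big_ord1 mul1r.
have mS i : measurable_fun setT (S ^~ (t i)).
  have [+ _] := gS 1%N (fun=> t i) (fun=> 1) (fun=> t0 i).
  by under eq_fun do rewrite big_ord1 mul1r.
have Ngauss Z K : centered_gaussian_process P Z K ->
    is_normal_rv P (fun w => - \sum_(i < n) c i * Z w (t i)) 0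
      (\sum_(i < n) \sum_(j < n) c i * c j * K (t i) (t j)).
  move=> /(_ n t (fun i => - c i) t0).
  rewrite (_ : (fun w => _) = (fun w => - \sum_(i < n) c i * Z w (t i))); last first.
    by apply/funext => w; rewrite -sumrN; apply: eq_bigr => i _; rewrite mulNr.
  by under eq_bigr do under eq_bigr do rewrite mulrNN.
pose fW : T -> measurableTypeR R := fun w => \sum_(i < n) c i * W w (t i).
have mfW : fW \in mfun by rewrite inE; exact: (gW n t c t0).1.
pose fS : T -> measurableTypeR R := fun w => \sum_(i < n) c i * S w (t i).
have mfS : fS \in mfun by rewrite inE; exact: (gS n t c t0).1.
pose Y : {RV P >-> measurableTypeR R} := mfun_Sub mfW.
pose V : {RV P >-> measurableTypeR R} := mfun_Sub mfS.
have lW : gaussian_law (distribution P Y) (\sum_(i < n) \sum_(j < n) c i * c j * KW (t i) (t j)).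
  by apply: is_normal_rv_law; [exact: gW|exact: Ngauss].
have lS : gaussian_law (distribution P V) (\sum_(i < n) \sum_(j < n) c i * c j * KS (t i) (t j)).
  by apply: is_normal_rv_law; [exact: gS|exact: Ngauss].
have iYV A B : measurable A -> measurable B ->
    (P (Y @^-1` A `&` V @^-1` B) = P (Y @^-1` A) * P (V @^-1` B))%E.
  move=> mA mB; apply: (indep_linear (Y := fun i w => W w (t i)) (Z := fun i w => S w (t i))) => //.
  by move=> A' B' mA' mB'; exact: ind.
have linE w : lin (fun w t => W w (Num.max t 0) + S w (Num.max t 0)) l w = (Y w : R) + V w.
  rewrite /lin big_tnth -[RHS]/(\sum_(i < n) _ + \sum_(i < n) _) -big_split/=.
  by apply: eq_bigr => i _; rewrite mulrDr.
have covE : cov (fun t s => KW (Num.max t 0) (Num.max s 0) + KS (Num.max t 0) (Num.max s 0)) l l =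
    \sum_(i < n) \sum_(j < n) c i * c j * KW (t i) (t j) +
    \sum_(i < n) \sum_(j < n) c i * c j * KS (t i) (t j).
  rewrite cov_add; congr (_ + _); rewrite /cov big_tnth; apply: eq_bigr => i _;
    by rewrite big_tnth.
rewrite covE; split.
- rewrite (funext linE); apply: (@measurable_funD _ _ _ _ (Y : T -> R) (V : T -> R)).
    exact: (gW n t c t0).1.
  exact: (gS n t c t0).1.
- under eq_integral do rewrite linE; exact: sum_indep_moment2.
- under eq_integral do rewrite linE; exact: sum_indep_moment4.
Qed.

Variables (Z : T -> R -> R) (K : R -> R -> R).
Hypotheses (gZ : has_gaussian_moments Z K) (Ksym : forall t s, K t s = K s t).

Lemma cov_ge0 l : 0 <= cov K l l.
Proof.
rewrite -lee_fin; have [_ <- _] := gZ l.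
by apply: integral_ge0 => w _; rewrite lee_fin sqr_ge0.
Qed.

(** The variances of the combinations [l + m] and [l - m] are nonnegative. *)
Lemma cov_le_half l m : `|cov K l m| <= 2^-1 * (cov K l l + cov K m m).
Proof.
have := cov_ge0 (l ++ m); have := cov_ge0 (l ++ scale (-1) m).
rewrite !cov_catl !cov_catr !cov_scalel !cov_scaler (cov_sym m l Ksym) => h1 h2.
by rewrite ler_norml; apply/andP; split; lra.
Qed.

(* Polarization of [E Y^4 = 3 (E Y^2)^2] *)
Lemma gaussian_moment22 l m :
  (\int[P]_w (lin Z l w ^+ 2 * lin Z m w ^+ 2)%:E =
   (cov K l l * cov K m m + 2 * cov K l m ^+ 2)%:E)%E.
Proof.
have p4 (x : R) : 0 <= x ^+ 4 by rewrite (exprM _ 2 2) sqr_ge0.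
have [ml _ l4] := gZ l; have [mm _ m4] := gZ m.
have [_ _ p] := gZ (l ++ m); have [_ _ q] := gZ (l ++ scale (-1) m).
have me k j : measurable_fun setT (fun w => (lin Z l w ^+ k * lin Z m w ^+ j)%:E).
  by apply/measurable_EFinP; apply: measurable_funM; exact: measurable_funX.
set I := LHS.
have I0 : (0 <= I)%E.
  by apply: integral_ge0 => w _; rewrite lee_fin mulr_ge0 ?sqr_ge0.
have fin4 k (f : T -> R) : measurable_fun setT f -> (forall w, 0 <= f w) -> 0 <= k ->
    (\int[P]_w (k * f w)%:E = k%:E * \int[P]_w (f w)%:E)%E.
  move=> mf f0 k0; under eq_integral do rewrite EFinM.
  rewrite ge0_integralZl//; first exact/measurable_EFinP.
  by move=> w _; rewrite lee_fin.
(* [(x + y)^4 + (x - y)^4 = 2 x^4 + 12 x^2 y^2 + 2 y^4]. All terms are nonnegative, so the identity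
   integrates before the middle one is known to be finite; its finiteness is then read off from the
   identity. *)
have key : (2%:E * (3 * cov K l l ^+ 2)%:E + (12%:E * I + 2%:E * (3 * cov K m m ^+ 2)%:E) =
    (3 * cov K (l ++ m) (l ++ m) ^+ 2)%:E +
    (3 * cov K (l ++ scale (-1) m) (l ++ scale (-1) m) ^+ 2)%:E)%E.
  have mX4 (f : T -> R) : measurable_fun setT f -> measurable_fun setT (fun w => f w ^+ 4).
    by move=> mf; exact: measurable_funX.
  have m22 : measurable_fun setT (fun w => lin Z l w ^+ 2 * lin Z m w ^+ 2).
    by apply: measurable_funM; exact: measurable_funX.
  have p22 w : 0 <= lin Z l w ^+ 2 * lin Z m w ^+ 2 by rewrite mulr_ge0 ?sqr_ge0.
  rewrite -p -q -ge0_integralD//; last 4 first.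
  - by move=> w _; rewrite lee_fin.
  - by apply/measurable_EFinP/mX4; have [] := gZ (l ++ m).
  - by move=> w _; rewrite lee_fin.
  - by apply/measurable_EFinP/mX4; have [] := gZ (l ++ scale (-1) m).
  rewrite -l4 -m4 -!fin4//; try exact: mX4.
  rewrite -ge0_integralD//; last 4 first.
  - by move=> w _; rewrite lee_fin mulr_ge0.
  - by apply/measurable_EFinP; apply: measurable_funM.
  - by move=> w _; rewrite lee_fin mulr_ge0.
  - by apply/measurable_EFinP; apply: measurable_funM => //; exact: mX4.
  rewrite -ge0_integralD//; last 4 first.
  - by move=> w _; rewrite lee_fin mulr_ge0.
  - by apply/measurable_EFinP; apply: measurable_funM => //; exact: mX4.
  - by move=> w _; rewrite -EFinD lee_fin addr_ge0// mulr_ge0.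
  - apply/measurable_EFinP; apply: measurable_funD; apply: measurable_funM => //; exact: mX4.
  apply: eq_integral => w _; rewrite -!EFinD !lin_cat lin_scale; congr (_%:E); ring.
have Ifin : I \is a fin_num.
  rewrite ge0_fin_numE// ltNge leye_eq; apply/eqP => Iy; move: key.
  by rewrite Iy -!EFinM gt0_muley ?lte_fin// addye// addey.
move: key; rewrite -(fineK Ifin) !cov_catl !cov_catr !cov_scalel !cov_scaler (cov_sym m l Ksym).
rewrite -!EFinM -!EFinD => -[key]; congr (_%:E); nra.
Qed.

End gaussian_moments.

(** * The covariance of the increments *)

Section power_differences.
Context (R : realType).
Implicit Types (p x r q t s : R).

Lemma powR_pinfty_bound (a e : R) : 0 < a -> 0 < e -> exists2 L : R, 0 < L &
  forall y, L <= y -> y `^ (- a) <= e.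
Proof.
move=> a0 e0; exists (e `^ (- a^-1)); first exact: powR_gt0.
move=> y Ly; have L0 : 0 < e `^ (- a^-1) by exact: powR_gt0.
have y0 : 0 < y by exact: lt_le_trans Ly.
have /(ge0_ler_powR (ltW a0)) : e `^ (- a^-1) <= y by [].
rewrite !nnegrE (ltW L0) (ltW y0) => /(_ isT isT); rewrite -powRrM mulNr mulVf ?gt_eqF// => h.
rewrite powR_inv1 ?(ltW e0)// in h.
by rewrite powRN -[e]invrK lef_pV2// posrE ?invr_gt0// powR_gt0.
Qed.

(** Second difference of [x^p] with steps [r] and [q]; it governs the covariance of distant
    increments. *)
Definition diff2 p x r q := x `^ p - (x - r) `^ p - (x - q) `^ p + (x - r - q) `^ p.

Let dpow p r x : r < x -> is_derive x (1 : R) (fun y => (y - r) `^ p) (p * (x - r) `^ (p - 1)).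
Proof.
move=> rx; have xr : 0 < x - r by rewrite subr_gt0.
have d1 : is_derive (x - r) 1 ((@powR R) ^~ p) (p * (x - r) `^ (p - 1)) by exact: is_derive1_powR.
have d2 : is_derive x 1 (fun y : R => y - r) 1.
  by apply: is_derive_eq; rewrite subr0.
have := is_derive1_comp (f := (@powR R) ^~ p) (g := fun y => y - r) d1 d2.
by rewrite /GRing.scale/= mulr1.
Qed.

Let cpow p r x : r < x -> {for x, continuous (fun y => (y - r) `^ p)}.
Proof.
move=> rx; apply/differentiable_continuous/derivable1_diffP.
by have [] := dpow p rx.
Qed.

(** Two mean value steps: first for [y^p - (y - r)^p] over a length [q], then for [y^(p - 1)] over a
    length [r]. The exponent [p - 2] is negative, so the smallest admissible argument gives the
    bound. *)
Lemma diff2_bound p x r q : 1 <= p -> p < 2 -> 0 <= r -> 0 <= q -> r + q < x ->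
  `|diff2 p x r q| <= p * (p - 1) * r * q * (x - r - q) `^ (p - 2).
Proof.
move=> p1 p2 r0 q0 xrq.
pose g y := y `^ p - (y - r) `^ p.
have p0 : 0 <= p by lra.
have gE : (fun y => (y - 0) `^ p - (y - r) `^ p) = g.
  by apply/funext => y; rewrite subr0.
have [c cI gc] : exists2 c, c \in `[x - q, x]%R &
    g x - g (x - q) = p * (c `^ (p - 1) - (c - r) `^ (p - 1)) * (x - (x - q)).
  apply: MVT_segment => [|y yI|]; first by lra.
    move: yI; rewrite in_itv/= => /andP[y1 y2].
    have d0 : is_derive y 1 (fun y => (y - 0) `^ p) (p * (y - 0) `^ (p - 1)).
      by apply: dpow; lra.
    have dr : is_derive y 1 (fun y => (y - r) `^ p) (p * (y - r) `^ (p - 1)).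
      by apply: dpow; lra.
    rewrite -gE; apply: is_derive_eq; rewrite subr0; ring.
  apply: continuous_in_subspaceT => y; rewrite inE/= in_itv/= => /andP[y1 y2].
  by rewrite -gE; apply: cvgB; apply: cpow; lra.
move: cI; rewrite in_itv/= => /andP[c1 c2].
have [e eI he] : exists2 e, e \in `[c - r, c]%R &
    c `^ (p - 1) - (c - r) `^ (p - 1) = (p - 1) * e `^ (p - 2) * (c - (c - r)).
  apply: (@MVT_segment _ (fun y => y `^ (p - 1)) (fun y => (p - 1) * y `^ (p - 2))) => [|y yI|].
  - by lra.
  - move: yI; rewrite in_itv/= => /andP[y1 y2].
    have := @dpow (p - 1) 0 y; under eq_fun do rewrite subr0.
    rewrite subr0 (_ : p - 1 - 1 = p - 2); last by ring.
    by apply; lra.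
  - apply: continuous_in_subspaceT => y; rewrite inE/= in_itv/= => /andP[y1 y2].
    apply/differentiable_continuous/derivable1_diffP/derivable_powR.
    by rewrite in_itv/= andbT; lra.
move: eI; rewrite in_itv/= => /andP[e1 e2].
have -> : diff2 p x r q = g x - g (x - q).
  by rewrite /diff2 /g (_ : x - q - r = x - r - q); ring.
rewrite gc he; set E := e `^ _.
have E0 : 0 <= E by exact: powR_ge0.
rewrite (_ : _ * _ = p * (p - 1) * r * q * E); last by ring.
have C0 : 0 <= p * (p - 1) * r * q by rewrite !mulr_ge0// subr_ge0.
rewrite (ger0_norm (mulr_ge0 C0 E0)); apply: ler_wpM2l => //.
have e0 : 0 < e by lra.
have y0 : 0 < x - r - q by lra.
rewrite /E -opprB !powRN lef_pV2 ?posrE ?powR_gt0//.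
by apply: ge0_ler_powR; rewrite ?nnegrE; lra.
Qed.

Lemma diff2_cvg0 p r q : 1 <= p -> p < 2 -> 0 <= r -> 0 <= q ->
  diff2 p x r q @[x --> +oo] --> 0.
Proof.
move=> p1 p2 r0 q0; apply/cvgrPdist_le => /= e e0.
(* The added 1 keeps the constant positive when [p = 1] or a lag is zero. *)
pose C := p * (p - 1) * r * q + 1.
have C0 : 0 < C by rewrite ltr_wpDl// !mulr_ge0//; lra.
have [L L0 hL] := @powR_pinfty_bound (2 - p) (e / C) ltac:(lra) (divr_gt0 e0 C0).
near=> x; rewrite sub0r normrN.
have xL : r + q + L <= x by near: x; apply: nbhs_pinfty_ge; exact: num_real.
apply: le_trans (diff2_bound p1 p2 r0 q0 _) _; first by lra.
have := hL (x - r - q) ltac:(lra); rewrite opprB ler_pdivlMr// mulrC; apply: le_trans.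
by rewrite ler_wpM2r ?powR_ge0// /C lerDl.
Unshelve. all: by end_near. Qed.

End power_differences.

Section sub_fractional_covariance.
Context (R : realType).
Implicit Types (p x r q t s : R).

(** At [p = 2H] this is [subfbm_cov H], and at [p = 1] it is the minimum of [t] and [s], so the same
    estimates treat [S] and [W]. *)
Definition frac_cov p t s := t `^ p + s `^ p - 2^-1 * (`|t - s| `^ p + (t + s) `^ p).

Definition pos_cov p t s := frac_cov p (Num.max t 0) (Num.max s 0).

Lemma pos_cov_sym p t s : pos_cov p t s = pos_cov p s t.
Proof. rewrite /pos_cov /frac_cov distrC; congr (_ - _ * (_ + _)); first by rewrite addrC.
by rewrite addrC. Qed.

Lemma frac_cov1 t s : 0 <= t -> 0 <= s -> frac_cov 1 t s = bm_cov t s.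
Proof.
move=> t0 s0; rewrite /frac_cov /bm_cov !powRr1 ?addr_ge0//.
by have [ts|st] := leP t s; [rewrite ler0_norm ?subr_le0//|rewrite gtr0_norm ?subr_gt0//]; lra.
Qed.

(** The variance of the increment is [|t - s|^p + (t + s)^p - 2^(p - 1) (t^p + s^p)], and convexity
    of [x^p] makes the correction nonpositive. *)
Lemma frac_cov_var p t s : 1 <= p -> 0 <= t -> 0 <= s ->
  frac_cov p t t + frac_cov p s s - 2 * frac_cov p t s <= `|t - s| `^ p.
Proof.
move=> p1 t0 s0; have p0 : p != 0 by rewrite gt_eqF//; lra.
have tI : t \in (`[0, +oo[%classic : set R) by rewrite inE/= in_itv/= andbT.
have sI : s \in (`[0, +oo[%classic : set R) by rewrite inE/= in_itv/= andbT.
have conv : (2^-1 * t + 2^-1 * s) `^ p <= 2^-1 * t `^ p + 2^-1 * s `^ p.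
  have h0 : 0 <= (2^-1 : R) by lra.
  have h1 : (2^-1 : R) <= 1 by lra.
  rewrite {2 4}(_ : 2^-1 = 1 - 2^-1); last by lra.
  exact: (convex_powR p1 (Itv01 h0 h1) tI sI).
rewrite /frac_cov !subrr normr0 powR0//.
have two_p x : 0 <= x -> (x + x) `^ p = 2 `^ p * x `^ p.
  by move=> x0; rewrite (_ : x + x = 2 * x) ?powRM//; ring.
have : (t + s) `^ p <= 2^-1 * (2 `^ p * t `^ p) + 2^-1 * (2 `^ p * s `^ p).
  have -> : t + s = 2 * (2^-1 * t + 2^-1 * s) by lra.
  rewrite powRM// ?addr_ge0 ?mulr_ge0//.
  by apply: le_trans (ler_wpM2l (powR_ge0 2 p) conv) _; lra.
by rewrite (two_p _ t0) (two_p _ s0); lra.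
Qed.

Lemma pos_cov_var p t s : 1 <= p ->
  pos_cov p t t + pos_cov p s s - 2 * pos_cov p t s <= `|t - s| `^ p.
Proof.
move=> p1; apply: (le_trans (frac_cov_var p1 _ _)); rewrite ?le_max ?lexx ?orbT//.
apply: ge0_ler_powR; rewrite ?nnegrE//; first by lra.
have [t0|t0] := leP 0 t; have [s0|s0] := leP 0 s => //.
- by rewrite subr0 ger0_norm// (le_trans _ (ler_norm _))// lerDl; lra.
- by rewrite sub0r normrN ger0_norm// -normrN (le_trans _ (ler_norm _))//; lra.
- by rewrite subrr normr0.
Qed.

(** Covariance of the increments over [[t - r, t]] and [[s - q, s]] of a process with covariance
    [pos_cov p]. *)
Definition incr_cov p t r s q :=
  pos_cov p t s - pos_cov p t (s - q) - pos_cov p (t - r) s + pos_cov p (t - r) (s - q).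

Lemma incr_cov_sym p t r s q : incr_cov p t r s q = incr_cov p s q t r.
Proof.
by rewrite /incr_cov !(pos_cov_sym p t) !(pos_cov_sym p (t - r)); ring.
Qed.

(** When the lags do not exceed [t], the powers of single times cancel. The distances between times
    give the covariance of stationary increments, and the sums of times give a second difference at
    [2 t], which vanishes as [t] grows. *)
Lemma incr_cov_diag p t r q : 1 <= p -> 0 <= r -> 0 <= q -> r <= t -> q <= t ->
  incr_cov p t r t q = 2^-1 * (r `^ p + q `^ p - `|r - q| `^ p) - 2^-1 * diff2 p (t + t) r q.
Proof.
move=> p1 r0 q0 rt qt; rewrite /incr_cov /pos_cov /frac_cov /diff2.
have tr : 0 <= t - r by lra.
have tq : 0 <= t - q by lra.
have t0 : 0 <= t by lra.
rewrite !max_l// subrr normr0 powR0 ?gt_eqF//; last by lra.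
have e1 : t - (t - q) = q by lra.
have e2 : t - r - t = - r by lra.
have e3 : t - r - (t - q) = q - r by lra.
have e4 : t + (t - q) = t + t - q by lra.
have e5 : t - r + t = t + t - r by lra.
have e6 : t - r + (t - q) = t + t - r - q by lra.
rewrite e1 e2 e3 e4 e5 e6 normrN (ger0_norm r0) (ger0_norm q0) (distrC q r); lra.
Qed.

(** For intervals that do not overlap, all absolute values open with the same sign. The powers of
    single times cancel, and second differences remain, one in the distance and one in the sum of
    the times. *)
Lemma incr_cov_off p t r s q : 0 <= r -> 0 <= q -> q <= s -> s + r <= t ->
  incr_cov p t r s q = 2^-1 * diff2 p (t - s + q) r q - 2^-1 * diff2 p (t + s) r q.
Proof.
move=> r0 q0 qs srt; rewrite /incr_cov /pos_cov /frac_cov /diff2.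
have tr : 0 <= t - r by lra.
have sq : 0 <= s - q by lra.
have t0 : 0 <= t by lra.
have s0 : 0 <= s by lra.
rewrite !max_l//.
have e1 : t - (s - q) = t - s + q by lra.
have e2 : t - r - s = t - s + q - r - q by lra.
have e3 : t - r - (s - q) = t - s + q - r by lra.
have e4 : t - s + q - q = t - s by lra.
have e5 : t + (s - q) = t + s - q by lra.
have e6 : t - r + s = t + s - r by lra.
have e7 : t - r + (s - q) = t + s - r - q by lra.
rewrite e1 e2 e3 e4 e5 e6 e7.
have n1 : 0 <= t - s by lra.
have n2 : 0 <= t - s + q by lra.
have n3 : 0 <= t - s + q - r by lra.
have n4 : 0 <= t - s + q - r - q by lra.
rewrite (ger0_norm n1) (ger0_norm n2) (ger0_norm n3) (ger0_norm n4); lra.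
Qed.

Lemma incr_cov_diag_cvg p r q : 1 <= p -> p < 2 -> 0 <= r -> 0 <= q ->
  incr_cov p t r t q @[t --> +oo] --> 2^-1 * (r `^ p + q `^ p - `|r - q| `^ p).
Proof.
move=> p1 p2 r0 q0; apply/cvgrPdist_le => /= e e0.
have /cvgrPdist_le/(_ e e0)[L [_ hL]] := diff2_cvg0 p1 p2 r0 q0.
near=> t.
have rt : r <= t by near: t; apply: nbhs_pinfty_ge; exact: num_real.
have qt : q <= t by near: t; apply: nbhs_pinfty_ge; exact: num_real.
have Lt : L < t by near: t; apply: nbhs_pinfty_gt; exact: num_real.
rewrite incr_cov_diag//.
have t0 : 0 <= t by exact: le_trans rt.
have := hL (t + t) ltac:(lra); rewrite /= sub0r normrN => h.
rewrite (_ : _ - _ = 2^-1 * diff2 p (t + t) r q); last by ring.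
have i2 : 0 <= (2^-1 : R) by lra.
rewrite normrM (ger0_norm i2); lra.
Unshelve. all: by end_near. Qed.

Lemma incr_cov_decay p r q (e : R) : 1 <= p -> p < 2 -> 0 <= r -> 0 <= q -> 0 < e ->
  exists2 L, 0 <= L & forall t s, L <= t -> L <= s -> L <= `|t - s| ->
    `|incr_cov p t r s q| <= e.
Proof.
move=> p1 p2 r0 q0 e0.
have /cvgrPdist_le/(_ e e0)[L [_ hL]] := diff2_cvg0 p1 p2 r0 q0.
have /cvgrPdist_le/(_ e e0)[L' [_ hL']] := diff2_cvg0 p1 p2 q0 r0.
(* The case of the later time in first position. Symmetry reduces the other case to it by exchanging
   [r] and [q], hence the two thresholds. *)
have aux r' q' M : 0 <= r' -> 0 <= q' -> (forall x, M < x -> `|0 - diff2 p x r' q'| <= e) ->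
    forall t s, q' <= s -> `|M| + r' + q' + 1 <= t - s -> `|incr_cov p t r' s q'| <= e.
  move=> r'0 q'0 hM t s qs ts; have Mn := normr_ge0 M; have Ml := ler_norm M.
  rewrite incr_cov_off//; last by lra.
  have h1 := hM (t - s + q') ltac:(lra); have h2 := hM (t + s) ltac:(lra).
  rewrite !sub0r !normrN in h1 h2.
  have i2 : 0 <= (2^-1 : R) by lra.
  rewrite -mulrBr normrM (ger0_norm i2).
  by apply: le_trans (ler_wpM2l i2 (ler_normB _ _)) _; lra.
pose N := `|L| + `|L'| + r + q + 1; have N0 := normr_ge0 L; have N1 := normr_ge0 L'.
exists N; first by rewrite /N; lra.
move=> t s Lt Ls; have [st|ts] := leP s t.
  rewrite ger0_norm ?subr_ge0// => Lts.
  by apply: aux hL _ _ _ _; rewrite /N in Lts Lt Ls; lra.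
rewrite ltr0_norm ?subr_lt0// => Lts; rewrite incr_cov_sym.
by apply: aux hL' _ _ _ _; rewrite /N in Lts Lt Ls; lra.
Qed.

End sub_fractional_covariance.

(** * The exponential law *)

Lemma measurable_patch d d' (T : measurableType d) (T' : measurableType d')
    (D : set T) (f : T -> T') :
  measurable D -> measurable_fun [set: T] f -> measurable_fun [set: T] (f \_ D).
Proof. by move=> mD mf; apply/(measurable_restrictT f mD).1; exact: measurable_funTS. Qed.

Section exponential_law.
Context (R : realType) (theta : R) (theta0 : 0 < theta).

Definition expo : probability (measurableTypeR R) R :=
  exponential_distribution_exponential_prob__canonical__probability_measure_Probability theta0.

Lemma expo_integral (f : R -> \bar R) : measurable_fun [set: R] f ->
  (forall x, 0 <= f x)%E ->
  (\int[expo]_r f r =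
   \int[leb]_(r in `[0%R, +oo[) (f r * (theta * expR (- theta * r))%:E))%E.
Proof.
move=> mf f0.
rewrite (@integral_density _ _ _ leb expo (exponential_pdf theta))//; last 2 first.
- exact: measurable_exponential_pdf.
- by move=> x; rewrite exponential_pdf_ge0// ltW.
rewrite [RHS]integral_mkcond; apply: eq_integral => x _.
rewrite /exponential_pdf !patchE; case: ifPn => //.
by rewrite mule0.
Qed.

Lemma expo_eq_integral (f g : R -> \bar R) :
  measurable_fun [set: R] f -> (forall x, 0 <= f x)%E ->
  measurable_fun [set: R] g -> (forall x, 0 <= g x)%E ->
  (forall x, (0 <= x)%R -> f x = g x) ->
  (\int[expo]_r f r = \int[expo]_r g r)%E.
Proof.
move=> mf f0 mg g0 fg; rewrite !expo_integral//; apply: eq_integral => x.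
by rewrite inE/= in_itv/= andbT => /fg ->.
Qed.

(** Extended valued, because the recursion also meets the negative exponent [2H - 2] before
    finiteness is known. *)
Definition exp_moment (p : R) : \bar R := (\int[expo]_r (r `^ p)%:E)%E.

Let mpow (p : R) : measurable_fun [set: R] (fun r : R => r `^ p).
Proof. exact: measurable_powR. Qed.

Let mexp : measurable_fun [set: R] (fun r : R => expR (- theta * r)).
Proof. by apply: measurableT_comp => //; exact: measurable_funM. Qed.

Lemma exp_moment_ge0 p : (0 <= exp_moment p)%E.
Proof. by apply: integral_ge0 => x _; rewrite lee_fin powR_ge0. Qed.

Lemma exp_moment_obnd p : exp_moment p =
  (\int[leb]_(r in `]0%R, +oo[) (theta * (expR (- theta * r) * r `^ p))%:E)%E.
Proof.
rewrite /exp_moment expo_integral//; last 2 first.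
- exact/measurable_EFinP.
- by move=> x; rewrite lee_fin powR_ge0.
rewrite integral_itv_obnd_cbnd; last first.
  apply: measurable_funTS; apply/measurable_EFinP; apply: measurable_funM => //.
  exact: measurable_funM.
by apply: eq_integral => x _; rewrite -EFinM; congr (_%:E); ring.
Qed.

(** From [exp y >= y^3 / 3!], one power more than [x^p <= x^2]; hence the [6], and a boundary term
    of order [1 / x]. *)
Let tail (p x : R) : 0 <= p -> p <= 2 -> 1 <= x ->
  expR (- theta * x) * x `^ p <= 6 / theta ^+ 3 / x.
Proof.
move=> p0 p2 x1; have x0 : 0 < x by lra.
have tx0 : 0 < theta * x by rewrite mulr_gt0.
apply: (@le_trans _ _ (expR (- theta * x) * x ^+ 2)).
  rewrite ler_wpM2l ?expR_ge0// -powR_mulrn; last exact: ltW.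
  by apply: ler_powR.
rewrite mulNr expRN mulrC ler_pdivrMr ?expR_gt0//.
have := expR_ge1Dxn 2 (ltW tx0) => h.
have h3 : (theta * x) ^+ 3 / 6 <= expR (theta * x).
  by apply: le_trans h; rewrite lerDr.
apply: (@le_trans _ _ (6 / theta ^+ 3 / x * ((theta * x) ^+ 3 / 6))).
  by rewrite le_eqVlt; apply/orP; left; apply/eqP; field; rewrite !gt_eqF.
by rewrite ler_wpM2l// !divr_ge0// ?exprn_ge0// ltW.
Qed.

(** Integration by parts with primitive [theta exp(- theta x) x^p], which tends to zero at infinity,
    and at the origin because [p > 0]. Applied at [p = 2H - 1] it reaches the singularity
    [r^(2H - 2)] of the kernel. *)
Lemma exp_moment_rec (p : R) : 0 < p -> p <= 2 ->
  (p%:E * exp_moment (p - 1) = theta%:E * exp_moment p)%E.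
Proof.
move=> p0 p2.
pose F (x : R) : R := theta * (expR (- theta * x) * x `^ p).
pose D : set R := `]0%R, +oo[%classic.
have mbig q : measurable_fun D (fun r : R => theta * (expR (- theta * r) * r `^ q)).
  apply: measurable_funTS; apply: measurable_funM => //.
  exact: measurable_funM.
have pos (q r : R) : 0 <= theta * (expR (- theta * r) * r `^ q).
  by rewrite !mulr_ge0 ?expR_ge0 ?powR_ge0// ltW.
have Zl (c q : R) : 0 <= c ->
    (c%:E * \int[leb]_(r in D) (theta * (expR (- theta * r) * r `^ q))%:E =
     \int[leb]_(r in D) (c * (theta * (expR (- theta * r) * r `^ q)))%:E)%E.
  move=> c0; rewrite -ge0_integralZl.
  - by apply: eq_integral => r _; rewrite -EFinM.
  - exact: measurable_itv.
  - by apply/measurable_EFinP; exact: mbig.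
  - by move=> r _; rewrite lee_fin; exact: pos.
  - by rewrite lee_fin.
rewrite !exp_moment_obnd (Zl _ _ (ltW p0)) (Zl _ _ (ltW theta0)).
have cE : continuous (fun x : R => expR (- theta * x)).
  move=> x; apply: continuous_comp; last exact: continuous_expR.
  exact: mulrl_continuous.
have cP (q x : R) : D x -> {for x, continuous (fun r : R => r `^ q)}.
  move=> Dx; apply/differentiable_continuous/derivable1_diffP/derivable_powR.
  exact: Dx.
have cF (c q x : R) : D x -> {for x, continuous (fun r => c * (theta * (expR (- theta * r) * r `^ q)))}.
  move=> Dx; apply: cvgM; first exact: cvg_cst.
  apply: cvgM; first exact: cvg_cst.
  by apply: cvgM; [exact: cE|exact: cP].
(* The shift by 2 ensures [u n < 1 < v n] from [n = 0] on. *)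
pose u (n : nat) : R := n.+2%:R^-1; pose v (n : nat) : R := n.+2%:R.
apply: (@improper_by_parts R u v F).
- have DE x : D x = (0 < x) by rewrite /D/= in_itv/= andbT.
  apply/seteqP; split => x; rewrite DE.
    move=> x0; pose y := Num.max x x^-1.
    have [n yn] : exists n : nat, y <= n.+2%:R.
      exists (Num.truncn y); apply/ltW/(lt_trans (truncnS_gt _)); rewrite ltr_nat//.
    exists n => //=; rewrite in_itv/=; apply/andP; split.
      rewrite /u -[x]invrK lef_pV2 ?posrE ?invr_gt0//.
      by apply: le_trans yn; rewrite le_max lexx orbT.
    by apply: le_trans yn; rewrite le_max lexx.
  by move=> [n _] /=; rewrite in_itv/= => /andP[+ _]; apply: lt_le_trans; rewrite invr_gt0.
- move=> m n mn; rewrite subsetEset => x /=; rewrite !in_itv/= => /andP[ux xv].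
  apply/andP; split.
    by apply: le_trans ux; rewrite lef_pV2 ?posrE// ler_nat !ltnS.
  by apply: le_trans xv _; rewrite ler_nat !ltnS.
- move=> n; rewrite /u /v; apply: (@lt_trans _ _ 1); last by rewrite ltr1n.
  by rewrite invf_lt1// ltr1n.
- by move=> x _; rewrite mulr_ge0 ?pos// ltW.
- by move=> x _; rewrite mulr_ge0 ?pos// ltW.
- by move=> x Dx; exact: cF.
- by move=> x Dx; exact: cF.
- move=> x; rewrite /D/= in_itv/= andbT => x0.
  have dp : is_derive x 1 ((@powR R) ^~ p) (p * x `^ (p - 1)) by exact: is_derive1_powR.
  have de : is_derive x 1 (fun y : R => expR (- theta * y)) (- theta * expR (- theta * x)).
    by apply: is_derive_eq; rewrite /GRing.scale/=; ring.
  rewrite (_ : F = cst theta * ((fun y : R => expR (- theta * y)) * ((@powR R) ^~ p))); last first.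
    by apply/funext => y; rewrite !fctE.
  apply: is_derive_eq; rewrite !fctE /GRing.scale/=; ring.
- rewrite -[X in _ --> X](subrr 0); apply: cvgB.
    apply/cvgrPdist_le => /= e e0; near=> n.
    have v1 : 1 <= v n by rewrite /v ler1n.
    rewrite sub0r normrN (ger0_norm (pos _ _)).
    apply: le_trans (ler_wpM2l (ltW theta0) (tail (ltW p0) p2 v1)) _.
    have v0 : 0 < v n by rewrite /v.
    rewrite mulrA (ler_pdivrMr _ _ v0) [e * _]mulrC -(ler_pdivrMr _ _ e0).
    near: n; exists (Num.truncn (theta * (6 / theta ^+ 3) / e)) => // n /= Cn.
    by apply/ltW; apply: lt_le_trans (truncnS_gt _) _; rewrite ler_nat ltnS ltnW.
  apply/cvgrPdist_le => /= e e0.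
  have [L L0 hL] := powR_pinfty_bound p0 (divr_gt0 e0 theta0).
  near=> n; rewrite sub0r normrN (ger0_norm (pos _ _)).
  have un : 0 < u n by rewrite invr_gt0.
  apply: (@le_trans _ _ (theta * u n `^ p)).
    apply: ler_wpM2l; first exact: ltW.
    apply: ler_piMl; first exact: powR_ge0.
    by rewrite expR_le1 mulNr oppr_le0; apply: mulr_ge0; exact: ltW.
  rewrite mulrC -(ler_pdivlMr _ _ theta0).
  have Lv : L <= v n.
    near: n; exists (Num.truncn L) => // n /= Ln.
    by apply/ltW; apply: lt_le_trans (truncnS_gt _) _; rewrite ler_nat ltnS ltnW.
  by rewrite /u -powR_inv1// -powRrM mulN1r; exact: hL.
Unshelve. all: by end_near. Qed.

Lemma exp_moment0 : exp_moment 0 = 1%E.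
Proof.
rewrite /exp_moment; under eq_integral do rewrite powRr0.
exact: (integral_mass1 _ (probability_setT expo)).
Qed.

Lemma exp_moment1 : exp_moment 1 = (theta^-1)%:E.
Proof.
have := @exp_moment_rec 1 ltr01 ltac:(lra); rewrite subrr exp_moment0 mul1e => h.
have := congr1 (fun z => ((theta^-1)%:E * z)%E) h.
by rewrite mule1 muleA -EFinM mulVf ?gt_eqF// mul1e.
Qed.

(** The recursion started from [exp_moment 0 = 1] makes the second moment finite, and
    [r^p <= 1 + r^2]. *)
Lemma exp_moment_fin p : 0 <= p -> p <= 2 -> exp_moment p \is a fin_num.
Proof.
move=> p0 p2.
have h2 : exp_moment 2 \is a fin_num.
  have := @exp_moment_rec 2 ltac:(lra) ltac:(lra); rewrite (_ : 2 - 1 = 1 :> R); last by lra.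
  rewrite exp_moment1 -EFinM => h.
  have := congr1 (fun z => ((theta^-1)%:E * z)%E) h.
  by rewrite muleA -EFinM -EFinM mulVf ?gt_eqF// mul1e => <-.
rewrite ge0_fin_numE ?exp_moment_ge0//.
apply: (@le_lt_trans _ _ (1 + exp_moment 2)%E); last first.
  by rewrite -(fineK h2) -EFinD ltry.
rewrite -exp_moment0 /exp_moment -ge0_integralD//; last 4 first.
- by move=> x _; rewrite lee_fin powR_ge0.
- exact/measurable_EFinP.
- by move=> x _; rewrite lee_fin powR_ge0.
- exact/measurable_EFinP.
apply: ge0_le_integral => //.
- by move=> x _; rewrite lee_fin powR_ge0.
- exact/measurable_EFinP.
- by apply/measurable_EFinP; exact: measurable_funD.
move=> x _; rewrite -EFinD lee_fin powRr0.
(* A power of a negative base is 1 by convention. *)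
have [x0|x0] := ltP x 0; first by rewrite lt0_powR1// lerDl powR_ge0.
have [x1|x1] := leP x 1; last first.
  by apply: (@le_trans _ _ (x `^ 2)); [apply: ler_powR => //; exact: ltW|rewrite lerDr].
apply: (@le_trans _ _ 1); last by rewrite lerDl powR_ge0.
have <- : 1 `^ p = 1 :> R by rewrite powR1.
by apply: ge0_ler_powR => //; rewrite nnegrE.
Qed.

Lemma ge0_integral_shift (q : R) (f : R -> \bar R) :
  measurable_fun [set: R] f -> (forall x, 0 <= f x)%E ->
  (\int[leb]_x f (x - q)%R = \int[leb]_x f x)%E.
Proof.
move=> mf f0; have mfN : measurable_fun [set: R] (fun x : R => f (- x)%R).
  apply: measurableT_comp => //; exact: measurableT_comp.
rewrite -[RHS](ge0_integral_comp_subr 0)//; under [RHS]eq_integral do rewrite sub0r.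
rewrite -(ge0_integral_comp_subr q mfN)//.
by apply: eq_integral => x _; rewrite opprB.
Qed.

(** Translating the exponential density by [q] produces the factor [exp(- theta q)]. *)
Lemma expo_memoryless (q : R) (f : R -> R) : 0 <= q ->
  measurable_fun [set: R] f -> (forall x, 0 <= f x) ->
  (\int[expo]_r ((q <= (r : R))%R%:R * f ((r : R) - q)%R)%:E =
   (expR (- theta * q))%:E * \int[expo]_r (f r)%:E)%E.
Proof.
move=> q0 mf f0.
have mi : measurable_fun [set: R] (fun r : R => (q <= r)%R%:R : R).
  rewrite (_ : (fun _ => _) = \1_(`[q, +oo[%classic)) //.
  apply/funext => t; rewrite indicE; congr (_%:R); congr nat_of_bool.
  by apply/idP/idP; rewrite inE/= in_itv/= andbT.
have mfq : measurable_fun [set: R] (fun r : R => f (r - q)).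
  by apply: measurableT_comp => //; exact: measurable_funB.
rewrite !expo_integral//; last 3 first.
- exact/measurable_EFinP.
- by apply/measurable_EFinP; exact: measurable_funM.
- by move=> x; rewrite lee_fin mulr_ge0.
rewrite -ge0_integralZl//; last 2 first.
- apply: measurable_funTS; apply: emeasurable_funM; apply/measurable_EFinP => //.
  exact: measurable_funM.
- by move=> x _; rewrite -EFinM lee_fin !mulr_ge0 ?expR_ge0// ltW.
pose G (x : R) := ((expR (- theta * q))%:E * ((f x)%:E * (theta * expR (- theta * x))%:E))%E.
have mG : measurable_fun [set: R] (G \_ `[0%R, +oo[%classic).
  apply: measurable_patch => //.
  apply: emeasurable_funM => //; apply: emeasurable_funM; apply/measurable_EFinP => //.
  exact: measurable_funM.
have G0 x : (0 <= (G \_ `[0%R, +oo[%classic) x)%E.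
  apply: erestrict_ge0 => y _.
  by rewrite /G -!EFinM lee_fin !mulr_ge0 ?expR_ge0// ltW.
rewrite [RHS]integral_mkcond.
transitivity (\int[leb]_x (G \_ `[0%R, +oo[%classic) (x - q)%R)%E; last first.
  exact: ge0_integral_shift.
rewrite [LHS]integral_mkcond.
apply: eq_integral => x _; rewrite !patchE /G.
have [qx|xq] := leP q x.
  rewrite !mem_set/= ?in_itv/= ?andbT ?subr_ge0//; last exact: le_trans qx.
  rewrite mul1r -!EFinM; congr (_%:E).
  rewrite (_ : - theta * x = - theta * q + - theta * (x - q)); last by ring.
  by rewrite expRD; ring.
rewrite [X in _ = if X then _ else _]memNset/=; last first.
  by rewrite in_itv/= andbT subr_ge0; apply/negP; rewrite -ltNge.
by case: ifP => // _; rewrite mul0r mul0e.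
Qed.

Lemma expo_laplace : (\int[expo]_q (expR (- theta * (q : R)))%:E = (2^-1)%:E)%E.
Proof.
have th2 : 0 < 2 * theta by rewrite mulr_gt0.
rewrite expo_integral//; last exact/measurable_EFinP.
transitivity ((2^-1)%:E * \int[leb]_x (exponential_pdf (2 * theta) x)%:E)%E; last first.
  by rewrite integral_exponential_pdf// mule1.
rewrite -ge0_integralZl; [|by []|by apply/measurable_EFinP; exact: measurable_exponential_pdf|
  by move=> x _; rewrite lee_fin exponential_pdf_ge0// ltW|by rewrite lee_fin].
rewrite [LHS]integral_mkcond; apply: eq_integral => x _.
rewrite /exponential_pdf !patchE; case: ifPn => _; last by rewrite mule0.
rewrite -!EFinM; congr (_%:E).
rewrite (_ : - (2 * theta) * x = - theta * x + - theta * x) ?expRD; last by ring.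
by field.
Qed.

(** The distance of two independent exponential variables is exponential of the same rate: by
    memorylessness each of the events [q <= r] and [r <= q] contributes the moment times the mean of
    [exp(- theta q)], which is one half. *)
Lemma expo_abs_moment (p : R) : 0 < p ->
  (\int[expo]_q \int[expo]_r (`|(r : R) - (q : R)| `^ p)%:E = exp_moment p)%E.
Proof.
move=> p0.
pose h (q r : R) := (q <= r)%R%:R * (r - q) `^ p.
have h0 q r : 0 <= h q r by rewrite mulr_ge0// powR_ge0.
have mh : measurable_fun [set: R * R] (fun x => (h x.1 x.2)%:E).
  apply/measurable_EFinP; apply: measurable_funM.
    rewrite (_ : (fun _ => _) = \1_[set x : R * R | x.1 <= x.2]); last first.
      apply/funext => t; rewrite indicE; congr (_%:R); congr nat_of_bool.
      by apply/idP/idP; rewrite inE.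
    apply: measurable_indic; rewrite -[X in measurable X]setTI.
    exact: measurable_fun_le.
  exact: (measurableT_comp (mpow p) (measurable_funB measurable_snd measurable_fst)).
have mh1 q : measurable_fun [set: R] (fun r => (h q r)%:E).
  exact: (measurableT_comp mh (measurable_pair1 _)).
have mh2 q : measurable_fun [set: R] (fun r => (h r q)%:E).
  exact: (measurableT_comp mh (measurable_pair2 _)).
transitivity (\int[expo]_q (\int[expo]_r (h q r)%:E + \int[expo]_r (h r q)%:E))%E.
  apply: eq_integral => q _; rewrite -ge0_integralD//;
    [|by move=> *; rewrite lee_fin|exact: mh1|by move=> *; rewrite lee_fin|exact: mh2].
  apply: eq_integral => r _; rewrite -EFinD /h; congr (_%:E).
  case: (ltgtP q r) => qr; rewrite ?mul1r ?mul0r ?addr0 ?add0r.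
  - by rewrite gtr0_norm// subr_gt0.
  - by rewrite ltr0_norm ?subr_lt0// opprB.
  - by rewrite qr subrr normr0 powR0 ?gt_eqF// addr0.
have h0e (x : R * R) : (0 <= (h x.1 x.2)%:E)%E by rewrite lee_fin.
have mF : measurable_fun [set: R] (fun q : R => \int[expo]_r (h q r)%:E)%E.
  exact: (measurable_fun_fubini_tonelli_F (m2 := expo) (fun x => (h x.1 x.2)%:E) mh h0e).
have mG : measurable_fun [set: R] (fun q : R => \int[expo]_r (h r q)%:E)%E.
  exact: (measurable_fun_fubini_tonelli_G (m1 := expo) (fun x => (h x.1 x.2)%:E) mh h0e).
have Eh (q : R) : 0 <= q -> (\int[expo]_r (h q r)%:E = (expR (- theta * q))%:E * exp_moment p)%E.
  by move=> q0; rewrite /h (expo_memoryless q0 (mpow p))// => x; exact: powR_ge0.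
clearbody h.
have half : (\int[expo]_q \int[expo]_r (h q r)%:E = (2^-1)%:E * exp_moment p)%E.
  transitivity (\int[expo]_q ((expR (- theta * (q : R)))%:E * exp_moment p))%E.
    apply: expo_eq_integral; [exact: mF| | | |exact: Eh].
    - by move=> x; apply: integral_ge0 => y _; rewrite lee_fin.
    - by apply: emeasurable_funM => //; exact/measurable_EFinP.
    - by move=> x; rewrite mule_ge0 ?lee_fin ?expR_ge0// exp_moment_ge0.
  rewrite ge0_integralZr; first by rewrite expo_laplace.
  - by [].
  - exact/measurable_EFinP.
  - by move=> x _; rewrite lee_fin expR_ge0.
  - exact: exp_moment_ge0.
rewrite ge0_integralD; first last.
- exact: mG.
- by move=> x _; apply: integral_ge0 => y _; rewrite lee_fin.
- exact: mF.
- by move=> x _; apply: integral_ge0 => y _; rewrite lee_fin.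
- by [].
rewrite -(fubini_tonelli (m1 := expo) (m2 := expo) (fun x => (h x.1 x.2)%:E) mh h0e).
rewrite half -ge0_muleDl ?lee_fin//.
by rewrite -EFinD (_ : 2^-1 + 2^-1 = 1 :> R) ?mul1e//; lra.
Qed.

End exponential_law.

(** * The deterministic numerator *)

Section kernel_integral.
Context (R : realType) (theta H : R) (theta0 : 0 < theta) (H0 : 2^-1 < H) (H1 : H < 1).

Let i1 : 0 < 2 * H - 1. Proof. by move: H0 => h; lra. Qed.
Let i2 : 0 < 2 * H. Proof. by move: H0 => h; lra. Qed.
Let i7 : 0 < H. Proof. by move: H0 => h; lra. Qed.
Let i3 : 2 * H <= 2. Proof. by move: H1 => h; lra. Qed.
Let i4 : 2 * H - 1 <= 2. Proof. by move: H1 => h; lra. Qed.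
Let i5 : 2 * H - 2 <= 0. Proof. by move: H1 => h; lra. Qed.
Let i6 : 0 < 2 - 2 * H. Proof. by move: H1 => h; lra. Qed.

Local Notation a := (2 * H - 2).

Let g (x : R) : R := expR (- theta * x) * x `^ a.

Let g0 x : 0 <= g x. Proof. by rewrite mulr_ge0 ?expR_ge0 ?powR_ge0. Qed.

Let mexp : measurable_fun [set: R] (fun r : R => expR (- theta * r)).
Proof. by apply: measurableT_comp => //; exact: measurable_funM. Qed.

Let mg : measurable_fun [set: R] g.
Proof. by apply: measurable_funM => //; exact: measurable_powR. Qed.

(** Two steps of the recursion, from the exponent [2H - 2] up to [2H]. The denominator is
    [2 alpha_H], which the prefactor of the kernel term will cancel. *)
Let total : (\int[leb]_(x in `[0%R, +oo[) (g x)%:E =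
  (theta / (2 * H * (2 * H - 1)))%:E * exp_moment theta0 (2 * H))%E.
Proof.
have e1 := exp_moment_rec theta0 i2 i3.
have e2 := exp_moment_rec theta0 i1 i4.
have aE : 2 * H - 1 - 1 = a by lra.
rewrite aE in e2.
have gE : (theta%:E * \int[leb]_(x in `[0%R, +oo[) (g x)%:E = exp_moment theta0 a)%E.
  rewrite -ge0_integralZl.
  - rewrite /exp_moment expo_integral.
    + by apply: eq_integral => x _; rewrite -!EFinM /g; congr (_%:E); ring.
    + by apply/measurable_EFinP; exact: measurable_powR.
    + by move=> x; rewrite lee_fin powR_ge0.
  - exact: measurable_itv.
  - by apply/measurable_EFinP; exact: measurable_funTS.
  - by move=> x _; rewrite lee_fin.
  - by rewrite lee_fin ltW.
move: e1 e2 gE; move: (exp_moment theta0 a) (exp_moment theta0 (2 * H - 1)) (exp_moment theta0 (2 * H)) => M0 M1 M2 e1 e2 gE.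
have e2' : (M0 = ((2 * H - 1)^-1 * theta)%:E * M1)%E.
  by rewrite EFinM -muleA -e2 muleA -EFinM mulVf ?lt0r_neq0// mul1e.
have e1' : (M1 = ((2 * H)^-1 * theta)%:E * M2)%E.
  by rewrite EFinM -muleA -e1 muleA -EFinM mulVf ?lt0r_neq0// mul1e.
have := congr1 (fun z => ((theta^-1)%:E * z)%E) gE.
rewrite muleA -EFinM mulVf ?lt0r_neq0// mul1e => ->.
rewrite e2' e1' !muleA -!EFinM; congr ((_%:E) * _)%E.
by field; rewrite !gt_eqF.
Qed.

Let total_fin : (\int[leb]_(x in `[0%R, +oo[) (g x)%:E)%E \is a fin_num.
Proof. by rewrite total fin_numM// exp_moment_fin// ltW. Qed.

(** The part of the inner integral with [(t - s)^(2H - 2)], written in the lag; it increases to a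
    finite limit. [B] below is the part with [(t + s)^(2H - 2)], which tends to zero. *)
Let A (t : R) : \bar R := (\int[leb]_(x in `[0%R, t]) (g x)%:E)%E.

Let A_ge0 t : (0 <= A t)%E.
Proof. by apply: integral_ge0 => x _; rewrite lee_fin. Qed.

Let A_mono s t : s <= t -> (A s <= A t)%E.
Proof.
move=> st; apply: ge0_subset_integral => //.
- by apply/measurable_EFinP; exact: measurable_funTS.
- by move=> x _; rewrite lee_fin.
- by move=> x /=; rewrite !in_itv/= => /andP[-> xs]; exact: le_trans st.
Qed.

Let A_le t : (A t <= \int[leb]_(x in `[0%R, +oo[) (g x)%:E)%E.
Proof.
apply: ge0_subset_integral => //.
- by apply/measurable_EFinP; exact: measurable_funTS.
- by move=> x _; rewrite lee_fin.
- by move=> x /=; rewrite !in_itv/= => /andP[->].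
Qed.

Let A_fin t : A t \is a fin_num.
Proof.
rewrite ge0_fin_numE//; apply: le_lt_trans (A_le t) _.
by rewrite ltey_eq total_fin.
Qed.

Let A_cvg : fine (A t) @[t --> +oo] --> fine (\int[leb]_(x in `[0%R, +oo[) (g x)%:E)%E.
Proof.
(* Monotone convergence is applied along the integers; monotonicity of [A] extends the limit to real
   times. *)
have : A n%:R @[n --> \oo] --> (\int[leb]_(x in `[0%R, +oo[) (g x)%:E)%E.
  exact: ge0_cvgn_integral.
rewrite -(fineK total_fin) => /fine_cvgP[_]; move/cvgrPdist_le => Ac.
apply/cvgrPdist_le => /= e e0.
have [N _ hN] := Ac e e0.
near=> t.
have Nt : N%:R <= t by near: t; apply: nbhs_pinfty_ge; exact: num_real.
have := hN N (leqnn N); rewrite /= => h.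
rewrite ger0_norm ?subr_ge0; last by apply: fine_le => //; exact: A_le.
apply: le_trans h; rewrite ger0_norm ?subr_ge0; last by apply: fine_le => //; exact: A_le.
by rewrite lerD2l lerN2; apply: fine_le => //; exact: A_mono.
Unshelve. all: by end_near. Qed.

Let B (t : R) : \bar R :=
  (\int[leb]_(s in `[0%R, t]) (expR (- theta * (t - s)) * (t + s) `^ a)%:E)%E.

Let mE1 t : measurable_fun [set: R] (fun s : R => expR (- theta * (t - s))).
Proof. by apply: (measurableT_comp mexp); exact: measurable_funB. Qed.

Let B_ge0 t : (0 <= B t)%E.
Proof. by apply: integral_ge0 => x _; rewrite lee_fin mulr_ge0 ?expR_ge0 ?powR_ge0. Qed.

(** Reflecting, the integral is at most that over the whole half-line, which is the total mass of
    the exponential law divided by [theta]. *)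
Let E_int t : (\int[leb]_(s in `[0%R, t]) (expR (- theta * (t - s)))%:E <= (theta^-1)%:E)%E.
Proof.
pose h := (fun x : R => (expR (- theta * x))%:E) \_ `[0%R, +oo[%classic.
have mh : measurable_fun [set: R] h.
  by apply: measurable_patch => //; exact/measurable_EFinP.
have h0 x : (0 <= h x)%E by apply: erestrict_ge0 => ? _; rewrite lee_fin expR_ge0.
apply: (@le_trans _ _ (\int[leb]_s h (t - s)%R)%E).
  rewrite integral_mkcond; apply: ge0_le_integral => //.
  - by move=> x _; apply: erestrict_ge0 => ? _; rewrite lee_fin expR_ge0.
  - apply: measurable_patch; first exact: measurable_itv.
    apply/measurable_EFinP. exact: mE1.
  - by apply: (measurableT_comp mh); exact: measurable_funB.
  - move=> s _; rewrite /h !patchE; case: ifPn => [|_]; last exact: (h0 (t - s)).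
    by rewrite inE/= in_itv/= => /andP[_ st]; rewrite mem_set//= in_itv/= subr_ge0 st.
rewrite ge0_integral_comp_subr// /h -integral_mkcond.
have : (\int[leb]_(r in `[0%R, +oo[) (theta%:E * (expR (- theta * r))%:E) = 1)%E.
  rewrite -[RHS](integral_mass1 1%E (probability_setT (expo theta0))) expo_integral//.
  by apply: eq_integral => r _; rewrite mul1e EFinM.
rewrite ge0_integralZl; [|by []|exact/measurable_EFinP/measurable_funTS|
  by move=> x _; rewrite lee_fin expR_ge0|by rewrite lee_fin ltW] => e1.
have := congr1 (fun z => ((theta^-1)%:E * z)%E) e1.
by rewrite mule1 muleA -EFinM mulVf ?gt_eqF// mul1e => ->.
Qed.

(** [(t + s)^(2H - 2) <= t^(2H - 2)] since the exponent is negative. *)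
Let B_le t : 0 < t -> (B t <= (t `^ a / theta)%:E)%E.
Proof.
move=> t0; rewrite EFinM; apply: le_trans (lee_wpmul2l _ (E_int t)); last by rewrite lee_fin powR_ge0.
rewrite -ge0_integralZl; first last.
- by rewrite lee_fin powR_ge0.
- by move=> x _; rewrite lee_fin expR_ge0.
- by apply/measurable_EFinP; apply: measurable_funTS; exact: mE1.
- exact: measurable_itv.
apply: ge0_le_integral.
- exact: measurable_itv.
- by move=> x _; rewrite lee_fin mulr_ge0 ?expR_ge0 ?powR_ge0.
- apply: measurable_funTS; apply/measurable_EFinP; apply: measurable_funM; first exact: mE1.
  apply: (measurableT_comp (measurable_powR a)); exact: measurable_funD.
- apply: measurable_funTS; apply/measurable_EFinP; apply: measurable_funM => //; exact: mE1.
- move=> s; rewrite /= in_itv/= => /andP[s0 st]; rewrite -EFinM lee_fin mulrC.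
  rewrite ler_wpM2r ?expR_ge0// -(opprB 2) !powRN lef_pV2 ?posrE ?powR_gt0//; last by lra.
  by apply: ge0_ler_powR; rewrite ?nnegrE ?(ltW i6)//; lra.
Qed.

(** The bound [t^(2H - 2) / theta] blows up at the origin, whereas Cesaro averaging asks for a bound
    on the whole half-line. For small [t] the length of the interval compensates:
    [t * t^(2H - 2) = t^(2H - 1) <= 1]. *)
Let B_le_small t : 0 < t -> t <= 1 -> (B t <= 1)%E.
Proof.
move=> t0 t1.
apply: (@le_trans _ _ (\int[leb]_(s in `[0%R, t]) cst (t `^ a)%:E s)%E).
  apply: ge0_le_integral.
  - exact: measurable_itv.
  - by move=> x _; rewrite lee_fin mulr_ge0 ?expR_ge0 ?powR_ge0.
  - apply: measurable_funTS; apply/measurable_EFinP; apply: measurable_funM; first exact: mE1.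
    apply: (measurableT_comp (measurable_powR a)); exact: measurable_funD.
  - by [].
  - move=> s; rewrite /= in_itv/= => /andP[s0 st]; rewrite lee_fin.
    apply: (@le_trans _ _ (1 * (t + s) `^ a)).
      apply: ler_wpM2r; first exact: powR_ge0.
      by rewrite expR_le1 mulNr oppr_le0 mulr_ge0 ?subr_ge0// ltW.
    rewrite mul1r -(opprB 2) !powRN lef_pV2 ?posrE ?powR_gt0//; last by lra.
    by apply: ge0_ler_powR; rewrite ?nnegrE ?(ltW i6)//; lra.
rewrite integral_cst//= lebesgue_measure_itv/= lte_fin t0 oppr0 adde0 -EFinM lee_fin.
rewrite mulrC (_ : a = (2 * H - 1) - 1); last by lra.
rewrite mulr_powRB1; [|exact: ltW|exact: i1].
apply: (@le_trans _ _ (1 `^ (2 * H - 1))); last by rewrite powR1.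
by apply: ge0_ler_powR; rewrite ?nnegrE ?(ltW i1)//; lra.
Qed.

Let B_neg t : t <= 0 -> B t = 0%E.
Proof.
move=> t0; apply: null_set_integral => //.
  apply: measurable_funTS; apply/measurable_EFinP; apply: measurable_funM; first exact: mE1.
  by apply: (measurableT_comp (measurable_powR a)); exact: measurable_funD.
by apply: etrans (lebesgue_measure_itv _) _; rewrite /= lte_fin ltNge t0.
Qed.

Let B_bound t : (B t <= (1 + theta^-1)%:E)%E.
Proof.
have ti : 0 < theta^-1 by rewrite invr_gt0.
have [t0|t0] := leP t 0; first by rewrite B_neg// lee_fin; lra.
have [t1|t1] := leP t 1.
  by apply: le_trans (B_le_small t0 t1) _; rewrite lee_fin; lra.
apply: le_trans (B_le t0) _; rewrite lee_fin.
apply: (@le_trans _ _ (1 / theta)); last by lra.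
apply: ler_wpM2r; first exact: ltW.
by rewrite -[leRHS](powRr0 t); apply: ler_powR; [lra|exact: i5].
Qed.

Let B_fin t : B t \is a fin_num.
Proof. by rewrite (ge0_fin_numE (B_ge0 t)); exact: le_lt_trans (B_bound t) (ltry _). Qed.

Let B_cvg : fine (B t) @[t --> +oo] --> 0.
Proof.
apply/cvgrPdist_le => /= e e0.
have [L L0 hL] := @powR_pinfty_bound _ (2 - 2 * H) (e * theta) i6 (mulr_gt0 e0 theta0).
near=> t.
have Lt : L <= t by near: t; apply: nbhs_pinfty_ge; exact: num_real.
have t0 : 0 < t by lra.
rewrite sub0r normrN (ger0_norm (fine_ge0 (B_ge0 t))) -lee_fin (fineK (B_fin t)).
apply: le_trans (B_le t0) _; rewrite lee_fin ler_pdivrMr//.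
by have := hL t Lt; rewrite opprB.
Unshelve. all: by end_near. Qed.

Let k (t s : R) : R := expR (- theta * (t - s)) * ((t - s) `^ a + (t + s) `^ a).

Let AE t : (\int[leb]_(s in `[0%R, t]) (expR (- theta * (t - s)) * (t - s) `^ a)%:E = A t)%E.
Proof.
rewrite /A integral_mkcond [RHS]integral_mkcond.
rewrite -[RHS](ge0_integral_comp_subr t).
- apply: eq_integral => s _; rewrite !patchE /=.
  have -> : (t - s \in `[0, t]%classic) = (s \in `[0, t]%classic).
    by apply/idP/idP; rewrite !inE/= !in_itv/= => /andP[? ?]; apply/andP; split; lra.
  by [].
- by apply: measurable_patch => //; exact/measurable_EFinP.
- by move=> x; apply: erestrict_ge0 => ? _; rewrite lee_fin.
Qed.

Let kE t : (\int[leb]_(s in `[0%R, t]) (k t s)%:E = A t + B t)%E.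
Proof.
rewrite -AE /B -ge0_integralD.
- by apply: eq_integral => s _; rewrite -EFinD /k mulrDr.
- exact: measurable_itv.
- by move=> x _; rewrite lee_fin mulr_ge0 ?expR_ge0 ?powR_ge0.
- apply: measurable_funTS; apply/measurable_EFinP; apply: measurable_funM; first exact: mE1.
  by apply: (measurableT_comp (measurable_powR a)); exact: measurable_funB.
- by move=> x _; rewrite lee_fin mulr_ge0 ?expR_ge0 ?powR_ge0.
- apply: measurable_funTS; apply/measurable_EFinP; apply: measurable_funM; first exact: mE1.
  by apply: (measurableT_comp (measurable_powR a)); exact: measurable_funD.
Qed.

Let mj : measurable_fun [set: R] (fun t => fine (A t + B t)%E).
Proof.
apply: measurableT_comp => //.
under eq_fun do rewrite -kE integral_mkcond.
(* An integral with a moving endpoint becomes an integral over the line of a jointly measurable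
   function of both variables. *)
pose K (x : R * R) : \bar R := if x.2 \in `[0%R, x.1]%classic then (k x.1 x.2)%:E else 0%E.
have K0 x : (0 <= K x)%E.
  rewrite /K; case: ifP => // _.
  by rewrite lee_fin mulr_ge0 ?expR_ge0 ?addr_ge0 ?powR_ge0.
have mK : measurable_fun [set: R * R] K.
  pose C := [set x : R * R | 0 <= x.2 <= x.1].
  have mC : measurable C.
    rewrite (_ : C = [set x : R * R | 0 <= x.2] `&` [set x | x.2 <= x.1]); last first.
      by apply/seteqP; split => x /= => [/andP[]|[? ?]] //; apply/andP.
    apply: measurableI.
      rewrite -[X in measurable X]setTI; exact: measurable_fun_le.
    rewrite -[X in measurable X]setTI; exact: measurable_fun_le.
  rewrite (_ : K = (fun x => (k x.1 x.2)%:E) \_ C); last first.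
    apply/funext => x; rewrite /K patchE.
    have -> // : (x.2 \in `[0, x.1]%classic) = (x \in C).
    by apply/idP/idP => /set_mem h; apply/mem_set; move: h; rewrite /C /= in_itv.
  apply: measurable_patch => //; apply/measurable_EFinP; rewrite /k.
  have md : measurable_fun [set: R * R] (fun x => x.1 - x.2) by exact: measurable_funB.
  apply: measurable_funM; first exact: (measurableT_comp mexp md).
  apply: measurable_funD; first exact: (measurableT_comp (measurable_powR a) md).
  apply: (measurableT_comp (measurable_powR a)); exact: measurable_funD.
have := measurable_fun_fubini_tonelli_F (m2 := leb) K mK K0.
rewrite /fubini_F; congr (measurable_fun _ _).
Qed.

Lemma double_kernel_integral_cvg :
  T^-1 * (alpha_H H * double_kernel_integral theta H T) @[T --> +oo] -->
  2^-1 * theta * fine (exp_moment theta0 (2 * H)).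
Proof.
have jE T : double_kernel_integral theta H T =
    \int[leb]_(t in `[0, T]) fine (A t + B t)%E.
  by apply: eq_Rintegral => t _; rewrite -kE.
have := @Rintegral_average_cvg _ (fun t => fine (A t + B t)%E)
  (fine (\int[leb]_(x in `[0%R, +oo[) (g x)%:E)%E + (1 + theta^-1))
  (fine (\int[leb]_(x in `[0%R, +oo[) (g x)%:E)%E) mj => h.
have -> : 2^-1 * theta * fine (exp_moment theta0 (2 * H)) =
    alpha_H H * fine (\int[leb]_(x in `[0%R, +oo[) (g x)%:E)%E.
  rewrite total fineM//=; last by apply: exp_moment_fin => //; exact: ltW.
  by rewrite /alpha_H; field; rewrite !gt_eqF//.
under eq_fun do rewrite jE mulrCA.
apply: cvgM; first exact: cvg_cst.
apply: h => [t t0|].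
  rewrite (ger0_norm (fine_ge0 (adde_ge0 (A_ge0 t) (B_ge0 t)))).
  rewrite (fineD (A_fin t) (B_fin t)); apply: lerD.
    by apply: fine_le => //; exact: A_le.
  rewrite -lee_fin (fineK (B_fin t)); exact: B_bound.
rewrite (_ : (fun t => _) = (fun t => fine (A t)) + (fun t => fine (B t))); last first.
  by apply/funext => t; rewrite (fineD (A_fin t) (B_fin t)).
rewrite -[X in _ --> X]addr0; exact: (cvgD A_cvg B_cvg).
Qed.

End kernel_integral.

(** * The moving average representation *)

Lemma continuous_comp_max0 (R : realType) (f : R -> R) :
  {within [set t | 0 <= t], continuous f} -> continuous (fun t : R => f (Num.max t 0)).
Proof.
move=> /subspace_continuousP cf x.
have m0 y : [set t : R | 0 <= t] (Num.max y 0) by rewrite /= le_max lexx orbT.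
apply: cvg_comp (cf _ (m0 x)).
move=> A [e e0 eA]; rewrite /= in eA.
exists e => // y /= xy; apply: eA; last exact: m0.
rewrite /ball_/=; apply: le_lt_trans xy.
have [x0|x0] := leP x 0; have [y0|y0] := leP y 0.
- by rewrite subrr normr0.
- by rewrite sub0r normrN gtr0_norm// ler0_norm; lra.
- by rewrite subr0 !gtr0_norm//; lra.
- by [].
Qed.

Lemma integral_comp_subr (R : realType) (t : R) (f : R -> \bar R) :
  measurable_fun [set: R] f -> (\int[leb]_x f (t - x)%R = \int[leb]_x f x)%E.
Proof.
move=> mf; rewrite integralE [RHS]integralE; congr (_ - _)%E.
  apply: etrans (ge0_integral_comp_subr t (measurable_funepos mf) (funepos_ge0 f)).
  by apply: eq_integral => x _; rewrite !funeposE.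
apply: etrans (ge0_integral_comp_subr t (measurable_funeneg mf) (funeneg_ge0 f)).
by apply: eq_integral => x _; rewrite !funenegE.
Qed.

Section pathwise_representation.
Context (R : realType) (theta : R) (theta0 : 0 < theta).
Local Notation expo := (expo theta0).

Lemma expo_integral_EFin (f : R -> R) : measurable_fun [set: R] f ->
  (\int[expo]_r (f r)%:E =
   \int[leb]_(r in `[0%R, +oo[) (f r * (theta * expR (- theta * r)))%:E)%E.
Proof.
move=> mf; have mE : measurable_fun [set: R] (EFin \o f) by exact/measurable_EFinP.
have d0 r : 0 <= theta * expR (- theta * r) by rewrite mulr_ge0 ?expR_ge0 ?ltW.
rewrite integralE [RHS]integralE; congr (_ - _)%E.
  rewrite expo_integral; [|exact: measurable_funepos|by []].
  apply: eq_integral => r _; rewrite !funeposE /= -!EFin_max -EFinM.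
  by rewrite maxr_pMl// mul0r.
rewrite expo_integral; [|exact: measurable_funeneg|by []].
apply: eq_integral => r _; rewrite !funenegE /= -!EFin_max -EFinM.
by rewrite maxr_pMl// mul0r mulNr.
Qed.

Variables (z X : R -> R).
Hypotheses (cz : continuous z) (z0 : forall t : R, t <= 0 -> z t = 0)
  (cX : {within [set t | 0 <= t], continuous X})
  (XE : forall t : R, 0 <= t -> X t = z t - theta * \int[leb]_(s in `[0, t]) X s).

Let Y (t : R) : R := \int[leb]_(s in `[0, t]) X s.

Let Xc (t : R) : R := X (Num.max t 0).

Let cXc : continuous Xc. Proof. exact: continuous_comp_max0. Qed.

Let XcE (t : R) : 0 <= t -> Xc t = X t. Proof. by move=> t0; rewrite /Xc max_l. Qed.

Let YE t : Y t = \int[leb]_(s in `[0, t]) Xc s.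
Proof.
by apply: eq_Rintegral => s; rewrite inE/= in_itv/= => /andP[s0 _]; rewrite XcE.
Qed.

Let iX t : leb.-integrable `[0, t] (EFin \o Xc).
Proof.
apply: continuous_compact_integrable; first exact: segment_compact.
exact: continuous_subspaceT.
Qed.

Let dY (t : R) : 0 < t -> is_derive t 1 Y (X t).
Proof.
move=> t0; have tt : t < t + 1 by rewrite ltrDl.
have [dF Fx] := @continuous_FTC1_closed _ Xc 0 t (t + 1) tt (iX _) t0 (@cXc t).
rewrite (funext YE); apply: DeriveDef; first exact: dF.
by rewrite -derive1E Fx XcE// ltW.
Qed.

Let cY (t : R) : 0 < t -> {within `[0, t], continuous Y}.
Proof.
move=> t0; rewrite (funext YE).
exact: (parameterized_integral_continuous (ltW t0) (iX t)).
Qed.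

Let cexp (t : R) : continuous (fun s : R => expR (- theta * (t - s))).
Proof.
move=> s; apply: continuous_comp; last exact: continuous_expR.
apply: cvgM; first exact: cvg_cst.
by apply: cvgB; [exact: cvg_cst|exact: cvg_id].
Qed.

(** With [Y] the primitive of [X], the equation reads [Y' = z - theta Y], so
    [theta exp(- theta (t - s)) Y s] has derivative [theta exp(- theta (t - s)) z s] in [s]; it
    vanishes at [s = 0]. *)
Let convolution (t : R) : 0 < t ->
  (\int[leb]_(s in `[0%R, t]) (theta * expR (- theta * (t - s)) * z s)%:E = (theta * Y t)%:E)%E.
Proof.
move=> t0; pose F (s : R) : R := theta * expR (- theta * (t - s)) * Y s.
have cF : {within `[0, t], continuous F}.
  have cG : {within `[0, t], continuous (fun s => theta * expR (- theta * (t - s)))}.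
    by apply: continuous_subspaceT => s; apply: cvgM; [exact: cvg_cst|exact: cexp].
  by move=> s; apply: cvgM; [exact: cG|exact: cY].
have dF s : s \in `]0, t[ -> is_derive s 1 F (theta * expR (- theta * (t - s)) * z s).
  rewrite in_itv/= => /andP[s0 st].
  have de : is_derive s 1 (fun s : R => expR (- theta * (t - s))) (theta * expR (- theta * (t - s))).
    by apply: is_derive_eq; rewrite /GRing.scale/=; ring.
  have dy := dY s0.
  rewrite (_ : F = cst theta * ((fun s : R => expR (- theta * (t - s))) * Y)); last first.
    by apply/funext => y; rewrite !fctE /F mulrA.
  apply: is_derive_eq; rewrite !fctE /GRing.scale/= (XE (ltW s0)) -/(Y s); ring.
have := @continuous_FTC2 R (fun s => theta * expR (- theta * (t - s)) * z s) F 0 t t0.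
move=> ->.
- rewrite /F subrr mulr0 expR0 mulr1 (_ : Y 0 = 0) ?mulr0 ?sube0//.
  by rewrite /Y set_itv1 Rintegral_set1.
- apply: continuous_subspaceT => s; apply: cvgM; last exact: cz.
  by apply: cvgM; [exact: cvg_cst|exact: cexp].
- split.
  + by move=> s st; have [] := dF s st.
  + by have /(continuous_within_itvP _ t0)[] := cF.
  + by have /(continuous_within_itvP _ t0)[] := cF.
- by move=> s st; rewrite derive1E; have [] := dF s st.
Qed.

Lemma max0_continuous : continuous (fun r : R => Num.max r 0).
Proof. by apply: (@continuous_comp_max0 _ id); apply: continuous_subspaceT => x. Qed.

Lemma incr_continuous t : continuous (fun r : R => z t - z (t - Num.max r 0)).
Proof.
move=> r; apply: cvgB; first exact: cvg_cst.
apply: continuous_comp; last exact: cz.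
by apply: cvgB; [exact: cvg_cst|exact: max0_continuous].
Qed.

(** Lags beyond [t] reach times where [z] vanishes, so for [t >= 0] only the compact range [[0, t]]
    of lags matters. Integrability under the exponential law follows. *)
Lemma incr_bounded t : exists B : R, forall r, `|z t - z (t - Num.max r 0)| <= B.
Proof.
have [t0|t0] := leP 0 t; last first.
  exists 0 => r; rewrite !z0 ?subrr ?normr0//; last by lra.
  have : 0 <= Num.max r 0 by rewrite le_max lexx orbT.
  lra.
have cf : continuous (fun r => `|z t - z (t - r)|).
  move=> r; apply: cvg_norm; apply: cvgB; first exact: cvg_cst.
  apply: continuous_comp; last exact: cz.
  by apply: cvgB; [exact: cvg_cst|exact: cvg_id].
have [c _ hc] := EVT_max t0 (continuous_subspaceT cf).
exists `|z t - z (t - c)| => r; set m := Num.max r 0.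
have m0 : 0 <= m by rewrite le_max lexx orbT.
have [mt|tm] := leP m t; first by apply: hc; rewrite in_itv/= m0.
have -> : z (t - m) = z (t - t) by rewrite !z0//; lra.
by apply: hc; rewrite in_itv/= t0 lexx.
Qed.

(** [theta] times the integral of [X] is the convolution of [z] with the exponential density; the
    extension of [z] by zero absorbs the cut-off at lag [t]. *)
Lemma ou_representation (t : R) : 0 <= t ->
  X t = \int[expo]_r (z t - z (t - Num.max r 0)).
Proof.
move=> t0.
have muT : (expo [set: R] < +oo)%E by rewrite probability_setT ltry.
have [B hB] := incr_bounded t.
have mh (f : R -> R) : continuous f -> measurable_fun [set: R] f by exact: continuous_measurable_fun.
have mz : measurable_fun [set: R] (fun r => z (t - Num.max r 0)).
  apply: mh => r; apply: continuous_comp; last exact: cz.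
  by apply: cvgB; [exact: cvg_cst|exact: max0_continuous].
have ih : expo.-integrable setT (EFin \o (fun r => z t - z (t - Num.max r 0))).
  by apply: (bounded_integrable (B := B)) => //; exact: (mh _ (@incr_continuous t)).
have ic : expo.-integrable setT (EFin \o cst (z t)).
  exact: finite_measure_integrable_cst.
have key : (\int[expo]_r (z (t - Num.max (r : R) 0))%:E = (theta * Y t)%:E)%E.
  rewrite expo_integral_EFin//.
  have [{}t0|tle0] := ltP 0 t; last first.
    have te : t = 0 by lra.
    rewrite integral0_eq.
      by rewrite te /Y set_itv1 Rintegral_set1 mulr0.
    move=> r; rewrite /= in_itv/= andbT => r0.
    by rewrite max_l// z0 ?mul0r// te; lra.
  rewrite -convolution// integral_mkcond [RHS]integral_mkcond.
  rewrite -[RHS](integral_comp_subr t).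
    apply: eq_integral => r _; rewrite !patchE.
    have [r0|r0] := leP 0 r; last first.
      rewrite memNset/=; last by rewrite in_itv/= andbT; lra.
      by rewrite memNset//= in_itv/=; lra.
    rewrite mem_set/=; last by rewrite in_itv/= andbT.
    have [rt|tr] := leP r t.
      rewrite mem_set/=; last by rewrite in_itv/=; lra.
      have -> : t - (t - r) = r by lra.
      by rewrite mulrC.
    rewrite memNset/=; last by rewrite in_itv/=; lra.
    by rewrite z0 ?mul0r//; lra.
  apply: measurable_patch => //; apply/measurable_EFinP; apply: mh => s.
  by apply: cvgM; [apply: cvgM; [exact: cvg_cst|exact: cexp]|exact: cz].
have e1 : Rintegral expo setT (cst (z t)) = z t.
  by rewrite Rintegral_cst// [X in fine X]probability_setT mulr1.
rewrite XE// -[X in _ = X](subKr (z t)); congr (_ - _).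
rewrite -[X in X - _]e1 -RintegralB//.
have : \int[expo]_r z (t - Num.max (r : R) 0) = theta * Y t by rewrite /Rintegral key.
move=> <-; apply: eq_Rintegral => r _; rewrite /cst/=; lra.
Qed.

End pathwise_representation.

(** * Averages over a product space *)

Lemma ge0_dominated_cvg d (T : measurableType d) (R : realType)
    (mu : {measure set T -> \bar R}) (f_ : nat -> T -> R) (f g : T -> R) :
  (forall n, measurable_fun [set: T] (f_ n)) -> measurable_fun [set: T] g ->
  (forall n x, 0 <= f_ n x) -> (forall n x, f_ n x <= g x) ->
  (\int[mu]_x (g x)%:E < +oo)%E ->
  (forall x, f_ n x @[n --> \oo] --> f x) ->
  (\int[mu]_x (f_ n x)%:E @[n --> \oo] --> \int[mu]_x (f x)%:E)%E.
Proof.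
move=> mf_ mg f0 fg gy ff.
have g0 x : 0 <= g x by exact: le_trans (f0 0%N x) (fg 0%N x).
have mf : measurable_fun [set: T] f.
  by apply: (measurable_fun_cvg (h := f_)) => // x _; exact: ff.
have /(_ _)/(_ _)/(_ _)[] := @dominated_convergence _ _ _ mu _ measurableT
  (fun n x => (f_ n x)%:E) (EFin \o f) (EFin \o g)
  (fun n => proj2 (measurable_EFinP _ _) (mf_ n)) (proj2 (measurable_EFinP _ _) mf) => //.
- apply/aeW => x _; apply/cvg_EFin; last exact: ff.
  exact: nearW.
- apply/integrableP; split; first exact/measurable_EFinP.
  by under eq_integral do rewrite /= ger0_norm//.
- by apply/aeW => x n _; rewrite /= ger0_norm// lee_fin.
Qed.

Lemma measurable_Rintegral d1 d2 (T1 : measurableType d1) (T2 : measurableType d2)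
    (R : realType) (m2 : {sigma_finite_measure set T2 -> \bar R}) (f : T1 * T2 -> R) :
  measurable_fun [set: T1 * T2] f ->
  measurable_fun [set: T1] (fun x => \int[m2]_y f (x, y)).
Proof.
move=> /measurable_EFinP mf; apply: measurableT_comp => //.
under eq_fun do rewrite integralE.
apply: emeasurable_funB.
- have := measurable_fun_fubini_tonelli_F (m2 := m2) _ (measurable_funepos mf) (funepos_ge0 _).
  rewrite (_ : fubini_F _ _ = fun x => (\int[m2]_y (fun y => (f (x, y))%:E)^\+ y)%E)//.
  by apply/funext => x; apply: eq_integral => y _; rewrite !funeposE.
- have := measurable_fun_fubini_tonelli_F (m2 := m2) _ (measurable_funeneg mf) (funeneg_ge0 _).
  rewrite (_ : fubini_F _ _ = fun x => (\int[m2]_y (fun y => (f (x, y))%:E)^\- y)%E)//.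
  by apply/funext => x; apply: eq_integral => y _; rewrite !funenegE.
Qed.

Lemma average_uniform (R : realType) (T : R) (T0 : 0 < T) (f : R -> R) :
  measurable_fun [set: R] f -> (forall t, 0 <= f t) ->
  leb.-integrable `[0, T] (EFin \o f) ->
  (\int[uniform_prob T0]_t (f t)%:E = (T^-1 * \int[leb]_(t in `[0, T]) f t)%:E)%E.
Proof.
move=> mf f0 fi; rewrite integral_uniform//; last exact/measurable_EFinP.
rewrite subr0 EFinM; congr (_ * _)%E.
by rewrite /Rintegral fineK//; exact: integrable_fin_num.
Qed.

(** The masses of the level sets of [f] become the coefficients of the discretized moving
    average. *)
Lemma sfun_integral d (T : measurableType d) (R : realType) (mu : probability T R)
    (f : {nnsfun T >-> R}) (g : R -> R) :
  (\int[mu]_t (g (f t))%:E =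
   (\sum_(x <- sfun_values f) fine (mu (f @^-1` [set x])) * g x)%:E)%E.
Proof.
have e x : (fun t => (f t == x)%:R : R) = \1_(f @^-1` [set x]).
  by apply/funext => t; rewrite indicE; congr (_%:R); congr nat_of_bool; apply/eqP/idP => [h|]; rewrite inE.
have muT : (mu [set: T] < +oo)%E by rewrite probability_setT ltry.
have i1 x : mu.-integrable setT (EFin \o (fun t => (f t == x)%:R * g x)).
  apply: (bounded_integrable (B := `|g x|)) => //.
    by apply: measurable_funM => //; exact: sfun_eq_measurable.
  by move=> t _; case: (_ == _); rewrite ?mul1r// mul0r normr0.
transitivity (\int[mu]_t (\sum_(x <- sfun_values f) ((f t == x)%:R * g x)%:E))%E.
  by apply: eq_integral => t _; rewrite sumEFin -sfun_comp_sum.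
rewrite integral_sum// -sumEFin; apply: eq_bigr => x _.
transitivity (\int[mu]_t ((g x)%:E * (\1_(f @^-1` [set x]) t)%:E))%E.
  by apply: eq_integral => t _; rewrite -e -EFinM mulrC.
have mA : measurable (f @^-1` [set x]) by [].
rewrite integralZl//; last first.
  by apply: (bounded_integrable (B := 1)) => // t _; rewrite indicE; case: (_ \in _); rewrite ?normr1 ?normr0.
rewrite integral_indic// setIT EFinM muleC fineK//.
exact: fin_num_measure.
Qed.

Section average_variance.
Context d d' (T : measurableType d) (T' : measurableType d') (R : realType).
Context (P : probability T R) (U : probability T' R).
Variables (Q : T -> T' -> R) (m : T' -> R) (k : T' -> T' -> R) (A : T -> R) (v M kappa : R).
Hypotheses (mQ : measurable_fun [set: T * T'] (fun p => Q p.1 p.2))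
  (Q0 : forall w t, 0 <= Q w t)
  (mm : measurable_fun [set: T'] m) (m0 : forall t, 0 <= m t)
  (mk : measurable_fun [set: T' * T'] (fun p => k p.1 p.2)) (k0 : forall t s, 0 <= k t s)
  (EQ : forall t, (\int[P]_w (Q w t)%:E = (m t)%:E)%E)
  (EQQ : forall t s, (\int[P]_w (Q w t * Q w s)%:E = (m t * m s + k t s)%:E)%E)
  (mA : measurable_fun [set: T] A)
  (AE : forall w, (\int[U]_t (Q w t)%:E = (A w)%:E)%E)
  (mM : (\int[U]_t (m t)%:E = M%:E)%E)
  (kkappa : (\int[U]_t \int[U]_s (k t s)%:E <= kappa%:E)%E)
  (v0 : 0 <= v).

Let A0 w : 0 <= A w.
Proof. by rewrite -lee_fin -AE; apply: integral_ge0 => t _; rewrite lee_fin. Qed.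

Let M0 : 0 <= M.
Proof. by rewrite -lee_fin -mM; apply: integral_ge0 => t _; rewrite lee_fin. Qed.

Let E1 : (\int[P]_w (A w)%:E = M%:E)%E.
Proof.
under eq_integral do rewrite -AE.
have := fubini_tonelli (m1 := P) (m2 := U) (fun p => (Q p.1 p.2)%:E).
move=> /= -> //; last by move=> p; rewrite lee_fin.
  by under eq_integral do rewrite EQ.
exact/measurable_EFinP.
Qed.

Let mQ1 t : measurable_fun [set: T] (Q ^~ t).
Proof. exact: (measurableT_comp mQ (measurable_pair2 _)). Qed.

Let mQ2 w : measurable_fun [set: T'] (Q w).
Proof. exact: (measurableT_comp mQ (measurable_pair1 _)). Qed.

Let mk1 t : measurable_fun [set: T'] (k t).
Proof. exact: (measurableT_comp mk (measurable_pair1 _)). Qed.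

Let EQA t : (\int[P]_w (Q w t * A w)%:E = (m t * M)%:E + \int[U]_s (k t s)%:E)%E.
Proof.
transitivity (\int[P]_w \int[U]_s (Q w t * Q w s)%:E)%E.
  apply: eq_integral => w _; rewrite EFinM -AE -ge0_integralZl//.
  - exact/measurable_EFinP.
  - by move=> s _; rewrite lee_fin.
  - by rewrite lee_fin.
have mQQ : measurable_fun [set: T * T'] (fun p => (Q p.1 t * Q p.1 p.2)%:E).
  apply/measurable_EFinP; apply: measurable_funM => //.
  exact: (measurableT_comp (mQ1 t) measurable_fst).
have := fubini_tonelli (m1 := P) (m2 := U) (fun p => (Q p.1 t * Q p.1 p.2)%:E) mQQ.
move=> /= -> //; last by move=> p; rewrite lee_fin mulr_ge0.
under eq_integral do rewrite EQQ EFinD.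
rewrite ge0_integralD//.
- congr (_ + _)%E; rewrite EFinM -mM -ge0_integralZl//.
  + exact/measurable_EFinP.
  + by move=> s _; rewrite lee_fin.
  + by rewrite lee_fin.
- by move=> s _; rewrite lee_fin mulr_ge0.
- by apply/measurable_EFinP; exact: measurable_funM.
- by move=> s _; rewrite lee_fin.
- exact/measurable_EFinP.
Qed.

Let E2 : (\int[P]_w (A w ^+ 2)%:E <= (M ^+ 2 + kappa)%:E)%E.
Proof.
have -> : (\int[P]_w (A w ^+ 2)%:E = \int[P]_w \int[U]_t (Q w t * A w)%:E)%E.
  apply: eq_integral => w _; under [RHS]eq_integral do rewrite mulrC EFinM.
  rewrite ge0_integralZl//.
  - by rewrite AE -EFinM.
  - exact/measurable_EFinP.
  - by move=> s _; rewrite lee_fin.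
  - by rewrite lee_fin.
have mQA : measurable_fun [set: T * T'] (fun p => (Q p.1 p.2 * A p.1)%:E).
  apply/measurable_EFinP; apply: measurable_funM => //.
  exact: (measurableT_comp mA measurable_fst).
have := fubini_tonelli (m1 := P) (m2 := U) (fun p => (Q p.1 p.2 * A p.1)%:E) mQA.
move=> /= -> //; last by move=> p; rewrite lee_fin mulr_ge0.
under eq_integral do rewrite EQA.
rewrite ge0_integralD//.
- rewrite EFinD; apply: leeD => //.
  under eq_integral do rewrite mulrC EFinM.
  rewrite ge0_integralZl//; first by rewrite mM -EFinM.
  + exact/measurable_EFinP.
  + by move=> s _; rewrite lee_fin.
- by move=> s _; rewrite lee_fin mulr_ge0.
- by apply/measurable_EFinP; exact: measurable_funM.
- by move=> t _; apply: integral_ge0 => s _; rewrite lee_fin.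
- apply: (measurable_fun_fubini_tonelli_F (m2 := U) (fun p => (k p.1 p.2)%:E)).
    exact/measurable_EFinP.
  by move=> p; rewrite lee_fin.
Qed.

(** Here [A] averages the field [Q] over a time of law [U], and [k] is the covariance of [Q]. By
    Tonelli's theorem the mean of [A^2] is at most [M^2 + kappa]. The cross term of the square is
    moved to the other side, so that only nonnegative functions are integrated. *)
Lemma average_variance_le : (\int[P]_w ((A w - v) ^+ 2)%:E <= ((M - v) ^+ 2 + kappa)%:E)%E.
Proof.
have sq0 w : 0 <= (A w - v) ^+ 2 by exact: sqr_ge0.
have msq : measurable_fun [set: T] (fun w => (A w - v) ^+ 2).
  by apply: measurable_funX; exact: measurable_funB.
have : (\int[P]_w ((A w - v) ^+ 2)%:E + (2 * v * M)%:E =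
    \int[P]_w (A w ^+ 2)%:E + (v ^+ 2)%:E)%E.
  rewrite -[(v ^+ 2)%:E](integral_mass1 _ (probability_setT P)).
  have -> : ((2 * v * M)%:E = \int[P]_w (2 * v * A w)%:E)%E.
    under eq_integral do rewrite EFinM.
    rewrite ge0_integralZl//; first by rewrite E1 -EFinM.
    - exact/measurable_EFinP.
    - by move=> w _; rewrite lee_fin.
    - by rewrite lee_fin mulr_ge0.
  rewrite -!ge0_integralD//.
  - by apply: eq_integral => w _; rewrite -!EFinD; congr (_%:E); ring.
  - by move=> w _; rewrite lee_fin sqr_ge0.
  - by apply/measurable_EFinP; exact: measurable_funX.
  - by move=> w _; rewrite lee_fin sqr_ge0.
  - by move=> w _; rewrite lee_fin sqr_ge0.
  - exact/measurable_EFinP.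
  - by move=> w _; rewrite lee_fin !mulr_ge0.
  - by apply/measurable_EFinP; exact: measurable_funM.
move: E2; set a := (\int[P]_w (A w ^+ 2)%:E)%E; set b := (\int[P]_w ((A w - v) ^+ 2)%:E)%E.
have a0 : (0 <= a)%E by apply: integral_ge0 => w _; rewrite lee_fin sqr_ge0.
have b0 : (0 <= b)%E by apply: integral_ge0 => w _; rewrite lee_fin.
case: a a0 => [a| |]// _; case: b b0 => [b| |]// _.
by rewrite !lee_fin -!EFinD => h [e]; nra.
Qed.

End average_variance.

(** * Discretized moving averages *)

(** Both times are also kept away from the origin, because the formulas for the increments ask for
    lags shorter than the times. *)
Definition off_diagonal_decay (R : realType) (f : R -> R -> R) := forall e, 0 < e ->
  exists2 L : R, 0 <= L & forall t s, L <= t -> L <= s -> L <= `|t - s| -> `|f t s| <= e.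

Lemma off_diagonal_decay_sum (R : realType) (I : eqType) (l : seq I) (f : I -> R -> R -> R) :
  (forall i, i \in l -> off_diagonal_decay (f i)) ->
  off_diagonal_decay (fun t s => \sum_(i <- l) f i t s).
Proof.
elim: l => [_ e e0|i l IH fl e e0].
  by exists 0 => // t s _ _ _; rewrite big_nil normr0 ltW.
have e2 : 0 < e / 2 by rewrite divr_gt0.
have [L L0 hL] := fl i (mem_head _ _) _ e2.
have [L' L'0 hL'] := IH (fun j jl => fl j (mem_behead (s := i :: l) jl)) _ e2.
exists (L + L') => [|t s tL sL tsL]; first by rewrite addr_ge0.
rewrite big_cons; apply: le_trans (ler_normD _ _) _.
have h1 := hL t s ltac:(lra) ltac:(lra) ltac:(lra).
have h2 := hL' t s ltac:(lra) ltac:(lra) ltac:(lra).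
lra.
Qed.

Lemma off_diagonal_decayZ (R : realType) (c : R) (f : R -> R -> R) :
  off_diagonal_decay f -> off_diagonal_decay (fun t s => c * f t s).
Proof.
move=> df e e0; have c0 : 0 < `|c| + 1 by rewrite ltr_wpDl.
have [L L0 hL] := df (e / (`|c| + 1)) (divr_gt0 e0 c0).
exists L => // t s tL sL tsL; rewrite normrM.
have := hL t s tL sL tsL; rewrite ler_pdivlMr// mulrC mulrDl mul1r.
by have := normr_ge0 (f t s); lra.
Qed.

Lemma off_diagonal_decayD (R : realType) (f g : R -> R -> R) :
  off_diagonal_decay f -> off_diagonal_decay g ->
  off_diagonal_decay (fun t s => f t s + g t s).
Proof.
move=> df dg e e0; have e2 : 0 < e / 2 by rewrite divr_gt0.
have [L L0 hL] := df _ e2; have [L' L'0 hL'] := dg _ e2.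
exists (L + L') => [|t s tL sL tsL]; first by rewrite addr_ge0.
apply: le_trans (ler_normD _ _) _.
have h1 := hL t s ltac:(lra) ltac:(lra) ltac:(lra).
have h2 := hL' t s ltac:(lra) ltac:(lra) ltac:(lra).
lra.
Qed.

Lemma cvg_sum_seq (R : realType) (I : eqType) (l : seq I) (T : Type) (F : set_system T)
    (FF : Filter F) (f : I -> T -> R) (a : I -> R) :
  (forall i, i \in l -> f i t @[t --> F] --> a i) ->
  \sum_(i <- l) f i t @[t --> F] --> \sum_(i <- l) a i.
Proof.
elim: l => [_|i l IH fl].
  rewrite big_nil; under eq_fun do rewrite big_nil; exact: cvg_cst.
rewrite big_cons; under eq_fun do rewrite big_cons.
apply: cvgD; first by apply: fl; rewrite mem_head.
by apply: IH => j jl; apply: fl; rewrite in_cons jl orbT.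
Qed.

Lemma measurable_pos_cov d (T : measurableType d) (R : realType) (p : R) (f g : T -> R) :
  measurable_fun [set: T] f -> measurable_fun [set: T] g ->
  measurable_fun [set: T] (fun x => pos_cov p (f x) (g x)).
Proof.
have aux (h : T -> R) : measurable_fun [set: T] h -> measurable_fun [set: T] (fun x => h x `^ p).
  by move=> mh; exact: (measurableT_comp (measurable_powR p) mh).
have aux0 (h : T -> R) : measurable_fun [set: T] h -> measurable_fun [set: T] (fun x => Num.max (h x) 0).
  by move=> mh; exact: measurable_maxr.
move=> /aux0 mf /aux0 mg; apply: measurable_funB.
  by apply: measurable_funD; exact: aux.
apply: measurable_funM => //; apply: measurable_funD; apply: aux.
  by apply: measurableT_comp => //; exact: measurable_funB.
exact: measurable_funD.
Qed.

Section gaussian_moving_average.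
Context d (T : measurableType d) (R : realType) (P : probability T R).
Context (theta H : R) (theta0 : 0 < theta) (H0 : 2^-1 < H) (H1 : H < 1).
Local Notation expo := (expo theta0).
Local Notation phi := (step_approx R).

Definition mixed_cov (t s : R) := pos_cov 1 t s + pos_cov (2 * H) t s.

(** Bound for the variance of an increment over a lag [x], Brownian plus sub-fractional. Writing
    [x^1] keeps the two terms in the same form. *)
Definition mixed_var (x : R) := x `^ 1 + x `^ (2 * H).

Let H2 : 1 <= 2 * H. Proof. by move: H0 => h; lra. Qed.
Let H4 : 0 < 2 * H. Proof. by move: H0 => h; lra. Qed.

Lemma mixed_var_ge0 x : 0 <= mixed_var x.
Proof. by rewrite addr_ge0 ?powR_ge0. Qed.

Lemma measurable_mixed_var : measurable_fun [set: R] mixed_var.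
Proof. by apply: measurable_funD; exact: measurable_powR. Qed.

Lemma mixed_var_le x y : 0 <= x -> x <= y -> mixed_var x <= mixed_var y.
Proof.
move=> x0 xy; have y0 : 0 <= y by exact: le_trans xy.
by apply: lerD; apply: ge0_ler_powR => //; exact: ltW.
Qed.

Lemma mixed_var_max0 : (\int[expo]_r (mixed_var (Num.max (r : R) 0))%:E =
  exp_moment theta0 1 + exp_moment theta0 (2 * H))%E.
Proof.
have m0 r : 0 <= Num.max r 0 :> R by rewrite le_max lexx orbT.
have mm : measurable_fun [set: R] (fun r : R => Num.max r 0) by exact: measurable_maxr.
have mE : measurable_fun [set: R] (fun r => (mixed_var (Num.max r 0))%:E).
  by apply/measurable_EFinP; apply: (measurableT_comp measurable_mixed_var mm).
rewrite (@expo_eq_integral _ _ theta0 _ (fun r => (r `^ 1)%:E + (r `^ (2 * H))%:E)%E).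
- rewrite ge0_integralD//.
  + by move=> r _; rewrite lee_fin powR_ge0.
  + by apply/measurable_EFinP; exact: measurable_powR.
  + by move=> r _; rewrite lee_fin powR_ge0.
  + by apply/measurable_EFinP; exact: measurable_powR.
- by [].
- by move=> r; rewrite lee_fin mixed_var_ge0.
- by apply: emeasurable_funD; apply/measurable_EFinP; exact: measurable_powR.
- by move=> r; rewrite -EFinD lee_fin mixed_var_ge0.
- by move=> r r0; rewrite max_l.
Qed.

(** The constant [Gamma], that is [1 / theta + E r^(2H)]. *)
Definition ou_bound := fine (exp_moment theta0 1 + exp_moment theta0 (2 * H))%E.

Lemma mixed_var_max0_bound :
  (\int[expo]_r (mixed_var (Num.max (r : R) 0))%:E = ou_bound%:E)%E.
Proof.
rewrite mixed_var_max0 /ou_bound fineK// fin_numD.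
by apply/andP; split; apply: exp_moment_fin; move: H0 H1 => h h'; lra.
Qed.

Lemma mixed_cov_sym t s : mixed_cov t s = mixed_cov s t.
Proof. by rewrite /mixed_cov pos_cov_sym [X in _ + X]pos_cov_sym. Qed.

Section process.
Variable (Z : T -> R -> R).
Hypotheses (gZ : has_gaussian_moments P Z mixed_cov) (cZ : forall w, continuous (Z w))
  (Z0 : forall w (t : R), t <= 0 -> Z w t = 0).

Lemma incr_moment2_le a b :
  (\int[P]_w ((Z w a - Z w b) ^+ 2)%:E <= (mixed_var `|a - b|)%:E)%E.
Proof.
have [_ + _] := gZ [:: (1, a); (-1, b)].
rewrite /lin /cov; under eq_integral do rewrite !big_cons big_nil/= mul1r addr0 mulN1r.
move=> ->; rewrite !(big_cons, big_nil)/= lee_fin /mixed_cov /mixed_var.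
have h1 := @pos_cov_var R 1 a b (lexx _); have h2 := pos_cov_var a b H2.
rewrite (pos_cov_sym 1 b a) (pos_cov_sym (2 * H) b a).
move: h1 h2; move: (pos_cov 1 a b) (pos_cov 1 a a) (pos_cov 1 b b) (pos_cov _ a b)
  (pos_cov _ a a) (pos_cov _ b b) (_ `^ _) (_ `^ _) => x1 x2 x3 x4 x5 x6 x7 x8 h1 h2; lra.
Qed.

Lemma measurable_process : measurable_fun [set: T * R] (fun p => Z p.1 p.2).
Proof.
rewrite (_ : (fun _ => _) = fun p => Z p.1 (Num.max p.2 0)); last first.
  apply/funext => -[w t] /=; have [t0|//] := leP t 0.
  by rewrite !Z0// ltW.
apply: measurable_continuous_process => // t.
have [+ _ _] := gZ [:: (1, t)].
by rewrite /lin; under eq_fun do rewrite big_seq1 mul1r.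
Qed.

Let jincr (t : R) (psi1 psi2 : R -> R) : measurable_fun [set: R] psi1 ->
  measurable_fun [set: R] psi2 ->
  measurable_fun [set: T * R] (fun p => Z p.1 (t - psi1 p.2) - Z p.1 (t - psi2 p.2)).
Proof.
have aux (psi : R -> R) : measurable_fun [set: R] psi ->
    measurable_fun [set: T * R] (fun p => Z p.1 (t - psi p.2)).
  move=> mp; apply: (measurableT_comp measurable_process (g := fun p : T * R => (p.1, t - psi p.2))).
  apply: measurable_fun_pair; first exact: measurable_fst.
  by apply: measurable_funB => //; exact: (measurableT_comp mp measurable_snd).
by move=> m1 m2; apply: measurable_funB; exact: aux.
Qed.

Let bincr w (t : R) (psi1 psi2 : R -> R) :
  (forall r, 0 <= psi1 r) -> (forall r, 0 <= psi2 r) ->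
  exists B : R, forall r, `|Z w (t - psi1 r) - Z w (t - psi2 r)| <= B.
Proof.
move=> p1 p2; have [B hB] := incr_bounded (@cZ w) (@Z0 w) t.
exists (B + B) => r.
have := hB (psi1 r); have := hB (psi2 r); rewrite !max_l// => h2 h1.
rewrite (_ : _ - _ = (Z w t - Z w (t - psi2 r)) - (Z w t - Z w (t - psi1 r))); last by ring.
by apply: le_trans (ler_normB _ _) _; exact: lerD.
Qed.

(** Jensen's inequality under the exponential law, Tonelli's theorem, then the variance bound for
    increments; [t] drops out of the right-hand side. With [psi1] and [psi2] among zero, the step
    function and [max r 0], this bounds the second moments of both averages and of their
    difference. *)
Lemma moving_average_moment2_le (t : R) (psi1 psi2 : R -> R) :
  measurable_fun [set: R] psi1 -> measurable_fun [set: R] psi2 ->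
  (forall r, 0 <= psi1 r) -> (forall r, 0 <= psi2 r) ->
  (\int[P]_w ((\int[expo]_r (Z w (t - psi1 r) - Z w (t - psi2 r))) ^+ 2)%:E <=
   \int[expo]_r (mixed_var `|psi1 r - psi2 r|)%:E)%E.
Proof.
move=> m1 m2 p1 p2; have mj := jincr t m1 m2.
have mj2 : measurable_fun [set: T * R]
    (fun p => ((Z p.1 (t - psi1 p.2) - Z p.1 (t - psi2 p.2)) ^+ 2)%:E).
  by apply/measurable_EFinP; exact: measurable_funX.
have j0 (p : T * R) : (0 <= ((Z p.1 (t - psi1 p.2) - Z p.1 (t - psi2 p.2)) ^+ 2)%:E)%E.
  by rewrite lee_fin sqr_ge0.
apply: (@le_trans _ _ (\int[P]_w \int[expo]_r
    ((Z w (t - psi1 r) - Z w (t - psi2 r)) ^+ 2)%:E)%E).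
  apply: ge0_le_integral => //.
  - by move=> w _; rewrite lee_fin sqr_ge0.
  - apply/measurable_EFinP; apply: measurable_funX.
    exact: (measurable_Rintegral expo mj).
  - exact: (measurable_fun_fubini_tonelli_F (m2 := expo) _ mj2 j0).
  - move=> w _; have [B hB] := bincr w t p1 p2.
    apply: (@sqr_Rintegral_le _ _ _ expo (fun r => Z w (t - psi1 r) - Z w (t - psi2 r)) B) => //.
    exact: (measurableT_comp mj (measurable_pair1 w)).
have := fubini_tonelli (m1 := P) (m2 := expo) _ mj2 j0; move=> /= ->.
apply: ge0_le_integral => //.
- by move=> r _; apply: integral_ge0 => w _; rewrite lee_fin sqr_ge0.
- exact: (measurable_fun_fubini_tonelli_G (m1 := P) _ mj2 j0).
- apply/measurable_EFinP; apply: (measurableT_comp measurable_mixed_var).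
  by apply: measurableT_comp => //; exact: measurable_funB.
- move=> r _; apply: le_trans (incr_moment2_le _ _) _; rewrite lee_fin.
  by rewrite (_ : _ - _ = - (psi1 r - psi2 r)) ?normrN//; ring.
Qed.

Let a n x := fine (expo (phi n @^-1` [set x])).

(** Encodes the sum over the lag values [x] of [a n x] times the increment over [[t - x, t]];
    [a n x] is the exponential mass of the lags rounded to [x]. *)
Definition moving_average n (t : R) : seq (R * R) :=
  flatten [seq [:: (a n x, t); (- a n x, t - x)] | x <- sfun_values (phi n)].

Lemma lin_moving_average n t w :
  lin Z (moving_average n t) w = \int[expo]_r (Z w t - Z w (t - phi n r)).
Proof.
rewrite /Rintegral (sfun_integral expo (phi n) (fun x => Z w t - Z w (t - x))) /=.
rewrite /lin big_flatten/= big_map; apply: eq_bigr => x _.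
by rewrite !big_cons big_nil /= -/(a n x); ring.
Qed.

Definition mixed_incr t r s q := incr_cov 1 t r s q + incr_cov (2 * H) t r s q.

Lemma cov_moving_average n t s : cov mixed_cov (moving_average n t) (moving_average n s) =
  \sum_(x <- sfun_values (phi n)) \sum_(y <- sfun_values (phi n))
    a n x * (a n y * mixed_incr t x s y).
Proof.
rewrite /cov big_flatten/= big_map; apply: eq_bigr => x _.
rewrite !big_cons big_nil /= addr0 -big_split /= big_flatten /= big_map.
apply: eq_bigr => y _; rewrite !big_cons big_nil /= /mixed_incr /incr_cov /mixed_cov; ring.
Qed.

Let phi_max n r : phi n r <= Num.max r 0. Proof. exact: step_approx_le. Qed.

Let phi0 n r : 0 <= phi n r. Proof. exact: fun_ge0. Qed.

Let mphi n : measurable_fun [set: R] (phi n). Proof. exact: (measurable_funPT (phi n)). Qed.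

Let mmax : measurable_fun [set: R] (fun r : R => Num.max r 0).
Proof. exact: measurable_maxr. Qed.

Lemma moving_average_bound n t :
  cov mixed_cov (moving_average n t) (moving_average n t) <= ou_bound.
Proof.
rewrite -lee_fin -mixed_var_max0_bound; have [_ <- _] := gZ (moving_average n t).
rewrite (_ : integral _ _ _ = \int[P]_w
    ((\int[expo]_r (Z w (t - (fun=> 0) r) - Z w (t - phi n r))) ^+ 2)%:E)%E; last first.
  by apply: eq_integral => w _; rewrite lin_moving_average subr0.
apply: le_trans (@moving_average_moment2_le t (fun=> 0) (phi n) _ _ _ _) _ => //.
apply: ge0_le_integral => //.
- by move=> r _; rewrite lee_fin mixed_var_ge0.
- apply/measurable_EFinP; apply: (measurableT_comp measurable_mixed_var).
  by apply: measurableT_comp => //; exact: measurable_funB.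
- by apply/measurable_EFinP; exact: (measurableT_comp measurable_mixed_var mmax).
- by move=> r _; rewrite lee_fin sub0r normrN ger0_norm// mixed_var_le.
Qed.

Lemma moving_average_cov_bound n t s :
  `|cov mixed_cov (moving_average n t) (moving_average n s)| <= ou_bound.
Proof.
apply: le_trans (cov_le_half gZ mixed_cov_sym _ _) _.
by have := moving_average_bound n t; have := moving_average_bound n s; lra.
Qed.

Lemma moving_average_decay n :
  off_diagonal_decay (fun t s => cov mixed_cov (moving_average n t) (moving_average n s)).
Proof.
rewrite (_ : (fun _ => _) = fun t s => \sum_(x <- sfun_values (phi n))
    \sum_(y <- sfun_values (phi n)) a n x * (a n y * mixed_incr t x s y)); last first.
  by apply/funext => t; apply/funext => s; exact: cov_moving_average.
apply: off_diagonal_decay_sum => x /sfun_values_ge0 x0.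
apply: off_diagonal_decay_sum => y /sfun_values_ge0 y0.
apply: off_diagonal_decayZ; apply: off_diagonal_decayZ; apply: off_diagonal_decayD => e e0.
  by apply: incr_cov_decay => //; rewrite ltr1n.
by apply: incr_cov_decay => //; move: H1 => h; lra.
Qed.

(** Covariance, at a common time, of the increments with lags [r] and [q] of a process with
    stationary increments of variance [mixed_var]. *)
Definition stationary_cov r q :=
  2^-1 * (r `^ 1 + q `^ 1 - `|r - q| `^ 1) +
  2^-1 * (r `^ (2 * H) + q `^ (2 * H) - `|r - q| `^ (2 * H)).

Definition moving_average_var n :=
  \sum_(x <- sfun_values (phi n)) \sum_(y <- sfun_values (phi n))
    a n x * (a n y * stationary_cov x y).

Lemma moving_average_var_cvg n :
  cov mixed_cov (moving_average n t) (moving_average n t) @[t --> +oo] --> moving_average_var n.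
Proof.
under eq_fun do rewrite cov_moving_average.
apply: cvg_sum_seq => x /sfun_values_ge0 x0.
apply: cvg_sum_seq => y /sfun_values_ge0 y0.
apply: cvgM; first exact: cvg_cst.
apply: cvgM; first exact: cvg_cst.
apply: cvgD; apply: incr_cov_diag_cvg => //; first by rewrite ltr1n.
by move: H1 => h; lra.
Qed.

(** As a double integral, the variance lends itself to dominated convergence when the step function
    is refined. *)
Lemma moving_average_var_integral n : ((moving_average_var n)%:E =
  \int[expo]_r \int[expo]_q (stationary_cov (phi n r) (phi n q))%:E)%E.
Proof.
under eq_integral do rewrite (sfun_integral expo (phi n) (stationary_cov _)).
rewrite (sfun_integral expo (phi n) (fun r =>
  \sum_(x <- sfun_values (phi n)) fine (expo (phi n @^-1` [set x])) * stationary_cov r x)).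
congr (_%:E); apply: eq_bigr => x _; rewrite mulr_sumr.
by apply: eq_bigr => y _.
Qed.

Lemma measurable_moving_average_cov n : measurable_fun [set: R * R]
  (fun p => cov mixed_cov (moving_average n p.1) (moving_average n p.2)).
Proof.
under eq_fun do rewrite cov_moving_average.
apply: measurable_sum => x; apply: measurable_sum => y.
apply: measurable_funM => //; apply: measurable_funM => //.
have m1 c : measurable_fun [set: R * R] (fun p => p.1 - c) by exact: measurable_funB.
have m2 c : measurable_fun [set: R * R] (fun p => p.2 - c) by exact: measurable_funB.
have pc q : measurable_fun [set: R * R] (fun p => incr_cov q p.1 x p.2 y).
  apply: measurable_funD; last exact: measurable_pos_cov.
  apply: measurable_funB; last exact: measurable_pos_cov.
  by apply: measurable_funB; exact: measurable_pos_cov.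
exact: measurable_funD.
Qed.

End process.
End gaussian_moving_average.

(** * The limiting variance *)

(** At a positive limit the power is differentiable; the limit zero is treated by hand, through
    [u n <= e^(1/p)]. *)
Lemma ge0_cvg_powR (R : realType) (p x : R) (u : nat -> R) : 0 < p ->
  (forall n, 0 <= u n) -> u n @[n --> \oo] --> x ->
  u n `^ p @[n --> \oo] --> x `^ p.
Proof.
move=> p0 u0 ux.
have x0 : 0 <= x.
  rewrite -(cvg_lim _ ux)//; apply: limr_ge; first by apply/cvg_ex; exists x.
  exact: nearW.
move: x0; rewrite le_eqVlt => /predU1P[x0|x0]; last first.
  have cp : {for x, continuous (fun y : R => y `^ p)}.
    apply/differentiable_continuous/derivable1_diffP/derivable_powR.
    by rewrite in_itv/= andbT.
  exact: (cvg_comp _ _ ux cp).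
rewrite -x0 powR0 ?gt_eqF//; rewrite -x0 in ux.
apply/cvgrPdist_le => /= e e0.
have d0 : 0 < e `^ p^-1 by exact: powR_gt0.
move/cvgrPdist_le : ux => /(_ _ d0); apply: filterS => n.
rewrite !sub0r !normrN !ger0_norm ?powR_ge0// => h.
have := ge0_ler_powR (ltW p0) _ _ h; rewrite !nnegrE u0 (ltW d0) => /(_ isT isT).
by rewrite -powRrM mulVf ?gt_eqF// powRr1// ltW.
Qed.

Lemma half_of_sum (R : realFieldType) (y : \bar R) (g : R) :
  (y + (2^-1 * g)%:E = g%:E)%E -> y = (2^-1 * g)%:E.
Proof. by case: y => [x| |]//; rewrite -EFinD => -[h]; congr (_%:E); lra. Qed.

Section stationary_variance.
Context (R : realType) (theta H : R) (theta0 : 0 < theta) (H0 : 2^-1 < H) (H1 : H < 1).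
Local Notation expo := (expo theta0).
Local Notation phi := (step_approx R).
Local Notation m := (fun r : R => Num.max r 0).
Local Notation mv := (mixed_var H).
Local Notation c := (stationary_cov H).
Local Notation Gamma := (ou_bound H theta0).

Let H4 : 0 < 2 * H. Proof. by move: H0 => h; lra. Qed.

Let phi0 n (r : R) : 0 <= phi n r. Proof. exact: fun_ge0. Qed.
Let m0 (r : R) : 0 <= m r. Proof. by rewrite le_max lexx orbT. Qed.
Let mphi n : measurable_fun [set: R] (phi n). Proof. exact: (measurable_funPT (phi n)). Qed.
Let mm : measurable_fun [set: R] m. Proof. exact: measurable_maxr. Qed.

(** Dominated convergence: [0 <= phi n r <= max r 0] bounds the integrand by [mv (m r)], whose
    integral is [Gamma]. *)
Lemma moving_average_error_cvg :
  (\int[expo]_r (mv `|phi n r - m r|)%:E @[n --> \oo] --> 0)%E.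
Proof.
have := @ge0_dominated_cvg _ _ _ expo (fun n r => mv `|phi n r - m r|) (cst 0) (fun r => mv (m r)).
rewrite integral0; apply.
- move=> n; apply: (measurableT_comp (measurable_mixed_var H)).
  by apply: measurableT_comp => //; exact: measurable_funB.
- exact: (measurableT_comp (measurable_mixed_var H) mm).
- by move=> n x; exact: mixed_var_ge0.
- move=> n x; apply: mixed_var_le => //.
  rewrite distrC ger0_norm ?subr_ge0; last exact: step_approx_le.
  by rewrite gerBl.
- by rewrite mixed_var_max0_bound ?ltry.
- move=> x; rewrite /cst -[X in _ --> X]addr0.
  have d0 : `|phi n x - m x| @[n --> \oo] --> 0.
    rewrite -[X in _ --> X](normr0 R); apply: cvg_norm.
    rewrite -[X in _ --> X](subrr (m x)); apply: cvgB; last exact: cvg_cst.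
    exact: step_approx_cvg.
  apply: cvgD.
    have := ge0_cvg_powR ltr01 (fun n => normr_ge0 (phi n x - m x)) d0.
    by rewrite powR0.
  have := ge0_cvg_powR H4 (fun n => normr_ge0 (phi n x - m x)) d0.
  by rewrite powR0 ?gt_eqF.
Qed.

Let dist_powR_le (p r q : R) : 0 < p -> 0 <= r -> 0 <= q -> `|r - q| `^ p <= r `^ p + q `^ p.
Proof.
move=> p0 r0 q0; have [rq|qr] := leP r q.
  rewrite ler0_norm ?subr_le0// opprB; apply: (@le_trans _ _ (q `^ p)); last first.
    by rewrite lerDr powR_ge0.
  by apply: ge0_ler_powR; rewrite ?nnegrE ?(ltW p0)//; lra.
rewrite gtr0_norm ?subr_gt0//; apply: (@le_trans _ _ (r `^ p)); last first.
  by rewrite lerDl powR_ge0.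
by apply: ge0_ler_powR; rewrite ?nnegrE ?(ltW p0)//; lra.
Qed.

Let c0 r q : 0 <= r -> 0 <= q -> 0 <= c r q.
Proof.
move=> r0 q0; rewrite /stationary_cov.
have h1 := dist_powR_le ltr01 r0 q0; have h2 := dist_powR_le H4 r0 q0.
by apply: addr_ge0; apply: mulr_ge0 => //; rewrite subr_ge0.
Qed.

Let c_le r q : c r q <= 2^-1 * (mv r + mv q).
Proof.
rewrite /stationary_cov /mixed_var.
have := powR_ge0 `|r - q| 1; have := powR_ge0 `|r - q| (2 * H).
move: (r `^ 1) (q `^ 1) (_ `^ 1) (r `^ _) (q `^ _) (_ `^ _) => x1 x2 x3 x4 x5 x6; lra.
Qed.

Let mcov d (T : measurableType d) (f g : T -> R) : measurable_fun [set: T] f ->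
  measurable_fun [set: T] g -> measurable_fun [set: T] (fun x => c (f x) (g x)).
Proof.
move=> mf mg.
have mp (h : T -> R) p : measurable_fun [set: T] h -> measurable_fun [set: T] (fun x => h x `^ p).
  by move=> mh; exact: (measurableT_comp (measurable_powR p) mh).
have md : measurable_fun [set: T] (fun x => `|f x - g x|).
  by apply: measurableT_comp => //; exact: measurable_funB.
have aux p : measurable_fun [set: T]
    (fun x => 2^-1 * (f x `^ p + g x `^ p - `|f x - g x| `^ p)).
  apply: measurable_funM => //; apply: measurable_funB; last exact: mp.
  by apply: measurable_funD; exact: mp.
exact: measurable_funD.
Qed.

Let half_gamma k : 0 <= k ->
  (\int[expo]_q (2^-1 * (k + mv (m q)))%:E = (2^-1 * (k + Gamma))%:E)%E.
Proof.
move=> k0; under eq_integral do rewrite EFinM EFinD.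
have mE : measurable_fun [set: R] (fun q => (mv (m q))%:E).
  by apply/measurable_EFinP; exact: (measurableT_comp (measurable_mixed_var H) mm).
have mv0 q : (0 <= (mv q)%:E)%E by rewrite lee_fin mixed_var_ge0.
rewrite ge0_integralZl//; last 2 first.
- exact: emeasurable_funD.
- by move=> q _; rewrite adde_ge0.
rewrite ge0_integralD// mixed_var_max0_bound//.
by rewrite (integral_mass1 _ (probability_setT expo)) -EFinD -EFinM.
Qed.

Let inner_le (u v : R -> R) r : measurable_fun [set: R] u -> measurable_fun [set: R] v ->
  (forall r, 0 <= u r) -> (forall r, 0 <= v r) ->
  (forall r, u r <= m r) -> (forall r, v r <= m r) ->
  (\int[expo]_q (c (u r) (v q))%:E <= (2^-1 * (mv (m r) + Gamma))%:E)%E.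
Proof.
move=> mu mv' u0 v0 um vm; rewrite -(half_gamma (mixed_var_ge0 H (m r))); apply: ge0_le_integral => //.
- by move=> q _; rewrite lee_fin c0.
- by apply/measurable_EFinP; apply: mcov.
- apply/measurable_EFinP; apply: measurable_funM => //; apply: measurable_funD => //.
  exact: (measurableT_comp (measurable_mixed_var H) mm).
- move=> q _; rewrite lee_fin; apply: (le_trans (c_le _ _)).
  apply: ler_wpM2l => //; apply: lerD; exact: mixed_var_le.
Qed.

Let inner_fin (u v : R -> R) r : measurable_fun [set: R] u -> measurable_fun [set: R] v ->
  (forall r, 0 <= u r) -> (forall r, 0 <= v r) ->
  (forall r, u r <= m r) -> (forall r, v r <= m r) ->
  (\int[expo]_q (c (u r) (v q))%:E)%E \is a fin_num.
Proof.
move=> *; rewrite ge0_fin_numE.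
  by apply: le_lt_trans (inner_le _ _ _ _ _ _ _) _; rewrite ?ltry.
by apply: integral_ge0 => q _; rewrite lee_fin c0.
Qed.

(** Dominated convergence twice, for the inner integral at fixed [r] and then for the outer one;
    both majorants come from [c r q <= (mv r + mv q) / 2]. *)
Let double_cvg : (\int[expo]_r \int[expo]_q (c (phi n r) (phi n q))%:E @[n --> \oo] -->
  \int[expo]_r \int[expo]_q (c (m r) (m q))%:E)%E.
Proof.
have pm n r : phi n r <= m r by exact: step_approx_le.
have finn n r : (\int[expo]_q (c (phi n r) (phi n q))%:E)%E \is a fin_num.
  exact: inner_fin.
have finm r : (\int[expo]_q (c (m r) (m q))%:E)%E \is a fin_num.
  exact: (@inner_fin m m r mm mm m0 m0 (fun _ => lexx _) (fun _ => lexx _)).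
have := @ge0_dominated_cvg _ _ _ expo
  (fun n r => fine (\int[expo]_q (c (phi n r) (phi n q))%:E))
  (fun r => fine (\int[expo]_q (c (m r) (m q))%:E))
  (fun r => 2^-1 * (mv (m r) + Gamma)).
under [X in X @ _ --> _]eq_fun do under eq_integral do rewrite fineK//.
under [X in _ --> X]eq_integral do rewrite fineK//.
apply.
- move=> n; apply: measurableT_comp => //.
  apply: (measurable_fun_fubini_tonelli_F (m2 := expo) (fun p => (c (phi n p.1) (phi n p.2))%:E)).
    apply/measurable_EFinP; apply: mcov.
      exact: (measurableT_comp (mphi n) measurable_fst).
    exact: (measurableT_comp (mphi n) measurable_snd).
  by move=> p; rewrite lee_fin c0.
- apply: measurable_funM => //; apply: measurable_funD => //.
  exact: (measurableT_comp (measurable_mixed_var H) mm).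
- by move=> n r; apply: fine_ge0; apply: integral_ge0 => q _; rewrite lee_fin c0.
- by move=> n r; rewrite -lee_fin fineK//; exact: inner_le.
- under eq_integral do rewrite addrC.
  by rewrite half_gamma ?ltry// fine_ge0// adde_ge0// exp_moment_ge0.
move=> r; apply: fine_cvg; rewrite fineK//.
apply: (@ge0_dominated_cvg _ _ _ expo (fun n q => c (phi n r) (phi n q))
  (fun q => c (m r) (m q)) (fun q => 2^-1 * (mv (m r) + mv (m q)))).
- by move=> n; exact: mcov.
- apply: measurable_funM => //; apply: measurable_funD => //.
  exact: (measurableT_comp (measurable_mixed_var H) mm).
- by move=> n q; exact: c0.
- move=> n q; apply: (le_trans (c_le _ _)).
  apply: ler_wpM2l => //; apply: lerD; exact: mixed_var_le.
- by rewrite half_gamma ?ltry// mixed_var_ge0.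
move=> q; have dc : `|phi n r - phi n q| @[n --> \oo] --> `|m r - m q|.
  by apply: cvg_norm; apply: cvgB; exact: step_approx_cvg.
have aux p : 0 < p -> 2^-1 * (phi n r `^ p + phi n q `^ p - `|phi n r - phi n q| `^ p)
    @[n --> \oo] --> 2^-1 * (m r `^ p + m q `^ p - `|m r - m q| `^ p).
  move=> p0; apply: cvgM; first exact: cvg_cst.
  apply: cvgB; last exact: ge0_cvg_powR.
  by apply: cvgD; apply: ge0_cvg_powR => //; exact: step_approx_cvg.
by apply: cvgD; exact: aux.
Qed.

Let double_dist p : 0 < p ->
  (\int[expo]_r \int[expo]_q (`|m r - m q| `^ p)%:E = exp_moment theta0 p)%E.
Proof.
move=> p0; rewrite -(expo_abs_moment theta0 p0).
have mdist d (T : measurableType d) (f g : T -> R) : measurable_fun [set: T] f ->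
    measurable_fun [set: T] g -> measurable_fun [set: T] (fun x => (`|f x - g x| `^ p)%:E).
  move=> mf mg; apply/measurable_EFinP; apply: (measurableT_comp (measurable_powR p)).
  by apply: measurableT_comp => //; exact: measurable_funB.
have e r : (\int[expo]_q (`|m r - m q| `^ p)%:E = \int[expo]_q (`|q - m r| `^ p)%:E)%E.
  apply: expo_eq_integral.
  - exact: (mdist _ _ (fun=> m r) m).
  - by move=> x; rewrite lee_fin powR_ge0.
  - exact: (mdist _ _ id (fun=> m r)).
  - by move=> x; rewrite lee_fin powR_ge0.
  - by move=> x x0; rewrite distrC (max_l x0).
under eq_integral do rewrite e.
apply: expo_eq_integral.
- apply: (measurable_fun_fubini_tonelli_F (m2 := expo) (fun x => (`|x.2 - m x.1| `^ p)%:E)).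
    apply: mdist; first exact: measurable_snd.
    exact: (measurableT_comp mm measurable_fst).
  by move=> x; rewrite lee_fin powR_ge0.
- by move=> x; apply: integral_ge0 => y _; rewrite lee_fin powR_ge0.
- apply: (measurable_fun_fubini_tonelli_F (m2 := expo) (fun x : R * R => (`|x.2 - x.1| `^ p)%:E)).
    by apply: mdist; [exact: measurable_snd|exact: measurable_fst].
  by move=> x; rewrite lee_fin powR_ge0.
- by move=> x; apply: integral_ge0 => y _; rewrite lee_fin powR_ge0.
- by move=> x x0; rewrite (max_l x0).
Qed.

(** Adding half of [mv |r - q|] to [c] gives half of [mv r + mv q], which integrates to [Gamma]; the
    added term integrates to [Gamma / 2] by the law of the distance. Adding avoids a difference of
    integrals. *)
Let double_cov : (\int[expo]_r \int[expo]_q (c (m r) (m q))%:E = (2^-1 * Gamma)%:E)%E.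
Proof.
pose D (r q : R) := 2^-1 * (`|m r - m q| `^ 1 + `|m r - m q| `^ (2 * H)).
have D0 r q : 0 <= D r q by rewrite mulr_ge0// addr_ge0// powR_ge0.
have mF : measurable_fun [set: R * R] (fun x => (c (m x.1) (m x.2))%:E).
  apply/measurable_EFinP; apply: mcov.
    exact: (measurableT_comp mm measurable_fst).
  exact: (measurableT_comp mm measurable_snd).
have mdist p : measurable_fun [set: R * R] (fun x => `|m x.1 - m x.2| `^ p).
  apply: (measurableT_comp (measurable_powR p)); apply: measurableT_comp => //.
  apply: measurable_funB; first exact: (measurableT_comp mm measurable_fst).
  exact: (measurableT_comp mm measurable_snd).
have mD : measurable_fun [set: R * R] (fun x => (D x.1 x.2)%:E).
  by apply/measurable_EFinP; apply: measurable_funM => //; exact: measurable_funD.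
have F0 (x : R * R) : (0 <= (c (m x.1) (m x.2))%:E)%E by rewrite lee_fin c0.
have D0' (x : R * R) : (0 <= (D x.1 x.2)%:E)%E by rewrite lee_fin.
have mF1 r : measurable_fun [set: R] (fun q => (c (m r) (m q))%:E).
  exact: (measurableT_comp mF (measurable_pair1 r)).
have mD1 r : measurable_fun [set: R] (fun q => (D r q)%:E).
  exact: (measurableT_comp mD (measurable_pair1 r)).
have sum : (\int[expo]_r \int[expo]_q (c (m r) (m q))%:E + \int[expo]_r \int[expo]_q (D r q)%:E
    = Gamma%:E)%E.
  rewrite -ge0_integralD; first last.
  - exact: (measurable_fun_fubini_tonelli_F (m2 := expo) _ mD D0').
  - by move=> r _; apply: integral_ge0 => q _; rewrite lee_fin.
  - exact: (measurable_fun_fubini_tonelli_F (m2 := expo) _ mF F0).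
  - by move=> r _; apply: integral_ge0 => q _; exact: (F0 (r, q)).
  - by [].
  transitivity (\int[expo]_r (2^-1 * (Gamma + mv (m r)))%:E)%E.
    apply: eq_integral => r _; rewrite [Gamma + _]addrC -half_gamma ?mixed_var_ge0//.
    rewrite -ge0_integralD.
    + apply: eq_integral => q _; rewrite -EFinD; congr (_%:E).
      rewrite /D /stationary_cov /mixed_var.
      move: (m r `^ 1) (m q `^ 1) (_ `^ 1) (m r `^ _) (m q `^ _) (_ `^ _) => x1 x2 x3 x4 x5 x6; lra.
    + by [].
    + by move=> q _; exact: (F0 (r, q)).
    + exact: mF1.
    + by move=> q _; exact: (D0' (r, q)).
    + exact: mD1.
  rewrite half_gamma; last by rewrite fine_ge0// adde_ge0// exp_moment_ge0.
  by congr (_%:E); lra.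
have DE : (\int[expo]_r \int[expo]_q (D r q)%:E = (2^-1 * Gamma)%:E)%E.
  have d0 p (x : R * R) : (0 <= (`|m x.1 - m x.2| `^ p)%:E)%E by rewrite lee_fin powR_ge0.
  have md p : measurable_fun [set: R * R] (fun x => (`|m x.1 - m x.2| `^ p)%:E).
    exact/measurable_EFinP.
  have md1 p r : measurable_fun [set: R] (fun q => (`|m r - m q| `^ p)%:E).
    exact: (measurableT_comp (md p) (measurable_pair1 r)).
  have mI p := measurable_fun_fubini_tonelli_F (m2 := expo) _ (md p) (d0 p).
  have I0 p r : (0 <= \int[expo]_q (`|m r - m q| `^ p)%:E)%E.
    by apply: integral_ge0 => q _; exact: (d0 p (r, q)).
  transitivity (\int[expo]_r ((2^-1)%:E * (\int[expo]_q (`|m r - m q| `^ 1)%:E +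
      \int[expo]_q (`|m r - m q| `^ (2 * H))%:E)))%E.
    apply: eq_integral => r _; rewrite -ge0_integralD.
    - rewrite -ge0_integralZl.
      + by apply: eq_integral => q _; rewrite -EFinD -EFinM.
      + by [].
      + by apply: emeasurable_funD; exact: md1.
      + by move=> q _; apply: adde_ge0; exact: (d0 _ (r, q)).
      + by rewrite lee_fin.
    - by [].
    - by move=> q _; exact: (d0 _ (r, q)).
    - exact: md1.
    - by move=> q _; exact: (d0 _ (r, q)).
    - exact: md1.
  rewrite ge0_integralZl.
  - rewrite ge0_integralD; [|by []|by move=> r _; exact: I0|exact: mI|by move=> r _; exact: I0|exact: mI].
    rewrite !double_dist// EFinM /ou_bound fineK//.
    by rewrite fin_numD; apply/andP; split; apply: exp_moment_fin; move: H0 H1 => h h'; lra.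
  - by [].
  - by apply: emeasurable_funD; exact: mI.
  - by move=> r _; apply: adde_ge0; exact: I0.
  - by rewrite lee_fin.
by rewrite DE in sum; exact: half_of_sum sum.
Qed.

Lemma moving_average_var_lim : moving_average_var H theta0 n @[n --> \oo] --> 2^-1 * Gamma.
Proof.
have : (moving_average_var H theta0 n)%:E @[n --> \oo] --> (2^-1 * Gamma)%:E.
  rewrite -double_cov; under eq_fun do rewrite moving_average_var_integral.
  exact: double_cvg.
by move/fine_cvgP => [].
Qed.

End stationary_variance.

(** * Averages of decaying kernels over long time windows *)

Lemma uniform_prob_le (R : realType) (T : R) (T0 : 0 < T) (A : set R) (a b : R) :
  measurable A -> a <= b -> A `&` `[0, T] `<=` `[a, b] ->
  (uniform_prob T0 A <= (T^-1 * (b - a))%:E)%E.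
Proof.
move=> mA ab Aab.
have e : (\int[uniform_prob T0]_t (\1_A t)%:E = uniform_prob T0 A)%E.
  by rewrite integral_indic// setIT.
have m1 : measurable_fun [set: R] (fun t : R => (\1_A t : R)%:E).
  by apply/measurable_EFinP; exact: measurable_indic.
rewrite -e integral_uniform//.
rewrite subr0 EFinM; apply: lee_wpmul2l; first by rewrite lee_fin invr_ge0 ltW.
rewrite integral_indic//.
apply: (@le_trans _ _ (leb `[a, b]%classic)).
  by apply: le_measure; rewrite ?inE//; exact: measurableI.
by rewrite lebesgue_measure_itv/= lte_fin; case: ltP => _; rewrite -?EFinD// lee_fin subr_ge0.
Qed.

Lemma integral_cst_indic_le d (T : measurableType d) (R : realType) (U : probability T R)
    (A : set T) (c B l : R) : measurable A -> 0 <= c -> 0 <= B -> (U A <= l%:E)%E ->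
  (\int[U]_t (c + B * \1_A t)%:E <= (c + B * l)%:E)%E.
Proof.
move=> mA c0 B0 UA.
have m1 : measurable_fun [set: T] (fun t => (\1_A t : R)%:E).
  by apply/measurable_EFinP; exact: measurable_indic.
under eq_integral do rewrite EFinD EFinM.
rewrite ge0_integralD.
- rewrite (integral_mass1 _ (probability_setT U)) EFinD leeD2l// ge0_integralZl.
  + by rewrite integral_indic// setIT EFinM lee_wpmul2l.
  + by [].
  + exact: m1.
  + by move=> t _; rewrite lee_fin.
  + by rewrite lee_fin.
- by [].
- by move=> t _; rewrite lee_fin.
- by [].
- by move=> t _; rewrite -EFinM lee_fin mulr_ge0.
- by apply: emeasurable_funM.
Qed.

(** Off an exceptional set [k <= e / 2], and on it [k <= B]. Under the uniform law on [[0, T]] the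
    exceptional [t], before [L], have mass at most [L / T]; for given [t] the exceptional [s],
    before [L] or within [L] of [t], have mass at most [3 L / T]. Together they give the [4] in the
    threshold. *)
Lemma off_diagonal_decay_average (R : realType) (k : R -> R -> R) (B : R) :
  measurable_fun [set: R * R] (fun p => k p.1 p.2) ->
  (forall t s, 0 <= k t s) -> (forall t s, k t s <= B) -> off_diagonal_decay k ->
  forall e, 0 < e -> exists L : R, forall (T : R) (T0 : 0 < T), L <= T ->
    (\int[uniform_prob T0]_t \int[uniform_prob T0]_s (k t s)%:E <= e%:E)%E.
Proof.
move=> mk k0 kB dk e e0; have e2 : 0 < e / 2 by rewrite divr_gt0.
have B0 : 0 <= B by exact: le_trans (k0 0 0) (kB 0 0).
have [L L0 hL] := dk _ e2.
exists (4 * B * L / (e / 2)) => T T0 LT.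
pose U : probability (measurableTypeR R) R := uniform_prob T0.
change (\int[U]_t \int[U]_s (k t s)%:E <= e%:E)%E.
pose C : set R := [set t | t < L].
have mlt : measurable C by rewrite (_ : C = `]-oo, L[%classic).
pose A (t : R) : set R := C `|` `](t - L), (t + L)[%classic.
have mA t : measurable (A t) by exact: measurableU.
have UL : (U C <= (T^-1 * L)%:E)%E.
  rewrite -[X in T^-1 * X]subr0; apply: uniform_prob_le => // t [/= tL].
  by rewrite !in_itv/= => /andP[-> _]; exact: ltW.
have UA t : (U (A t) <= (T^-1 * (3 * L))%:E)%E.
  have -> : T^-1 * (3 * L) = T^-1 * L + T^-1 * (t + L - (t - L)) by ring.
  rewrite EFinD; apply: le_trans (leeD UL (@uniform_prob_le _ _ T0 `](t - L), (t + L)[%classic _ _ _ _ _)).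
  - exact: measureU2.
  - by [].
  - by lra.
  - by move=> s [/= + _]; exact: subset_itv_oo_cc.
have kle t s : k t s <= (e / 2 + B * \1_C t) + B * \1_(A t) s.
  have i0 (D : set R) x : 0 <= B * (\1_D x : R) by rewrite mulr_ge0// indicE.
  have [tL|Lt] := ltP t L.
    have := kB t s; have := i0 (A t) s.
    have -> : \1_C t = 1 :> R by rewrite indicE mem_set.
    lra.
  have [sA|sA] := boolP (s \in A t).
    have := kB t s; have := i0 C t.
    have -> : \1_(A t) s = 1 :> R by rewrite indicE sA.
    lra.
  have Ls : L <= s.
    by rewrite leNgt; apply/negP => sL; move/negP: sA; apply; apply/mem_set; left.
  have Lts : L <= `|t - s|.
    rewrite leNgt; apply/negP => h; move/negP: sA; apply; apply/mem_set; right.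
    by move: h; rewrite ltr_norml /= in_itv/= => /andP[? ?]; apply/andP; split; lra.
  have := hL t s Lt Ls Lts; rewrite ger0_norm// => h.
  have := i0 C t; have := i0 (A t) s; lra.
have c0 t : 0 <= e / 2 + B * (\1_C t : R).
  by rewrite addr_ge0 ?(ltW e2)// mulr_ge0// indicE.
have ke0 (p : R * R) : (0 <= (k p.1 p.2)%:E)%E by rewrite lee_fin.
have mke : measurable_fun [set: R * R] (fun p => (k p.1 p.2)%:E) by exact/measurable_EFinP.
have mi (D : set R) : measurable D -> measurable_fun [set: R] (fun t => B * (\1_D t : R)).
  by move=> mC; apply: measurable_funM => //; exact: measurable_indic.
apply: (@le_trans _ _ (\int[U]_t ((e / 2 + B * (T^-1 * (3 * L))) + B * \1_C t)%:E)%E).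
  apply: ge0_le_integral.
  - by [].
  - by move=> t _; apply: integral_ge0 => s _; exact: (ke0 (t, s)).
  - exact: (measurable_fun_fubini_tonelli_F (m2 := U) _ mke ke0).
  - by apply/measurable_EFinP; apply: measurable_funD => //; exact: mi.
  - move=> t _; rewrite addrAC.
    apply: le_trans (@integral_cst_indic_le _ _ _ U _ _ _ _ (mA t) (c0 t) B0 (UA t)).
    apply: ge0_le_integral.
    + by [].
    + by move=> s _; exact: (ke0 (t, s)).
    + exact: (measurableT_comp mke (measurable_pair1 t)).
    + by apply/measurable_EFinP; apply: measurable_funD => //; exact: mi.
    + by move=> s _; rewrite lee_fin.
apply: le_trans (@integral_cst_indic_le _ _ _ U _ _ _ _ mlt _ B0 UL) _.
  by rewrite addr_ge0 ?(ltW e2)// !mulr_ge0// ?invr_ge0 ltW.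
rewrite lee_fin.
have h : 4 * B * L <= e / 2 * T by rewrite [leRHS]mulrC -ler_pdivrMr.
have {}h : T^-1 * (4 * B * L) <= e / 2.
  by rewrite mulrC ler_pdivrMr.
have -> : e / 2 + B * (T^-1 * (3 * L)) + B * (T^-1 * L) = e / 2 + T^-1 * (4 * B * L) by ring.
lra.
Qed.

(** [a^2 - b^2 = 2 a (a - b) - (a - b)^2] and [2 a d <= d^2 / h + h a^2]. The mean of the left side
    is small as soon as the mean square of [a - b] is small and that of [a] bounded. *)
Lemma sqr_diff_le (R : realFieldType) (a b h : R) : 0 < h ->
  `|a ^+ 2 - b ^+ 2| <= (1 + h^-1) * (a - b) ^+ 2 + h * a ^+ 2.
Proof.
move=> h0; have hi : 0 < h^-1 by rewrite invr_gt0.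
have key (d : R) : 2 * a * d <= h^-1 * d ^+ 2 + h * a ^+ 2.
  have := mulr_ge0 (ltW hi) (sqr_ge0 (h * a - d)).
  rewrite (_ : h^-1 * (h * a - d) ^+ 2 = h * a ^+ 2 - 2 * a * d + h^-1 * d ^+ 2).
    lra.
  by field; rewrite gt_eqF.
have k1 := key (a - b); have k2 := key (b - a).
have e1 : (b - a) ^+ 2 = (a - b) ^+ 2 by ring.
have e2 : a ^+ 2 - b ^+ 2 = 2 * a * (a - b) - (a - b) ^+ 2 by ring.
have e3 : 2 * a * (b - a) = - (2 * a * (a - b)) by ring.
rewrite e1 e3 in k2; have s0 := sqr_ge0 (a - b).
rewrite e2 ler_norml; move: k1 k2 s0.
move: ((a - b) ^+ 2) (2 * a * (a - b)) (h * a ^+ 2) => x y z.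
rewrite mulrDl mul1r; move: (h^-1 * x) => u *; apply/andP; split; lra.
Qed.

(** * The law of large numbers *)

Lemma measurable_Rintegral_itv d (T : measurableType d) (R : realType) (a b : R) (f : T * R -> R) :
  measurable_fun [set: T * R] f ->
  measurable_fun [set: T] (fun w => \int[leb]_(t in `[a, b]) f (w, t)).
Proof.
move=> mf; pose D : set (T * R) := [set p | `[a, b]%classic p.2].
have mD : measurable D.
  have m2 : measurable_fun [set: T * R] (@snd T R) by exact: measurable_snd.
  have mab : measurable (`[a, b]%classic : set R) by exact: measurable_itv.
  by have := m2 measurableT _ mab; rewrite setTI.
have := measurable_Rintegral leb (measurable_patch mD mf).
congr (measurable_fun _ _); apply/funext => w.
rewrite [RHS]Rintegral_mkcond; apply: eq_Rintegral => t _.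
by rewrite !patchE; congr (if _ then _ else _); apply/idP/idP; rewrite !inE.
Qed.

Section law_of_large_numbers.
Context d (T : measurableType d) (R : realType) (P : probability T R).
Context (theta H : R) (theta0 : 0 < theta) (H0 : 2^-1 < H) (H1 : H < 1).
Local Notation expo := (expo theta0).
Local Notation phi := (step_approx R).
Local Notation m := (fun r : R => Num.max r 0).
Local Notation mv := (mixed_var H).
Local Notation Gamma := (ou_bound H theta0).
Variable (Z : T -> R -> R).
Hypotheses (gZ : has_gaussian_moments P Z (mixed_cov H)) (cZ : forall w, continuous (Z w))
  (Z0 : forall w (t : R), t <= 0 -> Z w t = 0).

Definition ou w (t : R) := \int[expo]_r (Z w t - Z w (t - Num.max r 0)).

Local Notation ma n w t := (lin Z (moving_average theta0 n t) w).

Let phi0 n (r : R) : 0 <= phi n r. Proof. exact: fun_ge0. Qed.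
Let m0 (r : R) : 0 <= m r. Proof. by rewrite le_max lexx orbT. Qed.
Let mphi n : measurable_fun [set: R] (phi n). Proof. exact: (measurable_funPT (phi n)). Qed.
Let mm : measurable_fun [set: R] m. Proof. exact: measurable_maxr. Qed.

Let Gamma0 : 0 <= Gamma.
Proof. by rewrite fine_ge0// adde_ge0// exp_moment_ge0. Qed.

Let jZ : measurable_fun [set: T * R] (fun p => Z p.1 p.2).
Proof. exact: measurable_process. Qed.

Let joint (psi : R -> R) : measurable_fun [set: R] psi ->
  measurable_fun [set: T * R] (fun p => \int[expo]_r (Z p.1 p.2 - Z p.1 (p.2 - psi r))).
Proof.
move=> mp.
suff mf : measurable_fun [set: (T * R) * R]
    (fun x => Z x.1.1 x.1.2 - Z x.1.1 (x.1.2 - psi x.2)).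
  exact: (measurable_Rintegral expo mf).
have m11 : measurable_fun [set: (T * R) * R] (fun x => x.1.1).
  exact: (measurableT_comp measurable_fst measurable_fst).
have m12 : measurable_fun [set: (T * R) * R] (fun x => x.1.2).
  exact: (measurableT_comp measurable_snd measurable_fst).
apply: measurable_funB.
  apply: (measurableT_comp jZ (g := fun x : (T * R) * R => (x.1.1, x.1.2))).
  exact: measurable_fun_pair.
apply: (measurableT_comp jZ (g := fun x : (T * R) * R => (x.1.1, x.1.2 - psi x.2))).
apply: measurable_fun_pair => //; apply: measurable_funB => //.
exact: (measurableT_comp mp measurable_snd).
Qed.

Lemma measurable_ou : measurable_fun [set: T * R] (fun p => ou p.1 p.2).
Proof. exact: joint. Qed.

Let mma n : measurable_fun [set: T * R] (fun p => ma n p.1 p.2).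
Proof. by under eq_fun do rewrite lin_moving_average; exact: joint. Qed.

Let cma n w : continuous (fun t => ma n w t).
Proof.
rewrite /lin /moving_average.
under eq_fun do rewrite big_flatten/= big_map.
move=> t; apply: cvg_sum_seq => x _.
under eq_fun do rewrite !big_cons big_nil/=.
rewrite !big_cons big_nil/=.
apply: cvgD; first by apply: cvgM; [exact: cvg_cst|exact: cZ].
apply: cvgD; last exact: cvg_cst.
apply: cvgM; first exact: cvg_cst.
apply: continuous_comp; last exact: cZ.
by apply: cvgB; [exact: cvg_id|exact: cvg_cst].
Qed.

Lemma integrable_moving_average2 n w tau :
  leb.-integrable `[0, tau] (EFin \o (fun t => ma n w t ^+ 2)).
Proof.
apply: continuous_compact_integrable; first exact: segment_compact.
apply: continuous_subspaceT => t.
rewrite /continuous_at expr2; under eq_fun do rewrite expr2.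
by apply: cvgM; exact: cma.
Qed.

Lemma ou_moment2_le t : (\int[P]_w (ou w t ^+ 2)%:E <= Gamma%:E)%E.
Proof.
have -> : (\int[P]_w (ou w t ^+ 2)%:E = \int[P]_w
    ((\int[expo]_r (Z w (t - (fun=> 0) r) - Z w (t - m r))) ^+ 2)%:E)%E.
  by apply: eq_integral => w _; rewrite /ou subr0.
apply: le_trans (moving_average_moment2_le theta0 H0 gZ cZ Z0 t _ mm _ m0) _ => //.
rewrite -mixed_var_max0_bound//; apply: ge0_le_integral => //.
- by move=> r _; rewrite lee_fin mixed_var_ge0.
- apply/measurable_EFinP; apply: (measurableT_comp (measurable_mixed_var H)).
  by apply: measurableT_comp => //; exact: measurable_funB.
- by apply/measurable_EFinP; exact: (measurableT_comp (measurable_mixed_var H) mm).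
- by move=> r _; rewrite lee_fin sub0r normrN ger0_norm// m0.
Qed.

Let integrable_incr (psi : R -> R) w t : measurable_fun [set: R] psi -> (forall r, 0 <= psi r) ->
  expo.-integrable setT (EFin \o (fun r => Z w t - Z w (t - psi r))).
Proof.
move=> mp p0; have [B hB] := incr_bounded (@cZ w) (@Z0 w) t.
have muT : (expo [set: R] < +oo)%E by rewrite probability_setT ltry.
apply: (bounded_integrable (B := B)) => //.
- apply: measurable_funB => //.
  apply: (measurableT_comp (continuous_measurable_fun (@cZ w))).
  exact: measurable_funB.
- by move=> r _; rewrite /= -[psi r](max_l (p0 r)); exact: hB.
Qed.

(** The bound does not depend on [t], hence it survives time averaging. *)
Lemma ou_error n t :
  (\int[P]_w ((ou w t - ma n w t) ^+ 2)%:E <= \int[expo]_r (mv `|phi n r - m r|)%:E)%E.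
Proof.
apply: le_trans (moving_average_moment2_le theta0 H0 gZ cZ Z0 t (mphi n) mm (phi0 n) m0).
rewrite le_eqVlt; apply/orP; left; apply/eqP; apply: eq_integral => w _.
congr ((_ ^+ 2)%:E); rewrite /ou lin_moving_average -RintegralB//.
- by apply: eq_Rintegral => r _; ring.
- exact: (integrable_incr w t mm m0).
- exact: integrable_incr.
Qed.

Let var_ge0 n : 0 <= moving_average_var H theta0 n.
Proof.
have h := @moving_average_var_cvg _ _ _ theta0 H0 H1 n.
rewrite -(cvg_lim _ h)//; apply: limr_ge; first by apply/cvg_ex; eexists; exact: h.
by apply: nearW => t; exact: (cov_ge0 gZ).
Qed.

(** Squared bias plus variance. Cesaro averaging of the variances controls the bias; the decay of
    [2 rho^2], the covariance of the squares, controls the variance. *)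
Lemma moving_average_average_variance n e : 0 < e ->
  exists L : R, forall (tau : R) (tau0 : 0 < tau), L <= tau ->
    (\int[P]_w ((tau^-1 * (\int[leb]_(t in `[0, tau]) (ma n w t ^+ 2)) -
      moving_average_var H theta0 n) ^+ 2)%:E <= e%:E)%E.
Proof.
move=> e0; have e2 : 0 < e / 2 by rewrite divr_gt0.
pose rho t s := cov (mixed_cov H) (moving_average theta0 n t) (moving_average theta0 n s).
pose k t s := 2 * rho t s ^+ 2.
have rhoG t s : `|rho t s| <= Gamma by exact: (moving_average_cov_bound theta0 H0 H1 gZ cZ Z0).
(* Boundedness of [rho] transfers its off-diagonal decay to its square. *)
have rho2 t s : rho t s ^+ 2 <= Gamma * `|rho t s|.
  by rewrite -real_normK ?num_real// expr2 ler_wpM2r.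
have k0 t s : 0 <= k t s by rewrite mulr_ge0// sqr_ge0.
have kB t s : k t s <= 2 * (Gamma * Gamma).
  by rewrite /k ler_wpM2l//; apply: (le_trans (rho2 t s)); exact: ler_wpM2l.
have mrho : measurable_fun [set: R * R] (fun p => rho p.1 p.2).
  exact: measurable_moving_average_cov.
have mk : measurable_fun [set: R * R] (fun p => k p.1 p.2).
  by apply: measurable_funM => //; exact: measurable_funX.
have dk : off_diagonal_decay k.
  have := off_diagonal_decayZ (2 * Gamma) (moving_average_decay theta0 H0 H1 n).
  move=> dr a a0; have [L L0 hL] := dr a a0; exists L => // t s tL sL tsL.
  apply: le_trans (hL t s tL sL tsL); rewrite -/(rho t s) ger0_norm// normrM.
  by rewrite (ger0_norm (mulr_ge0 _ Gamma0))// -mulrA ler_wpM2l.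
have [L1 hL1] := off_diagonal_decay_average mk k0 kB dk e2.
pose mu t := rho t t.
have mmu : measurable_fun [set: R] mu.
  apply: (measurableT_comp mrho (g := fun t : R => (t, t))).
  exact: measurable_fun_pair.
have mu0 t : 0 <= mu t by exact: (cov_ge0 gZ).
have muB t : `|mu t| <= Gamma by exact: rhoG.
have Mc := @Rintegral_average_cvg _ mu Gamma _ mmu (fun t _ => muB t)
  (@moving_average_var_cvg _ _ _ theta0 H0 H1 n).
have d1 : 0 < Num.sqrt (e / 2) by rewrite sqrtr_gt0.
have [L2 [_ hL2]] := (cvgrPdist_le _ _).1 Mc _ d1.
exists (Num.max L1 (L2 + 1)) => tau tau0 tauL.
have tL1 : L1 <= tau by apply: le_trans tauL; rewrite le_max lexx.
have tL2 : L2 < tau.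
  apply: lt_le_trans tauL; rewrite lt_max; apply/orP; right; lra.
have imu : leb.-integrable `[0, tau] (EFin \o mu).
  apply: (bounded_integrable (B := Gamma)) => //.
    by rewrite /= lebesgue_measure_itv/= lte_fin tau0 -EFinD ltry.
  exact: measurable_funTS.
have mQ : measurable_fun [set: T * R] (fun p => ma n p.1 p.2 ^+ 2).
  exact: measurable_funX.
have ima w := integrable_moving_average2 n w tau.
have mA : measurable_fun [set: T] (fun w => tau^-1 * \int[leb]_(t in `[0, tau]) (ma n w t ^+ 2)).
  by apply: measurable_funM => //; exact: (measurable_Rintegral_itv 0 tau mQ).
have := @average_variance_le _ _ _ _ _ P (uniform_prob tau0) (fun w t => ma n w t ^+ 2)
  mu k (fun w => tau^-1 * \int[leb]_(t in `[0, tau]) (ma n w t ^+ 2))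
  (moving_average_var H theta0 n) (tau^-1 * \int[leb]_(t in `[0, tau]) mu t) (e / 2) mQ
  (fun w t => sqr_ge0 _) mmu mu0 mk k0.
move=> h; apply: (le_trans (h _ _ _ _ _ _ _)).
- by move=> t; have [_ + _] := gZ (moving_average theta0 n t).
- by move=> t s; exact: (gaussian_moment22 gZ (@mixed_cov_sym R H)).
- exact: mA.
- move=> w; apply: average_uniform => //.
    exact: (measurableT_comp mQ (measurable_pair1 w)).
  by move=> t; exact: sqr_ge0.
- exact: average_uniform.
- exact: hL1.
- exact: var_ge0.
rewrite lee_fin; have := hL2 _ tL2; rewrite distrC => {}h.
have : (tau^-1 * \int[leb]_(t in `[0, tau]) mu t - moving_average_var H theta0 n) ^+ 2 <= e / 2.
  rewrite -real_normK ?num_real// -[leRHS](sqr_sqrtr (ltW e2)).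
  by apply: lerXn2r => //; rewrite nnegrE ltW.
lra.
Qed.

Hypothesis iou : forall w tau, leb.-integrable `[0, tau] (EFin \o (fun t => ou w t ^+ 2)).

(** [sqr_diff_le] averaged over time and expectation. The parameter [h] stays free, to be chosen
    small before the step function is refined. *)
Lemma ou_average_error n tau (tau0 : 0 < tau) h : 0 < h ->
  (\int[P]_w (`|tau^-1 * (\int[leb]_(t in `[0, tau]) (ou w t ^+ 2)) -
     tau^-1 * (\int[leb]_(t in `[0, tau]) (ma n w t ^+ 2))|)%:E <=
   (1 + h^-1)%:E * \int[expo]_r (mv `|phi n r - m r|)%:E + (h * Gamma)%:E)%E.
Proof.
move=> h0; set C := (X in (_ <= X)%E).
have h10 : 0 <= 1 + h^-1 by rewrite addr_ge0// invr_ge0 ltW.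
have mo2 : measurable_fun [set: T * R] (fun p => ou p.1 p.2 ^+ 2).
  by apply: measurable_funX; exact: measurable_ou.
have mm2 : measurable_fun [set: T * R] (fun p => ma n p.1 p.2 ^+ 2).
  exact: measurable_funX.
have mdiff : measurable_fun [set: T * R] (fun p => `|ou p.1 p.2 ^+ 2 - ma n p.1 p.2 ^+ 2|).
  by apply: measurableT_comp => //; exact: measurable_funB.
have mdE : measurable_fun [set: T * R] (fun p => (`|ou p.1 p.2 ^+ 2 - ma n p.1 p.2 ^+ 2|)%:E).
  exact/measurable_EFinP.
have dE0 (p : T * R) : (0 <= (`|ou p.1 p.2 ^+ 2 - ma n p.1 p.2 ^+ 2|)%:E)%E by rewrite lee_fin.
apply: (@le_trans _ _ (\int[P]_w \int[uniform_prob tau0]_t (`|ou w t ^+ 2 - ma n w t ^+ 2|)%:E)%E).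
  apply: ge0_le_integral => //.
  - apply/measurable_EFinP; apply: measurableT_comp => //.
    apply: measurable_funB; apply: measurable_funM => //.
      exact: (measurable_Rintegral_itv 0 tau mo2).
    exact: (measurable_Rintegral_itv 0 tau mm2).
  - exact: (measurable_fun_fubini_tonelli_F (m2 := uniform_prob tau0) _ mdE dE0).
  - move=> w _; have id : leb.-integrable `[0, tau] (EFin \o (fun t => ou w t ^+ 2 - ma n w t ^+ 2)).
      by apply: integrable_subr => //; exact: integrable_moving_average2.
    rewrite average_uniform//; last 2 first.
    + exact: (measurableT_comp mdiff (measurable_pair1 w)).
    + by have := integrable_norm id.
    rewrite lee_fin -mulrBr normrM (ger0_norm (ltW _)) ?invr_gt0//.
    rewrite ler_wpM2l ?invr_ge0 ?(ltW tau0)// -RintegralB//; last exact: integrable_moving_average2.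
    exact: le_normr_Rintegral.
have := fubini_tonelli (m1 := P) (m2 := uniform_prob tau0) _ mdE dE0; move=> /= ->.
rewrite -[leRHS](integral_mass1 _ (probability_setT (uniform_prob tau0))).
have C0 : (0 <= C)%E.
  rewrite adde_ge0// ?lee_fin ?mulr_ge0// ?(ltW h0)// mule_ge0// integral_ge0// => r _.
  by rewrite lee_fin mixed_var_ge0.
apply: ge0_le_integral => //.
- by move=> t _; apply: integral_ge0 => w _; exact: (dE0 (w, t)).
- exact: (measurable_fun_fubini_tonelli_G (m1 := P) _ mdE dE0).
- move=> t _.
  have me : measurable_fun [set: T] (fun w => (ou w t - ma n w t) ^+ 2).
    apply: measurable_funX; apply: measurable_funB.
      exact: (measurableT_comp measurable_ou (measurable_pair2 t)).
    exact: (measurableT_comp (mma n) (measurable_pair2 t)).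
  have mo : measurable_fun [set: T] (fun w => ou w t ^+ 2).
    exact: (measurableT_comp mo2 (measurable_pair2 t)).
  apply: (@le_trans _ _ (\int[P]_w ((1 + h^-1) * (ou w t - ma n w t) ^+ 2 + h * ou w t ^+ 2)%:E)%E).
    apply: ge0_le_integral => //.
    + exact: (measurableT_comp mdE (measurable_pair2 t)).
    + by apply/measurable_EFinP; apply: measurable_funD; exact: measurable_funM.
    + by move=> w _; rewrite lee_fin; exact: sqr_diff_le.
  under eq_integral do rewrite EFinD !EFinM.
  rewrite ge0_integralD.
  - apply: leeD.
      rewrite ge0_integralZl.
      + by rewrite lee_wpmul2l ?lee_fin//; exact: ou_error.
      + by [].
      + exact/measurable_EFinP.
      + by move=> w _; rewrite lee_fin sqr_ge0.
      + by rewrite lee_fin.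
    rewrite ge0_integralZl.
    + by rewrite EFinM lee_wpmul2l ?lee_fin ?(ltW h0)//; exact: ou_moment2_le.
    + by [].
    + exact/measurable_EFinP.
    + by move=> w _; rewrite lee_fin sqr_ge0.
    + by rewrite lee_fin ltW.
  - by [].
  - by move=> w _; rewrite -EFinM lee_fin mulr_ge0// sqr_ge0.
  - by apply/measurable_EFinP; exact: measurable_funM.
  - by move=> w _; rewrite -EFinM lee_fin mulr_ge0 ?(ltW h0)// sqr_ge0.
  - by apply/measurable_EFinP; exact: measurable_funM.
Qed.

Lemma ou_average_cvg e : 0 < e ->
  exists L : R, forall (tau : R) (tau0 : 0 < tau), L <= tau ->
    (\int[P]_w (`|tau^-1 * (\int[leb]_(t in `[0, tau]) (ou w t ^+ 2)) - 2^-1 * Gamma|)%:E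
      <= e%:E)%E.
Proof.
(* Five errors of size [a] will occur: two in passing from [ou] to its discretization, one from the
   limit of the variances, two from the fluctuation of the time average. *)
move=> e0; pose a := e / 8; have a0 : 0 < a by rewrite divr_gt0.
have G1 : 0 < Gamma + 1 by rewrite ltr_wpDl.
(* [h] is fixed before [n], because the discretization error is multiplied by [1 + h^-1]. The added
   1 keeps the denominator positive. *)
pose h := a / (Gamma + 1); have h0 : 0 < h by rewrite divr_gt0.
have hi : 0 < 1 + h^-1 by rewrite addr_gt0// invr_gt0.
have hG : h * Gamma <= a.
  by rewrite /h mulrAC ler_pdivrMr// ler_wpM2l ?(ltW a0)// lerDl.
have [n [n1 n2]] : exists n,
    (\int[expo]_r (mv `|phi n r - m r|)%:E <= (a / (1 + h^-1))%:E)%E /\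
    `|2^-1 * Gamma - moving_average_var H theta0 n| <= a.
  have c0 : (\int[expo]_r (mv `|phi k r - m r|)%:E)%E @[k --> \oo] --> (0 : R)%:E.
    exact: moving_average_error_cvg.
  have [c1 c2] := (fine_cvgP _ _).1 c0.
  have c2' := (cvgrPdist_le _ _).1 c2 _ (divr_gt0 a0 hi).
  have c3' := (cvgrPdist_le _ _).1 (@moving_average_var_lim _ _ _ theta0 H0 H1) _ a0.
  near \oo => n; exists n; split; last by near: n; exact: c3'.
  have n1 : (\int[expo]_r (mv `|phi n r - m r|)%:E)%E \is a fin_num by near: n; exact: c1.
  have n2 : `|0 - fine (\int[expo]_r (mv `|phi n r - m r|)%:E)%E| <= a / (1 + h^-1).
    by near: n; exact: c2'.
  rewrite -(fineK n1) lee_fin; apply: le_trans n2.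
  by rewrite sub0r normrN; exact: ler_norm.
have [L hL] := moving_average_average_variance n (exprn_gt0 2 a0).
exists L => tau tau0 Ltau.
have v1 := hL tau tau0 Ltau; have v2 := ou_average_error n tau0 h0.
set x := fun w => tau^-1 * (\int[leb]_(t in `[0, tau]) (ou w t ^+ 2)).
set y := fun w => tau^-1 * (\int[leb]_(t in `[0, tau]) (ma n w t ^+ 2)).
have mx : measurable_fun [set: T] x.
  apply: measurable_funM => //; apply: (measurable_Rintegral_itv 0 tau (f := fun p => ou p.1 p.2 ^+ 2)).
  by apply: measurable_funX; exact: measurable_ou.
have my : measurable_fun [set: T] y.
  apply: measurable_funM => //; apply: (measurable_Rintegral_itv 0 tau (f := fun p => ma n p.1 p.2 ^+ 2)).
  exact: measurable_funX.
set v := moving_average_var H theta0 n in n2 v1 *.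
have mxy : measurable_fun [set: T] (fun w => `|x w - y w|).
  by apply: measurableT_comp => //; exact: measurable_funB.
have myv : measurable_fun [set: T] (fun w => (y w - v) ^+ 2).
  by apply: measurable_funX; exact: measurable_funB.
have ai : 0 < a^-1 by rewrite invr_gt0.
apply: (@le_trans _ _ (\int[P]_w (`|x w - y w| + (2 * a + a^-1 * (y w - v) ^+ 2))%:E)%E).
  apply: ge0_le_integral => //.
  - by apply/measurable_EFinP; apply: measurableT_comp => //; exact: measurable_funB.
  - apply/measurable_EFinP; apply: measurable_funD => //; apply: measurable_funD => //.
    exact: measurable_funM.
  - move=> w _; rewrite lee_fin -/(x w).
    (* [z <= a + z^2 / a] converts the mean-square bound [a^2] into a bound in mean. *)
    have h1 : `|y w - v| <= a + a^-1 * (y w - v) ^+ 2.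
      rewrite -[(y w - v) ^+ 2]real_normK ?num_real//; set z := `|_|.
      have := mulr_ge0 (ltW ai) (sqr_ge0 (z - a)).
      rewrite (_ : a^-1 * (z - a) ^+ 2 = a^-1 * z ^+ 2 - 2 * z + a).
        by have : 0 <= z := normr_ge0 _; lra.
      by field; rewrite gt_eqF.
    rewrite (_ : x w - _ = (x w - y w) + ((y w - v) + (v - 2^-1 * Gamma))); last by ring.
    apply: le_trans (ler_normD _ _) _; rewrite lerD2l.
    apply: le_trans (ler_normD _ _) _; rewrite distrC in n2; lra.
under eq_integral do rewrite EFinD EFinD.
rewrite ge0_integralD.
- apply: (@le_trans _ _ ((2 * a)%:E + (2 * a + a)%:E)%E); last first.
    by rewrite -EFinD lee_fin /a; lra.
  apply: leeD.
    apply: (le_trans v2); rewrite (_ : 2 * a = a + a) ?EFinD; last by lra.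
    apply: leeD; last by rewrite lee_fin.
    apply: le_trans (lee_wpmul2l _ n1) _; first by rewrite lee_fin ltW.
    by rewrite -EFinM lee_fin mulrC divfK// gt_eqF.
  rewrite ge0_integralD.
  + rewrite (integral_mass1 _ (probability_setT P)) EFinD leeD2l//.
    under eq_integral do rewrite EFinM.
    rewrite ge0_integralZl.
    * apply: le_trans (lee_wpmul2l _ v1) _; first by rewrite lee_fin ltW.
      by rewrite -EFinM lee_fin expr2 mulKf// gt_eqF.
    * by [].
    * exact/measurable_EFinP.
    * by move=> w _; rewrite lee_fin sqr_ge0.
    * by rewrite lee_fin ltW.
  + by [].
  + by move=> w _; rewrite lee_fin mulr_ge0// ltW.
  + by [].
  + by move=> w _; rewrite lee_fin mulr_ge0 ?(ltW ai)// sqr_ge0.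
  + by apply/measurable_EFinP; exact: measurable_funM.
- by [].
- by move=> w _; rewrite lee_fin.
- exact/measurable_EFinP.
- move=> w _; rewrite -EFinD lee_fin; apply: addr_ge0; apply: mulr_ge0 => //; try exact: ltW.
  exact: sqr_ge0.
- by apply: emeasurable_funD => //; apply/measurable_EFinP; exact: measurable_funM.
Unshelve. all: by end_near. Qed.

End law_of_large_numbers.

(** * From time averages to the estimator *)

(** After division by [T], the error is [(- y / 2 + b - theta (u - v)) / u]. The first condition on
    [kappa] keeps [u] above [v / 2]; the second makes the numerator at most [eps v / 2]. *)
Lemma lse_error_le (R : realFieldType) (theta v kappa eps x I J T : R) :
  0 < theta -> 0 < v -> 0 < eps -> 0 < T -> 0 <= x ->
  kappa <= v / 2 -> kappa * (2^-1 + theta) <= eps * v / 4 ->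
  `|T^-1 * J + 2^-1 - theta * v| <= eps * v / 4 ->
  `|T^-1 * I - v| + T^-1 * x < kappa ->
  `|- (x / (2 * I)) + J / I + T / (2 * I) - theta| <= eps.
Proof.
move=> th0 v0 e0 T0 x0 k1 k2; set y := T^-1 * x; set u := T^-1 * I; set b := _ - theta * v.
move=> hb h.
have y0 : 0 <= y by rewrite mulr_ge0// invr_ge0 ltW.
have n0 : 0 <= `|u - v| by [].
have uv : `|u - v| < kappa by lra.
have u0 : v / 2 <= u.
  by move: uv; rewrite ltr_norml => /andP[? _]; lra.
have up : 0 < u by lra.
have IE : I = T * u by rewrite /u mulVKf// gt_eqF.
have I0 : 0 < I by rewrite IE mulr_gt0.
have -> : - (x / (2 * I)) + J / I + T / (2 * I) - theta =
    (- (2^-1 * y) + b - theta * (u - v)) / u.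
  by rewrite /b /y /u; field; rewrite !gt_eqF.
rewrite normrM normfV (gtr0_norm up) ler_pdivrMr//.
apply: le_trans (ler_normB _ _) _; rewrite normrM (gtr0_norm th0).
have h1 : `|- (2^-1 * y) + b| <= 2^-1 * y + eps * v / 4.
  apply: le_trans (ler_normD _ _) _; rewrite normrN (ger0_norm (mulr_ge0 _ y0))//.
  by rewrite lerD2l.
have h2 : theta * `|u - v| <= theta * kappa by rewrite ler_wpM2l// ltW.
have h3 : eps * (v / 2) <= eps * u by rewrite ler_wpM2l// ltW.
have y1 : y <= kappa by lra.
lra.
Qed.

Lemma markov_le d (T : measurableType d) (R : realType) (P : probability T R)
    (g : T -> R) (A : set T) (kappa e : R) :
  measurable_fun [set: T] g -> (forall w, 0 <= g w) -> measurable A -> 0 < kappa ->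
  (forall w, A w -> kappa <= g w) -> (\int[P]_w (g w)%:E <= (kappa * e)%:E)%E ->
  (P A <= e%:E)%E.
Proof.
move=> mg g0 mA k0 Ag ge.
rewrite -(@lee_pmul2l _ kappa%:E)// ?lte_fin// -EFinM; apply: le_trans ge.
rewrite -[X in (P X)]setIT -integral_indic// -ge0_integralZl//.
- apply: ge0_le_integral => //.
  + by move=> w _; rewrite -EFinM lee_fin mulr_ge0 ?(ltW k0)// indicE.
  + apply: emeasurable_funM => //; apply/measurable_EFinP; exact: measurable_indic.
  + exact/measurable_EFinP.
  + move=> w _; rewrite -EFinM lee_fin indicE; have [/set_mem /Ag h|_] := boolP (w \in A).
      by rewrite mulr1.
    by rewrite mulr0.
- by apply/measurable_EFinP; exact: measurable_indic.
- by rewrite lee_fin ltW.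
Qed.

Theorem theorem3p2 (R : realType) (d : measure_display) (Omega : measurableType d)
  (P : probability Omega R) (theta H : R)
  (W S X : Omega -> R -> R) :
  0 < theta -> 2^-1 < H -> H < 1 ->
  brownian_motion P W ->
  subfbm P H S ->
  indep_processes P W S ->
  (* X is the (continuous) solution of dX_t = -theta X_t dt + d xi_t, X_0 = 0,
     with xi = W + S the mixed sub-fractional Brownian motion *)
  (forall w, {within [set t | 0 <= t], continuous (X w)}) ->
  (forall w t, 0 <= t ->
     X w t = (W w t + S w t) - theta * Rintegral lebesgue_measure `[0, t] (X w)) ->
  forall eps : R, 0 < eps ->
    (fun T : R => P [set w | eps < `|lse theta H X T w - theta|])
      @ +oo --> 0%E.
Proof.
move=> theta0 H0 H1 [gW [W0 cW]] [gS [S0 cS]] indep cX XE eps eps0.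
pose Z w t := W w (Num.max t 0) + S w (Num.max t 0).
have gZ : has_gaussian_moments P Z (mixed_cov H).
  have := mixed_gaussian_moments gW gS indep; congr (has_gaussian_moments _ _ _).
  apply/funext => t; apply/funext => s; rewrite /mixed_cov /pos_cov frac_cov1//;
    by rewrite le_max lexx orbT.
have cZ w : continuous (Z w).
  by move=> t; apply: cvgD; apply: continuous_comp_max0.
have Z0 w (t : R) : t <= 0 -> Z w t = 0.
  by move=> t0; rewrite /Z max_r// W0 S0 addr0.
(* Only values of [X] at nonnegative times enter the estimator; there it coincides with [ou], whose
   measurability and moments are known. *)
have XoU w (t : R) : 0 <= t -> X w t = ou theta0 Z w t.
  apply: (ou_representation theta0 (@cZ w) (@Z0 w) (cX w)) => {}t t0.
  by rewrite XE// /Z max_l.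
have iou w tau : leb.-integrable `[0, tau] (EFin \o (fun t => ou theta0 Z w t ^+ 2)).
  have : leb.-integrable `[0, tau] (EFin \o (fun t => X w (Num.max t 0) ^+ 2)).
    apply: continuous_compact_integrable; first exact: segment_compact.
    apply: continuous_subspaceT => t.
    rewrite /continuous_at expr2; under eq_fun do rewrite expr2.
    by apply: cvgM; exact: continuous_comp_max0.
  apply: eq_integrable => // t; rewrite inE/= in_itv/= => /andP[t0 _].
  by rewrite /= -XoU// max_l.
have IE w tau : Rintegral leb `[0, tau] (fun t => X w t ^+ 2) =
    \int[leb]_(t in `[0, tau]) (ou theta0 Z w t ^+ 2).
  by apply: eq_Rintegral => t; rewrite inE/= in_itv/= => /andP[t0 _]; rewrite XoU.
pose Gamma := ou_bound H theta0; pose v := 2^-1 * Gamma.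
have M2fin : exp_moment theta0 (2 * H) \is a fin_num by apply: exp_moment_fin; lra.
have GammaE : Gamma = theta^-1 + fine (exp_moment theta0 (2 * H)).
  by rewrite /Gamma /ou_bound exp_moment1 fineD.
have G0 : 0 < Gamma.
  by rewrite GammaE ltr_pwDl ?invr_gt0// fine_ge0// exp_moment_ge0.
have v0 : 0 < v by rewrite mulr_gt0.
have ev0 : 0 < eps * v / 4 by rewrite !mulr_gt0.
(* The largest value meeting both conditions of [lse_error_le]. *)
pose kappa := Num.min (v / 2) (eps * v / 4 / (2^-1 + theta)).
have th2 : 0 < 2^-1 + theta by rewrite addr_gt0.
have k0 : 0 < kappa by rewrite lt_min (divr_gt0 v0)// (divr_gt0 ev0).
have k1 : kappa <= v / 2 by rewrite ge_min lexx.
have k2 : kappa * (2^-1 + theta) <= eps * v / 4.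
  by rewrite -ler_pdivlMr// ge_min lexx orbT.
have cJ := @double_kernel_integral_cvg R theta H theta0 H0 H1.
have thv : theta * v = 2^-1 + 2^-1 * theta * fine (exp_moment theta0 (2 * H)).
  by rewrite /v GammaE; field; rewrite gt_eqF.
have mX2 : measurable_fun [set: Omega * R] (fun p => ou theta0 Z p.1 p.2 ^+ 2).
  by apply: measurable_funX; exact: measurable_ou.
have mX2t t : measurable_fun [set: Omega] (fun w => ou theta0 Z w t ^+ 2).
  exact: (measurableT_comp mX2 (measurable_pair2 t)).
have mI tau : measurable_fun [set: Omega]
    (fun w => \int[leb]_(t in `[0, tau]) (ou theta0 Z w t ^+ 2)).
  exact: (measurable_Rintegral_itv 0 tau mX2).
have I0 w tau : 0 <= \int[leb]_(t in `[0, tau]) (ou theta0 Z w t ^+ 2).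
  by apply: Rintegral_ge0 => t _; exact: sqr_ge0.
have mlse tau : 0 <= tau -> measurable_fun [set: Omega] (lse theta H X tau).
  (* The reciprocal is written as a power with exponent -1, which is measurable; the two agree on
     nonnegative numbers, zero included. *)
  move=> tau0; rewrite (_ : lse theta H X tau = fun w =>
      (- (2^-1 * ou theta0 Z w tau ^+ 2) + alpha_H H * double_kernel_integral theta H tau + tau / 2) *
      (\int[leb]_(t in `[0, tau]) (ou theta0 Z w t ^+ 2)) `^ (-1)); last first.
    apply/funext => w; rewrite /lse IE XoU// powR_inv1// !invfM.
    ring.
  apply: measurable_funM.
    apply: measurable_funD => //; apply: measurable_funD => //.
    by apply: measurableT_comp => //; exact: measurable_funM.
  exact: (measurableT_comp (measurable_powR (-1)) (mI tau)).
pose A T := [set w | eps < `|lse theta H X T w - theta|].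
have mA T : 0 <= T -> measurable (A T).
  move=> T0; have mf : measurable_fun [set: Omega] (fun w => `|lse theta H X T w - theta|).
    by apply: measurableT_comp => //; apply: measurable_funB => //; exact: mlse.
  rewrite -[A T]setTI (_ : A T = (fun w => `|lse theta H X T w - theta|) @^-1` `]eps, +oo[).
    by apply: mf.
  by apply/seteqP; split => w; rewrite /A/= in_itv/= andbT.
have bound e : 0 < e -> \forall T \near +oo, (P (A T) <= e%:E)%E.
  move=> e0.
  (* Half of the Markov budget goes to each of the two summands of [g]. *)
  have ke : 0 < kappa * e / 2 by rewrite !mulr_gt0.
  have [L hL] := ou_average_cvg H0 H1 gZ cZ Z0 iou ke.
  near=> T.
  have T0 : 0 < T by near: T; exact: nbhs_pinfty_gt.
  have LT : L <= T by near: T; apply: nbhs_pinfty_ge; exact: num_real.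
  (* Makes the mean of [X_T^2 / T], at most [Gamma / T], fit into its half of the budget. *)
  have GT : Gamma / (kappa * e / 2) <= T by near: T; apply: nbhs_pinfty_ge; exact: num_real.
  have JT : `|2^-1 * theta * fine (exp_moment theta0 (2 * H)) -
      T^-1 * (alpha_H H * double_kernel_integral theta H T)| <= eps * v / 4.
    by near: T; exact: ((cvgrPdist_le _ _).1 cJ _ ev0).
  have Ti : 0 < T^-1 by rewrite invr_gt0.
  pose g w := `|T^-1 * (\int[leb]_(t in `[0, T]) (ou theta0 Z w t ^+ 2)) - v| +
    T^-1 * ou theta0 Z w T ^+ 2.
  have m1 : measurable_fun [set: Omega]
      (fun w => `|T^-1 * (\int[leb]_(t in `[0, T]) (ou theta0 Z w t ^+ 2)) - v|).
    by apply: measurableT_comp => //; apply: measurable_funB => //; exact: measurable_funM.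
  have m2 : measurable_fun [set: Omega] (fun w => T^-1 * ou theta0 Z w T ^+ 2).
    exact: measurable_funM.
  apply: (@markov_le _ _ _ P g (A T) kappa e) => //.
  - exact: measurable_funD.
  - by move=> w; rewrite addr_ge0// mulr_ge0 ?sqr_ge0// ltW.
  - exact: mA (ltW T0).
  (* Where [g < kappa], the error is at most [eps] by a deterministic estimate. *)
  - move=> w; rewrite /A/= => Aw; rewrite leNgt; apply/negP => gk.
    move: Aw; rewrite ltNge => /negP; apply.
    rewrite /lse IE XoU ?(ltW T0)//.
    apply: (@lse_error_le _ theta v kappa) => //; first exact: sqr_ge0.
    rewrite thv (_ : _ - _ = - (2^-1 * theta * fine (exp_moment theta0 (2 * H)) -
      T^-1 * (alpha_H H * double_kernel_integral theta H T))) ?normrN//; ring.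
  - rewrite /g; under eq_integral do rewrite EFinD.
    rewrite ge0_integralD.
    + rewrite (_ : kappa * e = kappa * e / 2 + kappa * e / 2) ?EFinD; last by lra.
      apply: leeD; first exact: hL.
      under eq_integral do rewrite EFinM.
      rewrite ge0_integralZl.
      * have o2 := ou_moment2_le theta0 H0 H1 gZ cZ Z0 T.
        have Ti0 : (0 <= (T^-1)%:E)%E by rewrite lee_fin ltW.
        apply: le_trans (lee_wpmul2l Ti0 o2) _.
        by rewrite -EFinM lee_fin ler_pdivrMl// mulrC -ler_pdivrMl// mulrC.
      * by [].
      * exact/measurable_EFinP.
      * by move=> w _; rewrite lee_fin sqr_ge0.
      * by rewrite lee_fin ltW.
    + by [].
    + by move=> w _; rewrite lee_fin.
    + exact/measurable_EFinP.
    + by move=> w _; rewrite lee_fin mulr_ge0 ?(ltW Ti)// sqr_ge0.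
    + exact/measurable_EFinP.
apply/fine_cvgP; split.
  near=> T; apply: fin_num_measure; apply: mA.
  by near: T; apply: nbhs_pinfty_ge; exact: num_real.
apply/cvgrPdist_le => /= e e0; near=> T.
rewrite sub0r normrN ger0_norm ?fine_ge0// -lee_fin fineK.
  by near: T; exact: bound.
apply: fin_num_measure; apply: mA.
by near: T; apply: nbhs_pinfty_ge; exact: num_real.
Unshelve. all: by end_near. Qed.
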